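(* Let $q$ be a prime number and let $\mathcal{C}$ be a $\mathbb{Z}_q$-extension of a pointed fusion category. Assume in addition that $\mathcal{C}$ is modular. Then $\mathcal{C}$ fits into one of the following classes: (1) $\mathcal{C}$ is pointed; (2) $\mathcal{C}\cong\mathcal{B}\boxtimes\mathcal{I}$, that is, $\mathcal{C}$ is equivalent to a Deligne tensor product $\mathcal{B}\boxtimes\mathcal{I}$, where $\mathcal{B}$ is a pointed modular category and $\mathcal{I}$ is an Ising category.
   Context: All fusion categories are over an algebraically closed field $k$ of characteristic $0$: a fusion category is a $k$-linear semisimple rigid tensor category with finitely many isomorphism classes of simple objects, finite-dimensional morphism spaces, and simple unit object. A fusion category is pointed if all its simple objects are invertible. The symbol $\boxtimes$ denotes the Deligne tensor product. A $G$-grading on a fusion category $\mathcal{C}$ ($G$ a finite group with identity element written $0$) is a decomposition $\mathcal{C}=\oplus_{g\in G}\mathcal{C}_g$ as a direct sum of full abelian subcategories such that duality sends $\mathcal{C}_g$ into $\mathcal{C}_{g^{-1}}$ and $\otimes$ maps $\mathcal{C}_g\times\mathcal{C}_h$ into $\mathcal{C}_{gh}$. It is faithful if $\mathcal{C}_g\neq 0$ for all $g\in G$. $\mathcal{C}$ is a $G$-extension of $\mathcal{D}$ if it has a faithful $G$-grading with $\mathcal{C}_0=\mathcal{D}$. A braided fusion category $\mathcal{C}$ with braiding $c$ is non-degenerate if its Müger center $\{X\in\mathcal{C} : c_{Y,X}c_{X,Y}=\mathrm{id}_{X\otimes Y}\ \text{for all } Y\in\mathcal{C}\}$ is trivial (consists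 of direct sums of the unit object). A modular category is a non-degenerate braided fusion category with a spherical structure. A braided fusion category of integer Frobenius-Perron dimension (such as any braided extension of a pointed fusion category) always has a spherical structure, so it is modular if and only if it is non-degenerate. An Ising category is a non-pointed fusion category whose group of isomorphism classes of invertible objects has order $2$ and which has, up to isomorphism, exactly one non-invertible simple object $X$, with $X\otimes X$ the direct sum of the two invertible objects (so $X$ has Frobenius-Perron dimension $\sqrt2$ and the category has Frobenius-Perron dimension $4$). *)

(* Defs.v *)
From mathcomp Require Import all_boot all_order all_algebra all_fingroup.

Set Implicit Arguments.
Unset Strict Implicit.
Unset Printing Implicit Defensive.

Import GRing.Theory.
Local Open Scope ring_scope.

Declare Scope cat_scope.
Delimit Scope cat_scope with cat.
Local Open Scope cat_scope.

Reserved Notation "g ∘ f" (at level 40, left associativity).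
Reserved Notation "X ⊗ Y" (at level 39, left associativity).
Reserved Notation "f ⊗m g" (at level 39, left associativity).
Reserved Notation "X ≅ Y" (at level 70, no associativity).

(* Morphism spaces are finite-dimensional: [vectType] is MathComp's structure
   of finite-dimensional vector spaces. *)
Record lincat (k : fieldType) := LinCat {
  obj :> Type;
  hom : obj -> obj -> vectType k;
  idm : forall X, hom X X;
  comp : forall X Y Z, hom Y Z -> hom X Y -> hom X Z;
  comp_linearl : forall X Y Z (f : hom X Y),
    linear (fun g : hom Y Z => comp g f);
  comp_linearr : forall X Y Z (g : hom Y Z),
    linear (fun f : hom X Y => comp g f);
  comp1m : forall X Y (f : hom X Y), comp (idm Y) f = f;
  compm1 : forall X Y (f : hom X Y), comp f (idm X) = f;
  compA : forall X Y Z W (h : hom Z W) (g : hom Y Z) (f : hom X Y),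
    comp h (comp g f) = comp (comp h g) f
}.
Arguments hom {k l} X Y.
Arguments idm {k l} X.
Arguments comp {k l X Y Z} g f.

Notation "g ∘ f" := (comp g f) : cat_scope.

Record iso (k : fieldType) (C : lincat k) (X Y : C) := Iso {
  fwd :> hom X Y;
  bwd : hom Y X;
  bwdK : bwd ∘ fwd = idm X;
  fwdK : fwd ∘ bwd = idm Y
}.
Arguments bwd {k C X Y} i.

Notation "X ≅ Y" := (inhabited (iso X Y)) : cat_scope.

Section Abelian.
Variables (k : fieldType) (C : lincat k).

Definition is_zero (X : C) : Prop :=
  forall Y, (forall f : hom X Y, f = 0) /\ (forall f : hom Y X, f = 0).

Definition is_mono (X Y : C) (f : hom X Y) : Prop :=
  forall Z (g h : hom Z X), f ∘ g = f ∘ h -> g = h.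

Definition is_epi (X Y : C) (f : hom X Y) : Prop :=
  forall Z (g h : hom Y Z), g ∘ f = h ∘ f -> g = h.

Definition is_ker (X Y K : C) (f : hom X Y) (i : hom K X) : Prop :=
  f ∘ i = 0 /\
  forall Z (g : hom Z X), f ∘ g = 0 -> exists! h : hom Z K, i ∘ h = g.

Definition is_coker (X Y Q : C) (f : hom X Y) (p : hom Y Q) : Prop :=
  p ∘ f = 0 /\
  forall Z (g : hom Y Z), g ∘ f = 0 -> exists! h : hom Q Z, h ∘ p = g.

(* [X] is the direct sum (biproduct) of the family [Y]. *)
Definition is_dsum (I : finType) (Y : I -> C) (X : C) : Prop :=
  exists (inj : forall i, hom (Y i) X) (pr : forall i, hom X (Y i)),
    [/\ forall i, pr i ∘ inj i = idm (Y i),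
        forall i j, i != j -> pr j ∘ inj i = 0
      & \sum_i inj i ∘ pr i = idm X].

Definition is_dsum2 (X1 X2 X : C) : Prop :=
  is_dsum (fun b : bool => if b then X1 else X2) X.

Record abelian : Prop := Abelian {
  ab_zero : exists Z : C, is_zero Z;
  ab_dsum : forall X Y : C, exists Z, is_dsum2 X Y Z;
  ab_ker : forall (X Y : C) (f : hom X Y), exists K (i : hom K X), is_ker f i;
  ab_coker : forall (X Y : C) (f : hom X Y),
    exists Q (p : hom Y Q), is_coker f p;
  ab_mono : forall (X Y : C) (f : hom X Y), is_mono f ->
    exists Z (g : hom Y Z), is_ker g f;
  ab_epi : forall (X Y : C) (f : hom X Y), is_epi f ->
    exists Z (g : hom Z X), is_coker g f
}.

Definition simple (X : C) : Prop :=
  ~ is_zero X /\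
  forall Y (i : hom Y X), is_mono i ->
    is_zero Y \/ exists j : iso Y X, fwd j = i.

Definition semisimple : Prop :=
  forall X : C, exists (n : nat) (S : 'I_n -> C),
    (forall i, simple (S i)) /\ is_dsum S X.

Definition finitely_many_simples : Prop :=
  exists (n : nat) (S : 'I_n -> C),
    forall X, simple X -> exists i, X ≅ S i.

(* Full subcategories, given by their objects, which are closed under
   isomorphism and are abelian with exact inclusion. *)
Record full_abelian_subcat (P : C -> Prop) : Prop := FullAbelianSubcat {
  fas_iso : forall X Y, X ≅ Y -> P X -> P Y;
  fas_zero : forall X, is_zero X -> P X;
  fas_dsum : forall X Y Z, is_dsum2 X Y Z -> P X -> P Y -> P Z;
  fas_ker : forall X Y K (f : hom X Y) (i : hom K X),
    is_ker f i -> P X -> P Y -> P K;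
  fas_coker : forall X Y Q (f : hom X Y) (p : hom Y Q),
    is_coker f p -> P X -> P Y -> P Q
}.

End Abelian.

Record functor (k : fieldType) (C D : lincat k) := Functor {
  fob :> C -> D;
  fmap : forall X Y, hom X Y -> hom (fob X) (fob Y);
  fmap_linear : forall X Y, linear (@fmap X Y);
  fmap1 : forall X, fmap (idm X) = idm (fob X);
  fmap_comp : forall X Y Z (g : hom Y Z) (f : hom X Y),
    fmap (g ∘ f) = fmap g ∘ fmap f
}.
Arguments fmap {k C D} F {X Y} f : rename.

Record bifunctor (k : fieldType) (B C D : lincat k) := Bifunctor {
  bob :> B -> C -> D;
  bmap : forall X X' Y Y', hom X X' -> hom Y Y' -> hom (bob X Y) (bob X' Y');
  bmap_linearl : forall X X' Y Y' (g : hom Y Y'),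
    linear (fun f : hom X X' => bmap f g);
  bmap_linearr : forall X X' Y Y' (f : hom X X'),
    linear (fun g : hom Y Y' => bmap f g);
  bmap1 : forall X Y, bmap (idm X) (idm Y) = idm (bob X Y);
  bmap_comp : forall X X' X'' Y Y' Y'' (f' : hom X' X'') (f : hom X X')
      (g' : hom Y' Y'') (g : hom Y Y'),
    bmap (f' ∘ f) (g' ∘ g) = bmap f' g' ∘ bmap f g
}.
Arguments bmap {k B C D} T {X X' Y Y'} f g : rename.

Section Functors.
Variable k : fieldType.

Definition natural (C D : lincat k) (F G : functor C D)
    (s : forall X, hom (F X) (G X)) : Prop :=
  forall X Y (f : hom X Y), s Y ∘ fmap F f = fmap G f ∘ s X.

Definition fully_faithful (C D : lincat k) (F : functor C D) : Prop :=
  forall X Y, bijective (@fmap k C D F X Y).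

Definition ess_image (C D : lincat k) (F : functor C D) (Y : D) : Prop :=
  exists X : C, F X ≅ Y.

Definition ess_surjective (C D : lincat k) (F : functor C D) : Prop :=
  forall Y, ess_image F Y.

(* For linear functors between abelian categories, right exactness is
   preservation of cokernels. *)
Definition right_exact (C D : lincat k) (F : functor C D) : Prop :=
  forall X Y Q (f : hom X Y) (p : hom Y Q),
    is_coker f p -> is_coker (fmap F f) (fmap F p).

Definition right_exact2 (B C D : lincat k) (T : bifunctor B C D) : Prop :=
  (forall X X' Q Y (f : hom X X') (p : hom X' Q), is_coker f p ->
     is_coker (bmap T f (idm Y)) (bmap T p (idm Y))) /\
  (forall X Y Y' Q (g : hom Y Y') (p : hom Y' Q), is_coker g p ->
     is_coker (bmap T (idm X) g) (bmap T (idm X) p)).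

(* [T : B x C -> E] exhibits [E] as the Deligne tensor product of [B] and [C]:
   for every abelian [A], restriction along [T] is an equivalence from the
   category of right exact functors [E -> A] to the category of bifunctors
   [B x C -> A] that are right exact in each variable. The two halves are
   essential surjectivity and full faithfulness of this restriction. *)
Definition is_deligne (B C E : lincat k) (T : bifunctor B C E) : Prop :=
  [/\ abelian E, right_exact2 T
    & forall A : lincat k, abelian A ->
      (forall F : bifunctor B C A, right_exact2 F ->
         exists F' : functor E A, right_exact F' /\
         exists u : forall X Y, iso (F' (T X Y)) (F X Y),
           forall X X' Y Y' (f : hom X X') (g : hom Y Y'),
             u X' Y' ∘ fmap F' (bmap T f g) = bmap F f g ∘ u X Y)
      /\
      (forall F G : functor E A, right_exact F -> right_exact G ->
         forall t : (forall X Y, hom (F (T X Y)) (G (T X Y))),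
           (forall X X' Y Y' (f : hom X X') (g : hom Y Y'),
              t X' Y' ∘ fmap F (bmap T f g) = fmap G (bmap T f g) ∘ t X Y) ->
         exists s : forall Z, hom (F Z) (G Z),
           [/\ natural s, forall X Y, s (T X Y) = t X Y
             & forall s', natural s' -> (forall X Y, s' (T X Y) = t X Y) ->
               forall Z, s' Z = s Z])].

End Functors.

Record moncat (k : fieldType) := MonCat {
  mlin :> lincat k;
  tens : bifunctor mlin mlin mlin;
  unit_ : mlin;
  asc : forall X Y Z, iso (tens (tens X Y) Z) (tens X (tens Y Z));
  lu : forall X, iso (tens unit_ X) X;
  ru : forall X, iso (tens X unit_) X;
  asc_nat : forall X X' Y Y' Z Z'
      (f : hom X X') (g : hom Y Y') (h : hom Z Z'),
    asc X' Y' Z' ∘ bmap tens (bmap tens f g) h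
      = bmap tens f (bmap tens g h) ∘ asc X Y Z;
  lu_nat : forall X Y (f : hom X Y),
    lu Y ∘ bmap tens (idm unit_) f = f ∘ lu X;
  ru_nat : forall X Y (f : hom X Y),
    ru Y ∘ bmap tens f (idm unit_) = f ∘ ru X;
  pentagon : forall X Y Z W,
    asc X Y (tens Z W) ∘ asc (tens X Y) Z W
      = bmap tens (idm X) (asc Y Z W) ∘ asc X (tens Y Z) W
          ∘ bmap tens (asc X Y Z) (idm W);
  triangle : forall X Y,
    bmap tens (idm X) (lu Y) ∘ asc X unit_ Y = bmap tens (ru X) (idm Y)
}.
Arguments tens {k} m.
Arguments unit_ {k m}.
Arguments asc {k m} X Y Z.
Arguments lu {k m} X.
Arguments ru {k m} X.

Notation "X ⊗ Y" := (tens _ X Y) : cat_scope.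
Notation "f ⊗m g" := (bmap (tens _) f g) : cat_scope.

Definition invertible (k : fieldType) (C : moncat k) (X : C) : Prop :=
  exists Y : C, (X ⊗ Y ≅ unit_) /\ (Y ⊗ X ≅ unit_).

Definition pointed (k : fieldType) (C : moncat k) : Prop :=
  forall X : C, simple X -> invertible X.

(* [Y] is a left dual of [X] (equivalently, [X] is a right dual of [Y]). *)
Definition is_dual (k : fieldType) (C : moncat k) (X Y : C)
    (e : hom (Y ⊗ X) unit_) (d : hom unit_ (X ⊗ Y)) : Prop :=
  ru X ∘ (idm X ⊗m e) ∘ asc X Y X ∘ (d ⊗m idm X) = lu X /\
  lu Y ∘ (e ⊗m idm Y) ∘ bwd (asc Y X Y) ∘ (idm Y ⊗m d) = ru Y.

Section MonoidalFunctors.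
Variable k : fieldType.

Definition is_monoidal (C D : moncat k) (F : functor C D)
    (J : forall X Y, iso (F X ⊗ F Y) (F (X ⊗ Y)))
    (J0 : iso unit_ (F unit_)) : Prop :=
  [/\ forall X X' Y Y' (f : hom X X') (g : hom Y Y'),
        J X' Y' ∘ (fmap F f ⊗m fmap F g) = fmap F (f ⊗m g) ∘ J X Y,
      forall X Y Z,
        fmap F (asc X Y Z) ∘ J (X ⊗ Y) Z ∘ (J X Y ⊗m idm (F Z))
          = J X (Y ⊗ Z) ∘ (idm (F X) ⊗m J Y Z) ∘ asc (F X) (F Y) (F Z),
      forall X,
        fmap F (lu X) ∘ J unit_ X ∘ (J0 ⊗m idm (F X)) = lu (F X)
    & forall X,
        fmap F (ru X) ∘ J X unit_ ∘ (idm (F X) ⊗m J0) = ru (F X)].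

(* The same axioms for a bifunctor [T], seen as a functor on the product
   category [B x C] with its componentwise tensor product. *)
Definition is_monoidal2 (B C D : moncat k) (T : bifunctor B C D)
    (J : forall X Y X' Y', iso (T X Y ⊗ T X' Y') (T (X ⊗ X') (Y ⊗ Y')))
    (J0 : iso unit_ (T unit_ unit_)) : Prop :=
  [/\ forall X1 X1' Y1 Y1' X2 X2' Y2 Y2' (f1 : hom X1 X1') (g1 : hom Y1 Y1')
          (f2 : hom X2 X2') (g2 : hom Y2 Y2'),
        J X1' Y1' X2' Y2' ∘ (bmap T f1 g1 ⊗m bmap T f2 g2)
          = bmap T (f1 ⊗m f2) (g1 ⊗m g2) ∘ J X1 Y1 X2 Y2,
      forall X1 Y1 X2 Y2 X3 Y3,
        bmap T (asc X1 X2 X3) (asc Y1 Y2 Y3) ∘ J (X1 ⊗ X2) (Y1 ⊗ Y2) X3 Y3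
            ∘ (J X1 Y1 X2 Y2 ⊗m idm (T X3 Y3))
          = J X1 Y1 (X2 ⊗ X3) (Y2 ⊗ Y3) ∘ (idm (T X1 Y1) ⊗m J X2 Y2 X3 Y3)
              ∘ asc (T X1 Y1) (T X2 Y2) (T X3 Y3),
      forall X Y,
        bmap T (lu X) (lu Y) ∘ J unit_ unit_ X Y ∘ (J0 ⊗m idm (T X Y))
          = lu (T X Y)
    & forall X Y,
        bmap T (ru X) (ru Y) ∘ J X Y unit_ unit_ ∘ (idm (T X Y) ⊗m J0)
          = ru (T X Y)].

End MonoidalFunctors.

Record fusion (k : fieldType) := Fusion {
  fmon :> moncat k;
  dual : fmon -> fmon;
  ev : forall X, hom (dual X ⊗ X) unit_;
  coev : forall X, hom unit_ (X ⊗ dual X);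
  dualP : forall X, is_dual (ev X) (coev X);
  right_dualP : forall X : fmon,
    exists (Y : fmon) (e : hom (X ⊗ Y) unit_) (d : hom unit_ (Y ⊗ X)),
      is_dual e d;
  fusion_abelian : abelian fmon;
  fusion_semisimple : semisimple fmon;
  fusion_finite : finitely_many_simples fmon;
  fusion_unit : simple (unit_ : fmon)
}.
Arguments dual {k f} X.
Arguments ev {k f} X.
Arguments coev {k f} X.

Section Gradings.
Variables (k : fieldType) (gT : finGroupType) (C : fusion k).

Record grading (P : gT -> C -> Prop) : Prop := Grading {
  gr_sub : forall g, full_abelian_subcat (P g);
  gr_orth : forall g h X Y, g != h -> P g X -> P h Y ->
    forall f : hom X Y, f = 0;
  gr_sum : forall X : C, exists Y : gT -> C,
    (forall g, P g (Y g)) /\ is_dsum Y X;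
  gr_dual : forall g X, P g X -> P g^-1%g (dual X);
  gr_tens : forall g h X Y, P g X -> P h Y -> P (g * h)%g (X ⊗ Y)
}.

Definition faithful_grading (P : gT -> C -> Prop) : Prop :=
  grading P /\ forall g, exists X, P g X /\ ~ is_zero X.

(* [D] is identified with the trivial component through a fully faithful
   tensor functor. *)
Definition extension_of (D : fusion k) : Prop :=
  exists P : gT -> C -> Prop, faithful_grading P /\
  exists (F : functor D C) (J : forall X Y, iso (F X ⊗ F Y) (F (X ⊗ Y)))
         (J0 : iso unit_ (F unit_)),
    [/\ is_monoidal J J0, fully_faithful F
      & forall X, P 1%g X <-> ess_image F X].

End Gradings.
Arguments extension_of {k} gT C D.

Section Duality.
Variables (k : fieldType) (C : fusion k).

(* The morphism [h : Z -> W^*] characterised by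
   [ev W ∘ (h ⊗m idm W) = g]. *)
Definition curry (Z W : C) (g : hom (Z ⊗ W) unit_) : hom Z (dual W) :=
  lu (dual W) ∘ (g ⊗m idm (dual W)) ∘ bwd (asc Z W (dual W))
    ∘ (idm Z ⊗m coev W) ∘ bwd (ru Z).

Definition dualm (X Y : C) (f : hom X Y) : hom (dual Y) (dual X) :=
  curry (ev Y ∘ (idm (dual Y) ⊗m f)).

Definition dual_tens (X Y : C) : hom (dual Y ⊗ dual X) (dual (X ⊗ Y)) :=
  curry (ev Y
    ∘ (idm (dual Y) ⊗m
        (lu Y ∘ (ev X ⊗m idm Y) ∘ bwd (asc (dual X) X Y)))
    ∘ asc (dual Y) (dual X) (X ⊗ Y)).

(* A monoidal natural isomorphism from the identity to the double dual. The
   monoidal structure of the double dual is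
   [(dualm (dual_tens X Y))^-1 ∘ dual_tens (dual Y) (dual X)]; compatibility
   with units is automatic since the components are invertible. *)
Definition is_pivotal (a : forall X : C, iso X (dual (dual X))) : Prop :=
  (forall X Y (f : hom X Y), a Y ∘ f = dualm (dualm f) ∘ a X) /\
  (forall X Y, dualm (dual_tens X Y) ∘ a (X ⊗ Y)
                 = dual_tens (dual Y) (dual X) ∘ (a X ⊗m a Y)).

Definition qdim (a : forall X : C, iso X (dual (dual X))) (X : C) :
    hom (unit_ : C) unit_ :=
  ev (dual X) ∘ (a X ⊗m idm (dual X)) ∘ coev X.

Definition is_spherical (a : forall X : C, iso X (dual (dual X))) : Prop :=
  is_pivotal a /\ forall X, qdim a X = qdim a (dual X).

End Duality.

Record bfusion (k : fieldType) := BFusion {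
  bfus :> fusion k;
  braid : forall X Y : bfus, iso (X ⊗ Y) (Y ⊗ X);
  braid_nat : forall (X X' Y Y' : bfus) (f : hom X X') (g : hom Y Y'),
    braid X' Y' ∘ (f ⊗m g) = (g ⊗m f) ∘ braid X Y;
  hexagon1 : forall X Y Z : bfus,
    asc Y Z X ∘ braid X (Y ⊗ Z) ∘ asc X Y Z
      = (idm Y ⊗m braid X Z) ∘ asc Y X Z ∘ (braid X Y ⊗m idm Z);
  hexagon2 : forall X Y Z : bfus,
    bwd (asc Z X Y) ∘ braid (X ⊗ Y) Z ∘ bwd (asc X Y Z)
      = (braid X Z ⊗m idm Y) ∘ bwd (asc X Z Y) ∘ (idm X ⊗m braid Y Z)
}.
Arguments braid {k b} X Y.

Section Braided.
Variable k : fieldType.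

Definition muger_central (C : bfusion k) (X : C) : Prop :=
  forall Y : C, braid Y X ∘ braid X Y = idm (X ⊗ Y).

Definition nondegenerate (C : bfusion k) : Prop :=
  forall X : C, muger_central X ->
    exists n : nat, is_dsum (fun _ : 'I_n => unit_ : C) X.

Definition modular (C : bfusion k) : Prop :=
  nondegenerate C /\
  exists a : (forall X : C, iso X (dual (dual X))), is_spherical a.

Definition braided_equivalent (C D : bfusion k) : Prop :=
  exists (F : functor C D) (J : forall X Y, iso (F X ⊗ F Y) (F (X ⊗ Y)))
         (J0 : iso unit_ (F unit_)),
    [/\ is_monoidal J J0,
        forall X Y, fmap F (braid X Y) ∘ J X Y = J Y X ∘ braid (F X) (F Y),
        fully_faithful F
      & ess_surjective F].

(* [E] is the Deligne tensor product of [B] and [C] as a braided fusion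
   category: its tensor product and braiding are those of [B] and [C],
   componentwise on the objects [T X Y]. *)
Definition deligne_product (B C E : bfusion k) : Prop :=
  exists T : bifunctor B C E, is_deligne T /\
  exists (J : forall X Y X' Y', iso (T X Y ⊗ T X' Y') (T (X ⊗ X') (Y ⊗ Y')))
         (J0 : iso unit_ (T unit_ unit_)),
    is_monoidal2 J J0 /\
    forall X Y X' Y',
      bmap T (braid X X') (braid Y Y') ∘ J X Y X' Y'
        = J X' Y' X Y ∘ braid (T X Y) (T X' Y').

Definition ising (C : fusion k) : Prop :=
  ~ pointed C /\
  exists d X : C,
    [/\ [/\ invertible d, ~ (d ≅ unit_)
          & forall Z : C, invertible Z -> (Z ≅ unit_) \/ (Z ≅ d)],
        [/\ simple X, ~ invertible X
          & forall Z : C, simple Z -> ~ invertible Z -> Z ≅ X]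
      & is_dsum2 unit_ d (X ⊗ X)].

End Braided.

(* Main.v *)
(* Suppose C is not pointed. Two simple objects of the same degree differ by an
   invertible factor, because X ⊗ Y^* then lies in the trivial component. If g
   fixes some simple X (g ⊗ X ≅ X), then g centralizes all invertible objects, so
   its monodromy with a simple object depends only on the degree and is a q-th
   root of unity; by non-degeneracy all stabilizers of non-invertible simple
   objects are one and the same group of order q, generated by some h. If the
   self-braiding w of h were trivial, the left actions of the powers of h on X
   would commute with the right action of h, contradicting the fact that X ⊗ X^*
   is the sum of these powers; since w^2 = w^q = 1, this forces q = 2. A sum over
   characters then yields a self-dual simple Z with Z ⊗ Z ≅ 1 ⊕ h. The objects
   1, h, Z generate an Ising category whose centralizer is pointed, and the tensor
   product of C exhibits C itself as the Deligne product of the two. *)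
From HB Require Import structures.
Require Import Defs.
From mathcomp Require Import all_boot all_order all_algebra all_fingroup.
From mathcomp Require Import boolp.
Import Defs.

Set Implicit Arguments.
Unset Strict Implicit.
Unset Printing Implicit Defensive.

Import GRing.Theory VectorInternalTheory.
Local Open Scope ring_scope.
Local Open Scope cat_scope.

(** * Semisimple linear categories *)

(** No Frobenius-Perron dimensions or Grothendieck ring occur: constituents are retracts, and
    multiplicities are read off from one-dimensional Hom spaces between simple objects. The delicate
    point is the passage from [X0] to a self-dual [Z]. Write [X0 ≅ a ⊗ dual X0] with [a] invertible.
    For invertible [u], the object [u ⊗ X0] will do once [u ⊗ u ⊗ a] is the unit or the object [d]
    fixing [X0], so [a] must be a square up to [d]. Monodromy is a pairing on invertible objects,
    and character orthogonality turns this into a dual condition: every [t] whose square is central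
    must pair trivially with [a]. That pairing equals the monodromy of [t ⊗ t] with [X0], which is 1
    if [t ⊗ t ≅ unit_] but not if [t ⊗ t ≅ d]. Hence the need to show that [d] is not a square,
    which again rests on its nontrivial self-braiding. Characteristic 0 keeps the resulting count
    nonzero in [k]. *)

Section LinearMaps.
Variables (k : fieldType) (U V : lmodType k) (f : U -> V).
Hypothesis lf : linear f.

Let F : {linear U -> V} := HB.pack f (GRing.isLinear.Build k U V _ f lf).

Lemma lin0 : f 0 = 0. Proof. exact: (linear0 F). Qed.
Lemma linD u v : f (u + v) = f u + f v. Proof. exact: (linearD F). Qed.
Lemma linB u v : f (u - v) = f u - f v. Proof. exact: (linearB F). Qed.
Lemma linZ a u : f (a *: u) = a *: f u. Proof. exact: (linearZ_LR F). Qed.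
Lemma lin_sum (I : Type) (r : seq I) (P : pred I) (E : I -> U) :
  f (\sum_(i <- r | P i) E i) = \sum_(i <- r | P i) f (E i).
Proof. exact: (linear_sum F). Qed.

End LinearMaps.

Section LinearCategories.
Variables (k : fieldType) (C : lincat k).
Implicit Types X Y Z W : C.

Lemma comp0m X Y Z (f : hom X Y) : (0 : hom Y Z) ∘ f = 0.
Proof. exact: (lin0 (comp_linearl f)). Qed.
Lemma compm0 X Y Z (g : hom Y Z) : g ∘ (0 : hom X Y) = 0.
Proof. exact: (lin0 (comp_linearr g)). Qed.
Lemma compDm X Y Z (g h : hom Y Z) (f : hom X Y) :
  (g + h) ∘ f = g ∘ f + h ∘ f.
Proof. exact: (linD (comp_linearl f)). Qed.
Lemma compmD X Y Z (g : hom Y Z) (f h : hom X Y) :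
  g ∘ (f + h) = g ∘ f + g ∘ h.
Proof. exact: (linD (comp_linearr g)). Qed.
Lemma compBm X Y Z (g h : hom Y Z) (f : hom X Y) :
  (g - h) ∘ f = g ∘ f - h ∘ f.
Proof. exact: (linB (comp_linearl f)). Qed.
Lemma compmB X Y Z (g : hom Y Z) (f h : hom X Y) :
  g ∘ (f - h) = g ∘ f - g ∘ h.
Proof. exact: (linB (comp_linearr g)). Qed.
Lemma compZm X Y Z a (g : hom Y Z) (f : hom X Y) :
  (a *: g) ∘ f = a *: (g ∘ f).
Proof. exact: (linZ (comp_linearl f)). Qed.
Lemma compmZ X Y Z a (g : hom Y Z) (f : hom X Y) :
  g ∘ (a *: f) = a *: (g ∘ f).
Proof. exact: (linZ (comp_linearr g)). Qed.
Lemma comp_suml X Y Z (I : Type) (r : seq I) (P : pred I)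
    (E : I -> hom Y Z) (f : hom X Y) :
  (\sum_(i <- r | P i) E i) ∘ f = \sum_(i <- r | P i) E i ∘ f.
Proof. exact: (lin_sum (comp_linearl f)). Qed.
Lemma comp_sumr X Y Z (I : Type) (r : seq I) (P : pred I)
    (E : I -> hom X Y) (g : hom Y Z) :
  g ∘ (\sum_(i <- r | P i) E i) = \sum_(i <- r | P i) g ∘ E i.
Proof. exact: (lin_sum (comp_linearr g)). Qed.

Definition iso_refl X : iso X X.
Proof. by exists (idm X) (idm X); rewrite comp1m. Defined.

Definition iso_sym X Y (f : iso X Y) : iso Y X :=
  Iso (fwdK f) (bwdK f).

Definition iso_trans X Y Z (g : iso Y Z) (f : iso X Y) : iso X Z.
Proof.
exists (g ∘ f) (bwd f ∘ bwd g).
- by rewrite compA -(compA (bwd f)) bwdK compm1 bwdK.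
- by rewrite compA -(compA g) fwdK compm1 fwdK.
Defined.

Lemma isoR X : X ≅ X. Proof. by constructor; apply: iso_refl. Qed.
Lemma isoS X Y : X ≅ Y -> Y ≅ X.
Proof. by case=> f; constructor; apply: iso_sym. Qed.
Lemma isoT X Y Z : X ≅ Y -> Y ≅ Z -> X ≅ Z.
Proof. by case=> f [g]; constructor; apply: (iso_trans g f). Qed.

Lemma iso_comp_eq0 X Y Z (f : iso X Y) (g : hom Y Z) : g ∘ f = 0 -> g = 0.
Proof. by move=> h; rewrite -[g]compm1 -(fwdK f) compA h comp0m. Qed.
Lemma comp_iso_eq0 X Y Z (f : hom X Y) (g : iso Y Z) : g ∘ f = 0 -> f = 0.
Proof. by move=> h; rewrite -[f]comp1m -(bwdK g) -compA h compm0. Qed.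

Lemma is_zeroP X : is_zero X <-> idm X = 0.
Proof.
split=> [/(_ X)[h _]|X0 Y]; [exact: h|split=> f].
- by rewrite -[f]compm1 X0 compm0.
- by rewrite -[f]comp1m X0 comp0m.
Qed.

Lemma is_zero_iso X Y : X ≅ Y -> is_zero X -> is_zero Y.
Proof.
case=> f /is_zeroP X0; apply/is_zeroP.
by rewrite -(fwdK f) -[fwd f]compm1 X0 compm0 comp0m.
Qed.

Lemma retract_zero X Y (i : hom Y X) (r : hom X Y) :
  r ∘ i = idm Y -> is_zero X -> is_zero Y.
Proof. by move=> ri /(_ Y)[_ X0]; apply/is_zeroP; rewrite -ri (X0 i) compm0. Qed.

Lemma simple_iso X Y : X ≅ Y -> simple X -> simple Y.
Proof.
move=> [f] [Xn0 Xs]; split=> [Y0|Z i im].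
  by apply/Xn0/(is_zero_iso _ Y0)/isoS; constructor.
have [|Z0|[j ij]] := Xs Z (bwd f ∘ i).
- move=> W g h; rewrite -!compA => e; apply: im.
  by rewrite -[i ∘ g]comp1m -[i ∘ h]comp1m -(fwdK f) -!compA e.
- by left.
- right; exists (iso_trans f j) => /=.
  by rewrite ij compA fwdK comp1m.
Qed.

Lemma is_dsum_iso (I : finType) (S : I -> C) X Y :
  X ≅ Y -> is_dsum S X -> is_dsum S Y.
Proof.
case=> f [inj [pr [h1 h2 h3]]].
exists (fun i => f ∘ inj i), (fun i => pr i ∘ bwd f); split.
- by move=> i; rewrite -compA (compA (bwd f)) bwdK comp1m.
- by move=> i j ij; rewrite -compA (compA (bwd f)) bwdK comp1m h2.
- rewrite (eq_bigr (fun i => f ∘ (inj i ∘ pr i) ∘ bwd f)) => [|i _].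
    by rewrite -comp_suml -comp_sumr h3 compm1 fwdK.
  by rewrite !compA.
Qed.

(** [≅] is only a proposition; choice extracts isomorphisms for a whole family at once. *)
Definition the_iso X Y (h : X ≅ Y) : iso X Y :=
  sval (cid (let: inhabits w := h in ex_intro (fun _ : iso X Y => True) w I)).

Lemma is_dsum_eq (I : finType) (S S' : I -> C) X :
  (forall i, S i ≅ S' i) -> is_dsum S X -> is_dsum S' X.
Proof.
move=> e0; have e i := the_iso (e0 i).
case=> inj [pr [h1 h2 h3]].
exists (fun i => inj i ∘ bwd (e i)), (fun i => e i ∘ pr i); split.
- by move=> i; rewrite -compA (compA (pr i)) h1 comp1m fwdK.
- by move=> i j ij; rewrite -compA (compA (pr j)) h2 // comp0m compm0.
- rewrite -h3; apply: eq_bigr => i _.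
  by rewrite -compA (compA (bwd (e i))) bwdK comp1m.
Qed.

Lemma dsum_hom_neq0 (I : finType) (S : I -> C) X Y (f : hom Y X)
    (inj : forall i, hom (S i) X) (pr : forall i, hom X (S i)) :
  \sum_i inj i ∘ pr i = idm X -> f <> 0 -> exists i, pr i ∘ f <> 0.
Proof.
move=> h fn0; apply: contrapT => H; apply: fn0.
rewrite -[f]comp1m -h comp_suml big1 // => i _.
rewrite -compA; have [->|] := pselect (pr i ∘ f = 0); first by rewrite compm0.
by move=> ?; case: H; exists i.
Qed.

Lemma dsum_hom_neq0' (I : finType) (S : I -> C) X Y (f : hom X Y)
    (inj : forall i, hom (S i) X) (pr : forall i, hom X (S i)) :
  \sum_i inj i ∘ pr i = idm X -> f <> 0 -> exists i, f ∘ inj i <> 0.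
Proof.
move=> h fn0; apply: contrapT => H; apply: fn0.
rewrite -[f]compm1 -h comp_sumr big1 // => i _.
rewrite compA; have [->|] := pselect (f ∘ inj i = 0); first by rewrite comp0m.
by move=> ?; case: H; exists i.
Qed.

End LinearCategories.

(** * Schur's lemma and the splitting of morphisms in a semisimple category *)

Section Schur.
Variables (k : closedFieldType) (C : lincat k).
Hypotheses (Cab : abelian C) (Css : semisimple C).
Implicit Types X Y Z S : C.

Lemma simple_idm_neq0 S : simple S -> idm S <> 0.
Proof. by case=> S0 _ h; apply/S0/is_zeroP. Qed.

Lemma schur S S' (f : hom S S') :
  simple S -> simple S' -> f <> 0 -> exists w : iso S S', fwd w = f.
Proof.
move=> [S0 Ss] [_ Ss'] fn0.
have [K [i [fi ki]]] := ab_ker Cab f.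
have im : is_mono i.
  move=> Z g h e; have [x [_ ux]] := ki Z (i ∘ g) ltac:(by rewrite compA fi comp0m).
  by rewrite -(ux g) // -(ux h).
have [K0|[j ij]] := Ss K i im; last first.
  by case: fn0; apply: (@iso_comp_eq0 _ _ _ _ _ j); rewrite ij.
have fm : is_mono f.
  move=> Z g h e; apply/eqP; rewrite -subr_eq0; apply/eqP.
  have [x [<- _]] := ki Z (g - h) ltac:(by rewrite compmB e subrr).
  by have [/(_ i) -> _] := K0 S; rewrite comp0m.
by have [//|[w wf]] := Ss' S f fm; exists w.
Qed.

(** Composition with [f] is a linear endomorphism of the nonzero finite-dimensional space [hom X X].
    In coordinates it is a matrix, whose characteristic polynomial has a root because [k] is
    algebraically closed. *)
Lemma end_eigen X (f : hom X X) : idm X <> 0 ->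
  exists a (g : hom X X), g <> 0 /\ f ∘ g = a *: g.
Proof.
move=> X0; pose V := hom X X.
pose phi (u : 'rV[k]_(dim V)) := v2r (f ∘ (r2v u : V)).
have lphi : linear phi.
  by move=> a u v; rewrite /phi linearP compmD compmZ linearP.
pose F : {linear 'rV[k]_(dim V) -> 'rV[k]_(dim V)} :=
  HB.pack phi (GRing.isLinear.Build k _ _ _ phi lphi).
have d0 : (0 < dim V)%N.
  rewrite lt0n; apply/eqP => d0; apply: X0.
  apply: (can_inj (@v2rK _ V)); apply/rowP => i.
  by case: (i) => m lm; have := lm; rewrite {1}d0.
have /closed_rootP [a ra] : size (char_poly (lin1_mx F)) != 1%N.
  by rewrite size_char_poly; case: (dim V) d0.
have : eigenvalue (lin1_mx F) a by rewrite eigenvalue_root_char.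
case/eigenvalueP=> v; rewrite mul_rV_lin1 => e v0; exists a, (r2v v); split.
  by move=> h; case/eqP: v0; rewrite -[v](@r2vK _ V) h linear0.
by apply: (can_inj (@v2rK _ V)); rewrite linearZ /= r2vK -e.
Qed.

(** [f - a *: idm S] kills a nonzero eigenvector [g], so it is not invertible and must vanish. *)
Lemma simple_end S (f : hom S S) : simple S -> exists a, f = a *: idm S.
Proof.
move=> sS; have [a [g [g0 e]]] := end_eigen f (simple_idm_neq0 sS).
exists a; apply: contrapT => h.
have [|w wE] := @schur S S (f - a *: idm S) sS sS.
  by move/eqP; rewrite subr_eq0 => /eqP.
apply: g0; apply: (@comp_iso_eq0 _ _ _ _ _ _ w).
by rewrite wE compBm e compZm comp1m subrr.
Qed.

Lemma simple_hom_scalar S S' (w : iso S S') (f : hom S S') :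
  simple S -> exists a, f = a *: fwd w.
Proof.
move=> sS; have [a e] := simple_end (bwd w ∘ f) sS; exists a.
by rewrite -[f]comp1m -(fwdK w) -compA e compmZ compm1.
Qed.

Lemma simple_iso_of_hom S S' (f : hom S S') :
  simple S -> simple S' -> f <> 0 -> S ≅ S'.
Proof. by move=> sS sS' /schur[]// w _. Qed.

Lemma scalar_idm_inj X (a b : k) : idm X <> 0 -> a *: idm X = b *: idm X -> a = b.
Proof.
move=> X0 /eqP; rewrite -subr_eq0 -scalerBl scaler_eq0 subr_eq0.
by case/orP=> /eqP // /X0.
Qed.

Lemma simple_mono S X (f : hom S X) : simple S -> f <> 0 ->
  exists r : hom X S, r ∘ f = idm S.
Proof.
move=> sS f0; have [n [T [sT [inj [pr [_ _ h]]]]]] := Css X.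
have [i pf] := dsum_hom_neq0 h f0.
have [w e] := schur sS (sT i) pf.
by exists (bwd w ∘ pr i); rewrite -compA -e bwdK.
Qed.

Lemma simple_epi S X (f : hom X S) : simple S -> f <> 0 ->
  exists s : hom S X, f ∘ s = idm S.
Proof.
move=> sS f0; have [n [T [sT [inj [pr [_ _ h]]]]]] := Css X.
have [i fi] := dsum_hom_neq0' h f0.
have [w e] := schur (sT i) sS fi.
by exists (inj i ∘ bwd w); rewrite compA -e fwdK.
Qed.

(* McCoy's lemma: [f] is regular as soon as [f - f ∘ a ∘ f] is. This lets the
   simple summands of the source be killed one at a time. *)
Lemma hom_regular X Y (f : hom X Y) : exists g : hom Y X, f ∘ g ∘ f = f.
Proof.
have [n [T [sT [inj [pr [h1 h2 h]]]]]] := Css X.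
pose N (f : hom X Y) := [set i | `[< f ∘ inj i <> 0 >]].
have [m] := ubnP #|N f|; elim: m f => // m IH f.
have [f0|/(dsum_hom_neq0' h)[i fi]] := pselect (f = 0).
  by exists 0; rewrite f0 comp0m comp0m.
have [r rf] := simple_mono (sT i) fi.
pose a := inj i ∘ r.
set f' := f - f ∘ a ∘ f => ltNm.
have /IH[b eb] : (#|N f'| < m)%N.
  apply: (@leq_trans #|N f|) => [|]; last by rewrite -ltnS.
  apply/proper_card/properP; split.
    apply/fintype.subsetP => j; rewrite !inE => /asboolP H.
    apply/asboolP => fj0; apply: H.
    by rewrite compBm -!compA fj0 !compm0 subrr.
  exists i; rewrite !inE; first exact/asboolP.
  apply/asboolPn => H; apply: H.
  by rewrite compBm /a -!compA rf compm1 subrr.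
(* Both [f ∘ (idm X - a ∘ f)] and [(idm Y - f ∘ a) ∘ f] equal [f'], so sandwiching this witness
   gives [f ∘ a ∘ f + f' ∘ b ∘ f' = f ∘ a ∘ f + f' = f]. *)
exists (a + (idm X - a ∘ f) ∘ b ∘ (idm Y - f ∘ a)).
rewrite compmD compDm.
have e1 : f ∘ (idm X - a ∘ f) = f' by rewrite compmB compm1 compA.
have e2 : (idm Y - f ∘ a) ∘ f = f' by rewrite compBm comp1m.
have -> : f ∘ ((idm X - a ∘ f) ∘ b ∘ (idm Y - f ∘ a)) ∘ f = f'.
  by rewrite !compA e1 -!compA e2 compA eb.
by rewrite /f' addrC subrK.
Qed.

Lemma mono_split X Y (f : hom X Y) :
  is_mono f -> exists r : hom Y X, r ∘ f = idm X.
Proof.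
move=> fm; have [g e] := hom_regular f; exists g.
by apply: fm; rewrite compA e compm1.
Qed.

Lemma coker_split X Y Q (f : hom X Y) (p : hom Y Q) : is_coker f p ->
  exists (s : hom Q Y) (g : hom Y X),
    p ∘ s = idm Q /\ s ∘ p + f ∘ g = idm Y.
Proof.
case=> pf up; have [g e] := hom_regular f.
have [s [sp _]] := up _ (idm Y - f ∘ g) ltac:(by rewrite compBm e comp1m subrr).
exists s, g; split; last by rewrite sp subrK.
have [x [_ ux]] := up _ p pf; rewrite -(ux (idm Q)) ?comp1m //.
by apply/esym/ux; rewrite -compA sp compmB compm1 compA pf comp0m subr0.
Qed.

Lemma ker_split X Y K (f : hom X Y) (i : hom K X) :
  is_ker f i -> exists r : hom X K, r ∘ i = idm K.
Proof.
case=> fi ui; apply: mono_split => Z g h e.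
have [x [_ ux]] := ui Z (i ∘ g) ltac:(by rewrite compA fi comp0m).
by rewrite -(ux g) // -(ux h).
Qed.

(** The idempotent of a simple summand is a nonzero scalar, hence the identity, so the summand is
    all of [X]. *)
Lemma simple_of_end X : idm X <> 0 ->
  (forall f : hom X X, exists a, f = a *: idm X) -> simple X.
Proof.
move=> X0 eX; have [n [T [sT [inj [pr [h1 h2 h]]]]]] := Css X.
have [i] := dsum_hom_neq0 h X0; rewrite compm1 => pi0.
have [a e] := eX (inj i ∘ pr i).
apply: (simple_iso _ (sT i)); constructor.
have a1 : a = 1.
  apply: (scalar_idm_inj (simple_idm_neq0 (sT i))).
  have := congr1 (fun x => pr i ∘ x ∘ inj i) e.
  by rewrite -!compA h1 compm1 h1 compZm comp1m compmZ h1 scale1r => <-.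
by exists (inj i) (pr i); rewrite ?h1 // e a1 scale1r.
Qed.

End Schur.

(** * Finite direct sums from binary ones *)

Section DirectSums.
Variables (k : fieldType) (A : lincat k).
Hypothesis Aab : abelian A.

Lemma dsum2P X1 X2 (X : A) : is_dsum2 X1 X2 X <->
  exists (i1 : hom X1 X) (i2 : hom X2 X) (p1 : hom X X1) (p2 : hom X X2),
    [/\ p1 ∘ i1 = idm X1, p2 ∘ i2 = idm X2, p1 ∘ i2 = 0, p2 ∘ i1 = 0
      & i1 ∘ p1 + i2 ∘ p2 = idm X].
Proof.
split=> [[inj [pr [g1 g2]]]|[i1 [i2 [p1 [p2 [h1 h2 h3 h4 h5]]]]]].
  rewrite big_bool /= => g3.
  exists (inj true), (inj false), (pr true), (pr false).
  by split=> //; [apply: (g1 true)|apply: (g1 false)|apply: (g2 false true)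
    |apply: (g2 true false)].
pose F b := if b then X1 else X2.
exists (fun b => if b return hom (F b) X then i1 else i2),
  (fun b => if b return hom X (F b) then p1 else p2).
by split; [case|do 2!case=> //|rewrite big_bool].
Qed.

Lemma dsum_exists n (S : 'I_n -> A) : exists X, is_dsum S X.
Proof.
elim: n S => [|n IH] S.
  have [Z /is_zeroP Z0] := ab_zero Aab.
  have h (i : 'I_0) : False by case: i.
  exists Z, (fun i => match h i with end), (fun i => match h i with end).
  by split=> [i|i|]; [case: (h i)|case: (h i)|rewrite big_ord0].
have [Y [inj [pr [h1 h2 h3]]]] := IH (fun i => S (lift ord0 i)).
have [X /dsum2P[i1 [i2 [p1 [p2 [k1 k2 k3 k4 g3]]]]]] := ab_dsum Aab (S ord0) Y.
(* The family [S] is dependent, so the structure maps at [i] must be transported along the equation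
   locating [i]; [eqS] keeps that equation as data. *)
have eqS (i : 'I_n.+1) : {j : 'I_n | i = lift ord0 j} + {i = ord0}.
  by case: (unliftP ord0 i) => [j ->|->]; [left; exists j|right].
pose inj' i : hom (S i) X :=
  match eqS i with
  | inleft (exist j e) => ecast i (hom (S i) X) (esym e) (i2 ∘ inj j)
  | inright e => ecast i (hom (S i) X) (esym e) (i1) end.
pose pr' i : hom X (S i) :=
  match eqS i with
  | inleft (exist j e) => ecast i (hom X (S i)) (esym e) (pr j ∘ p2)
  | inright e => ecast i (hom X (S i)) (esym e) (p1) end.
have inj0 : inj' ord0 = i1.
  rewrite /inj'; case: (eqS _) => [[j e]|e]; last by rewrite eq_axiomK.
  by exfalso; have := neq_lift ord0 j; rewrite -e eqxx.
have pr0 : pr' ord0 = p1.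
  rewrite /pr'; case: (eqS _) => [[j e]|e]; last by rewrite eq_axiomK.
  by exfalso; have := neq_lift ord0 j; rewrite -e eqxx.
have injS j : inj' (lift ord0 j) = i2 ∘ inj j.
  rewrite /inj'; case: (eqS _) => [[i e]|e]; last first.
    by exfalso; have := neq_lift ord0 j; rewrite e eqxx.
  by have e' := lift_inj e; subst i; rewrite eq_axiomK.
have prS j : pr' (lift ord0 j) = pr j ∘ p2.
  rewrite /pr'; case: (eqS _) => [[i e]|e]; last first.
    by exfalso; have := neq_lift ord0 j; rewrite e eqxx.
  by have e' := lift_inj e; subst i; rewrite eq_axiomK.
exists X, inj', pr'; split.
- move=> i; case: (unliftP ord0 i) => [j ->|->]; last by rewrite inj0 pr0.
  by rewrite injS prS -compA (compA p2) k2 comp1m h1.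
- move=> i i'; case: (unliftP ord0 i) => [j ->|->];
    case: (unliftP ord0 i') => [j' ->|->]; rewrite ?inj0 ?pr0 ?injS ?prS.
  + move=> neq; rewrite -compA (compA p2) k2 comp1m h2 //.
  + by rewrite compA k3 comp0m.
  + by rewrite -compA k4 compm0.
  + by rewrite eqxx.
- rewrite big_ord_recl inj0 pr0 -g3; congr (_ + _).
  rewrite -[i2 in RHS]compm1 -h3 comp_sumr comp_suml.
  by apply: eq_bigr => j _; rewrite injS prS !compA.
Qed.

End DirectSums.

(** * Linear functors and bifunctors preserve isomorphisms and direct sums *)

Section FunctorLemmas.
Variable k : fieldType.

Lemma fmap0 (C D : lincat k) (F : functor C D) X Y :
  fmap F (0 : hom X Y) = 0.
Proof. exact: (lin0 (fmap_linear F (X:=X) (Y:=Y))). Qed.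

Lemma fmapD (C D : lincat k) (F : functor C D) X Y (f g : hom X Y) :
  fmap F (f + g) = fmap F f + fmap F g.
Proof. exact: (linD (fmap_linear F (X:=X) (Y:=Y))). Qed.

Lemma fmapZ (C D : lincat k) (F : functor C D) X Y a (f : hom X Y) :
  fmap F (a *: f) = a *: fmap F f.
Proof. exact: (linZ (fmap_linear F (X:=X) (Y:=Y))). Qed.

Lemma fmap_sum (C D : lincat k) (F : functor C D) X Y
    (I : Type) (r : seq I) (P : pred I) (E : I -> hom X Y) :
  fmap F (\sum_(i <- r | P i) E i) = \sum_(i <- r | P i) fmap F (E i).
Proof. exact: (lin_sum (fmap_linear F (X:=X) (Y:=Y))). Qed.

Definition fmap_iso (C D : lincat k) (F : functor C D) X Y (f : iso X Y) :
  iso (F X) (F Y).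
Proof.
exists (fmap F f) (fmap F (bwd f)).
- by rewrite -fmap_comp bwdK fmap1.
- by rewrite -fmap_comp fwdK fmap1.
Defined.

Lemma fmap_isom (C D : lincat k) (F : functor C D) X Y : X ≅ Y -> F X ≅ F Y.
Proof. by case=> f; constructor; apply: fmap_iso. Qed.

Lemma fmap_dsum (C D : lincat k) (F : functor C D) (I : finType) (S : I -> C) X :
  is_dsum S X -> is_dsum (fun i => F (S i)) (F X).
Proof.
case=> inj [pr [h1 h2 h3]].
exists (fun i => fmap F (inj i)), (fun i => fmap F (pr i)); split.
- by move=> i; rewrite -fmap_comp h1 fmap1.
- by move=> i j ij; rewrite -fmap_comp h2 // fmap0.
- by rewrite -fmap1 -h3 fmap_sum; apply: eq_bigr => i _; rewrite fmap_comp.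
Qed.

Variables (B C D : lincat k) (T : bifunctor B C D).

Lemma bmap0l X X' Y Y' (g : hom Y Y') : bmap T (0 : hom X X') g = 0.
Proof. exact: (lin0 (@bmap_linearl _ _ _ _ T X X' _ _ g)). Qed.
Lemma bmap0r X X' Y Y' (f : hom X X') : bmap T f (0 : hom Y Y') = 0.
Proof. exact: (lin0 (@bmap_linearr _ _ _ _ T _ _ Y Y' f)). Qed.
Lemma bmapZl X X' Y Y' a (f : hom X X') (g : hom Y Y') :
  bmap T (a *: f) g = a *: bmap T f g.
Proof. exact: (linZ (@bmap_linearl _ _ _ _ T X X' _ _ g)). Qed.
Lemma bmapZr X X' Y Y' a (f : hom X X') (g : hom Y Y') :
  bmap T f (a *: g) = a *: bmap T f g.
Proof. exact: (linZ (@bmap_linearr _ _ _ _ T _ _ Y Y' f)). Qed.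
Lemma bmap_suml X X' Y Y' (I : Type) (r : seq I) (P : pred I)
    (E : I -> hom X X') (g : hom Y Y') :
  bmap T (\sum_(i <- r | P i) E i) g = \sum_(i <- r | P i) bmap T (E i) g.
Proof. exact: (lin_sum (@bmap_linearl _ _ _ _ T X X' _ _ g)). Qed.
Lemma bmap_sumr X X' Y Y' (I : Type) (r : seq I) (P : pred I)
    (f : hom X X') (E : I -> hom Y Y') :
  bmap T f (\sum_(i <- r | P i) E i) = \sum_(i <- r | P i) bmap T f (E i).
Proof. exact: (lin_sum (@bmap_linearr _ _ _ _ T _ _ Y Y' f)). Qed.

Definition bifunctor_l (Y : C) : functor B D.
Proof.
exists (fun X => T X Y) (fun X X' f => bmap T f (idm Y)).
- by move=> X X'; apply: bmap_linearl.
- by move=> X; apply: bmap1.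
- by move=> X X' X'' g f; rewrite -{1}(comp1m (idm Y)) bmap_comp.
Defined.

Definition bifunctor_r (X : B) : functor C D.
Proof.
exists (fun Y => T X Y) (fun Y Y' f => bmap T (idm X) f).
- by move=> Y Y'; apply: bmap_linearr.
- by move=> Y; apply: bmap1.
- by move=> Y Y' Y'' g f; rewrite -{1}(comp1m (idm X)) bmap_comp.
Defined.

Definition bmap_iso X X' Y Y' (f : iso X X') (g : iso Y Y') :
  iso (T X Y) (T X' Y').
Proof.
exists (bmap T f g) (bmap T (bwd f) (bwd g)).
- by rewrite -bmap_comp !bwdK bmap1.
- by rewrite -bmap_comp !fwdK bmap1.
Defined.

Lemma bmap_isom X X' Y Y' : X ≅ X' -> Y ≅ Y' -> T X Y ≅ T X' Y'.
Proof. by case=> f [g]; constructor; apply: bmap_iso. Qed.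

Lemma bmap_dsum (I J : finType) (S : I -> B) (S' : J -> C) X Y :
  is_dsum S X -> is_dsum S' Y ->
  is_dsum (fun p : I * J => T (S p.1) (S' p.2)) (T X Y).
Proof.
case=> inj [pr [h1 h2 h3]] [inj' [pr' [g1 g2 g3]]].
exists (fun p => bmap T (inj p.1) (inj' p.2)),
       (fun p => bmap T (pr p.1) (pr' p.2)); split.
- by move=> p; rewrite -bmap_comp h1 g1 bmap1.
- move=> [i j] [i' j']; rewrite -pair_eqE /= negb_and -bmap_comp.
  by case/orP=> ne; [rewrite h2 ?bmap0l|rewrite g2 ?bmap0r].
- rewrite -(bmap1 T) -h3 -g3 bmap_suml.
  under [RHS]eq_bigr do rewrite bmap_sumr.
  by rewrite pair_bigA /=; apply: eq_bigr => p _; rewrite bmap_comp.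
Qed.

End FunctorLemmas.

Section RightExact.
Variables (k : closedFieldType) (C : lincat k).
Hypotheses (Cab : abelian C) (Css : semisimple C).

(** Cokernels in [C] split, and a split cokernel is described by equations that every linear functor
    preserves. *)
Lemma semisimple_right_exact (D : lincat k) (F : functor C D) : right_exact F.
Proof.
move=> X Y Q f p cp; have [s [g [ps e]]] := coker_split Cab Css cp.
have [pf _] := cp.
split=> [|Z h hf]; first by rewrite -fmap_comp pf fmap0.
exists (h ∘ fmap F s); split=> [|h' <-].
  rewrite -compA -fmap_comp -[RHS]compm1 -fmap1 -e fmapD compmD.
  by rewrite (fmap_comp F f) (compA h) hf comp0m addr0.
by rewrite -compA -fmap_comp ps fmap1 compm1.
Qed.

End RightExact.

Lemma semisimple_right_exact2 (k : closedFieldType) (B C D : lincat k)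
    (T : bifunctor B C D) :
  abelian B -> semisimple B -> abelian C -> semisimple C -> right_exact2 T.
Proof.
move=> Bab Bss Cab Css; split=> [X X' Q Y|X Y Y' Q].
- exact: (semisimple_right_exact Bab Bss (bifunctor_l T Y)).
- exact: (semisimple_right_exact Cab Css (bifunctor_r T X)).
Qed.
(** * Coherence in monoidal categories *)

Section IsoCancel.
Variables (k : fieldType) (C : lincat k).

Lemma bwdKm (X Y Z : C) (f : iso X Y) (g : hom Z X) : bwd f ∘ (f ∘ g) = g.
Proof. by rewrite compA bwdK comp1m. Qed.
Lemma bwdmK (X Y Z : C) (f : iso X Y) (g : hom Y Z) : g ∘ f ∘ bwd f = g.
Proof. by rewrite -compA fwdK compm1. Qed.
Lemma fwdmK (X Y Z : C) (f : iso X Y) (g : hom X Z) : g ∘ bwd f ∘ f = g.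
Proof. by rewrite -compA bwdK compm1. Qed.
Lemma iso_epi (X Y Z : C) (f : iso X Y) (g h : hom Y Z) : g ∘ f = h ∘ f -> g = h.
Proof. by move=> e; rewrite -(bwdmK f g) e bwdmK. Qed.
Lemma iso_mono (X Y Z : C) (f : iso X Y) (g h : hom Z X) : f ∘ g = f ∘ h -> g = h.
Proof. by move=> e; rewrite -(bwdKm f g) e bwdKm. Qed.
End IsoCancel.

Section Monoidal.
Variables (k : fieldType) (M : moncat k).
Implicit Types X Y Z W : M.

Lemma tensm1 X Y : idm X ⊗m idm Y = idm (X ⊗ Y).
Proof. exact: bmap1. Qed.
Lemma tensmC X X' X'' Y Y' Y'' (f' : hom X' X'') (f : hom X X')
    (g' : hom Y' Y'') (g : hom Y Y') :
  (f' ∘ f) ⊗m (g' ∘ g) = (f' ⊗m g') ∘ (f ⊗m g).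
Proof. exact: bmap_comp. Qed.
Lemma tensmCl X X' X'' Y (f' : hom X' X'') (f : hom X X') :
  (f' ∘ f) ⊗m idm Y = (f' ⊗m idm Y) ∘ (f ⊗m idm Y).
Proof. by rewrite -tensmC comp1m. Qed.
Lemma tensmCr X Y Y' Y'' (f' : hom Y' Y'') (f : hom Y Y') :
  idm X ⊗m (f' ∘ f) = (idm X ⊗m f') ∘ (idm X ⊗m f).
Proof. by rewrite -tensmC comp1m. Qed.
Lemma tensm_lr X X' Y Y' (f : hom X X') (g : hom Y Y') :
  f ⊗m g = (f ⊗m idm Y') ∘ (idm X ⊗m g).
Proof. by rewrite -tensmC compm1 comp1m. Qed.
Lemma tensm_rl X X' Y Y' (f : hom X X') (g : hom Y Y') :
  f ⊗m g = (idm X' ⊗m g) ∘ (f ⊗m idm Y).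
Proof. by rewrite -tensmC compm1 comp1m. Qed.

Lemma unit_tens_inj X Y (f g : hom X Y) :
  idm (unit_ : M) ⊗m f = idm unit_ ⊗m g -> f = g.
Proof. by move=> e; apply: (@iso_epi _ _ _ _ _ (lu X)); rewrite -!lu_nat e. Qed.

Lemma tens_unit_inj X Y (f g : hom X Y) :
  f ⊗m idm (unit_ : M) = g ⊗m idm unit_ -> f = g.
Proof. by move=> e; apply: (@iso_epi _ _ _ _ _ (ru X)); rewrite -!ru_nat e. Qed.

(* Kelly's lemma: this unit axiom follows from the pentagon and the triangle. *)
Lemma lu_tens X Y : lu (X ⊗ Y) ∘ asc unit_ X Y = lu X ⊗m idm Y.
Proof.
apply: unit_tens_inj.
apply: (@iso_epi _ _ _ _ _ (asc unit_ (unit_ ⊗ X) Y)).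
apply: (@iso_epi _ _ _ _ _ (bmap_iso (tens M) (asc unit_ unit_ X) (iso_refl Y))).
rewrite /= tensmCr -!compA (compA (idm _ ⊗m asc _ _ _)) -pentagon.
rewrite (compA (idm _ ⊗m lu _)) triangle -[idm (X ⊗ Y)]tensm1 -asc_nat.
by rewrite compA -asc_nat -compA -tensmCl triangle.
Qed.

Lemma asc_natV X X' Y Y' Z Z' (f : hom X X') (g : hom Y Y') (h : hom Z Z') :
  bwd (asc X' Y' Z') ∘ (f ⊗m (g ⊗m h)) = ((f ⊗m g) ⊗m h) ∘ bwd (asc X Y Z).
Proof.
apply: (@iso_epi _ _ _ _ _ (asc X Y Z)).
by rewrite -compA -asc_nat bwdKm fwdmK.
Qed.

(** Applied to [X ≅ dual (dual X)], this makes the left dual of [X] a right dual, which is how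
    subcategories acquire right duals. *)
Lemma dual_iso X Y Z (e : hom (Z ⊗ Y) unit_) (d : hom unit_ (Y ⊗ Z)) (a : iso X Z) :
  is_dual e d -> is_dual (e ∘ (a ⊗m idm Y)) ((idm Y ⊗m bwd a) ∘ d).
Proof.
move=> [z1 z2]; split.
  rewrite -z1 tensmCr tensmCl -!compA; congr (_ ∘ (_ ∘ _)).
  rewrite (compA (idm Y ⊗m _)) -asc_nat -compA; congr (_ ∘ _).
  by rewrite compA -!tensmCl -tensmCr fwdK tensm1 comp1m.
have e1 : ((e ∘ (a ⊗m idm Y)) ⊗m idm X) ∘ bwd (asc X Y X)
      ∘ (idm X ⊗m ((idm Y ⊗m bwd a) ∘ d))
    = (idm unit_ ⊗m bwd a) ∘ ((e ⊗m idm Z) ∘ bwd (asc Z Y Z) ∘ (idm Z ⊗m d))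
      ∘ (a ⊗m idm unit_).
  rewrite tensmCr -!compA (compA (bwd _) (_ ⊗m (_ ⊗m _))) asc_natV tensm1.
  rewrite -[in RHS]tensm_rl [a ⊗m d]tensm_lr -[idm (Y ⊗ Z)]tensm1.
  rewrite (compA (bwd _) (a ⊗m _)) asc_natV !compA.
  by rewrite -tensmC compm1 comp1m -2!tensmC comp1m compm1 compm1.
rewrite -[LHS]compA -[LHS]compA [X in _ ∘ X]compA e1.
rewrite !compA lu_nat -(compA _ _ (e ⊗m _)) -(compA (bwd a)) -(compA (bwd a)) -(compA (bwd a)).
rewrite z2.
by rewrite ru_nat compA bwdK comp1m.
Qed.

(** Formal tensor words. [act A W] is the right-nested form of [val A ⊗ W]; with the tail [W] as an
    argument, rebracketing and inserting units change nothing up to conversion. *)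
Inductive tree := Unit | Leaf of M | Node of tree & tree.

Fixpoint val (A : tree) : M :=
  match A with
  | Unit => unit_ | Leaf X => X | Node A B => val A ⊗ val B
  end.

Fixpoint act (A : tree) (W : M) : M :=
  match A with
  | Unit => W | Leaf X => X ⊗ W | Node A B => act A (act B W)
  end.

Fixpoint actm (A : tree) W W' (f : hom W W') : hom (act A W) (act A W') :=
  match A with
  | Unit => f
  | Leaf X => idm X ⊗m f
  | Node A B => actm A (actm B f)
  end.

Fixpoint kap (A : tree) W : iso (val A ⊗ W) (act A W) :=
  match A with
  | Unit => lu W
  | Leaf X => iso_refl _
  | Node A B =>
      iso_trans (kap A (act B W))
        (iso_trans (bmap_iso (tens M) (iso_refl (val A)) (kap B W))
           (asc (val A) (val B) W))
  end.

Lemma actm1 A W : actm A (idm W) = idm (act A W).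
Proof.
by elim: A W => [|X|A IHA B IHB] W //=; rewrite ?bmap1 ?IHB ?IHA.
Qed.

Lemma actm_comp A W W' W'' (g : hom W' W'') (f : hom W W') :
  actm A (g ∘ f) = actm A g ∘ actm A f.
Proof.
elim: A W W' W'' g f => [|X|A IHA B IHB] W W' W'' g f //=.
- by rewrite tensmCr.
- by rewrite IHB IHA.
Qed.

Lemma actmZ A W W' a (f : hom W W') : actm A (a *: f) = a *: actm A f.
Proof.
by elim: A W W' f => [|X|A IHA B IHB] W W' f //=; rewrite ?bmapZr ?IHB ?IHA.
Qed.

Lemma kap_nat A W W' (f : hom W W') :
  kap A W' ∘ (idm (val A) ⊗m f) = actm A f ∘ kap A W.
Proof.
elim: A W W' f => [|X|A IHA B IHB] W W' f /=.
- exact: lu_nat.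
- by rewrite compm1 comp1m.
- rewrite -tensm1 -!compA asc_nat (compA _ _ (asc _ _ _)) -tensmCr IHB tensmCr.
  by rewrite !compA IHA.
Qed.

(* A morphism between tensor words, transported to a natural family of
   morphisms between the corresponding right-nested words. Associativity and
   unit constraints become identities under [sem], so equations between
   morphisms of [M] can be checked as in a strict monoidal category. *)
Fact sem_subproof (A B : tree) (f : hom (val A) (val B)) W :
  {g : hom (act A W) (act B W) | g ∘ kap A W = kap B W ∘ (f ⊗m idm W)}.
Proof. by exists (kap B W ∘ (f ⊗m idm W) ∘ bwd (kap A W)); rewrite fwdmK. Qed.

Definition sem (A B : tree) (f : hom (val A) (val B)) W :
  hom (act A W) (act B W) := sval (sem_subproof f W).

Lemma semK A B (f : hom (val A) (val B)) W :
  sem f W ∘ kap A W = kap B W ∘ (f ⊗m idm W).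
Proof. exact: svalP (sem_subproof f W). Qed.

Lemma semP A B (f : hom (val A) (val B)) W g :
  kap B W ∘ (f ⊗m idm W) = g ∘ kap A W -> sem f W = g.
Proof. by rewrite -semK => /iso_epi. Qed.

(** The single value [W = unit_] already suffices, since tensoring with the unit is faithful. *)
Lemma sem_inj A B (f g : hom (val A) (val B)) :
  (forall W, sem f W = sem g W) -> f = g.
Proof.
move=> e; apply: tens_unit_inj; apply: (@iso_mono _ _ _ _ _ (kap B _)).
by rewrite -!semK e.
Qed.

Lemma sem1 A W : @sem A A (idm (val A)) W = idm (act A W).
Proof. by apply: semP; rewrite tensm1 compm1 comp1m. Qed.

Lemma sem_comp A B D (g : hom (val B) (val D)) (f : hom (val A) (val B)) W :
  @sem A D (g ∘ f) W = sem g W ∘ sem f W.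
Proof. by apply: semP; rewrite -compA semK compA semK -compA -tensmCl. Qed.

Lemma semZ A B a (f : hom (val A) (val B)) W :
  @sem A B (a *: f) W = a *: sem f W.
Proof. by apply: semP; rewrite compZm semK bmapZl compmZ. Qed.

Lemma sem_nat A B (f : hom (val A) (val B)) W W' (h : hom W W') :
  sem f W' ∘ actm A h = actm B h ∘ sem f W.
Proof.
apply: (@iso_epi _ _ _ _ _ (kap A W)).
rewrite -!compA -kap_nat semK !compA semK -kap_nat -!compA.
by rewrite -tensm_rl -tensm_lr.
Qed.

Lemma sem_tens A A' B B' (f : hom (val A) (val A')) (g : hom (val B) (val B')) W :
  @sem (Node A B) (Node A' B') (f ⊗m g) W = sem f (act B' W) ∘ actm A (sem g W).
Proof.
apply: semP => /=; set w := act B' W.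
transitivity (kap A' w ∘ ((f ⊗m idm w) ∘ ((idm (val A) ⊗m (sem g W ∘ kap B W))
    ∘ asc (val A) (val B) W))).
  rewrite semK (compA (f ⊗m _)) -tensm_lr -!compA asc_nat.
  by rewrite (compA (_ ⊗m _) (f ⊗m _)) -tensmC comp1m.
rewrite [LHS]compA -semK tensmCr -!compA; congr (_ ∘ _).
by rewrite [in RHS]compA -kap_nat -!compA.
Qed.

(** This is the pentagon in strict form. Likewise [sem_lu] is Kelly's lemma and [sem_ru] is the
    triangle. *)
Lemma sem_asc A B D W :
  @sem (Node (Node A B) D) (Node A (Node B D))
    (asc (val A) (val B) (val D)) W = idm _.
Proof.
apply: semP; rewrite comp1m /= !tensmCr -!compA.
rewrite (compA (_ ⊗m fwd (asc _ _ _))) -pentagon.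
rewrite -[idm (val A ⊗ val B)]tensm1.
by rewrite (compA (asc _ _ _) (_ ⊗m _)) asc_nat -!compA.
Qed.

Lemma sem_lu A W : @sem (Node Unit A) A (lu (val A)) W = idm _.
Proof. by apply: semP; rewrite comp1m /= -lu_tens !compA lu_nat. Qed.

Lemma sem_ru A W : @sem (Node A Unit) A (ru (val A)) W = idm _.
Proof. by apply: semP; rewrite comp1m /= triangle. Qed.

Lemma sem_bwd A B (f : iso (val A) (val B)) W :
  @sem B A (bwd f) W ∘ sem f W = idm _.
Proof. by rewrite -sem_comp bwdK sem1. Qed.

Lemma sem_bwd1 A B (f : iso (val A) (val B)) W (e : hom (act A W) (act B W))
    (g : hom (act B W) (act A W)) :
  sem f W = e -> e ∘ g = idm _ -> @sem B A (bwd f) W = g.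
Proof. by move=> fe eg; rewrite -[LHS]compm1 -eg compA -fe sem_bwd comp1m. Qed.

Lemma sem_ascV A B D W :
  @sem (Node A (Node B D)) (Node (Node A B) D)
    (bwd (asc (val A) (val B) (val D))) W = idm _.
Proof. by apply: sem_bwd1 (sem_asc A B D W) _; rewrite comp1m. Qed.

Lemma sem_luV A W : @sem A (Node Unit A) (bwd (lu (val A))) W = idm _.
Proof. by apply: sem_bwd1 (sem_lu A W) _; rewrite comp1m. Qed.

Lemma sem_ruV A W : @sem A (Node A Unit) (bwd (ru (val A))) W = idm _.
Proof. by apply: sem_bwd1 (sem_ru A W) _; rewrite comp1m. Qed.

End Monoidal.
(** * Duality and braidings *)

Section Duals.
Variables (k : fieldType) (M : moncat k) (X Y : M).
Variables (e : hom (Y ⊗ X) unit_) (d : hom unit_ (X ⊗ Y)).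
Hypothesis dualXY : is_dual e d.

Local Notation X' := (Leaf X).
Local Notation Y' := (Leaf Y).
Let eS W : hom (Y ⊗ (X ⊗ W)) W := @sem _ _ (Node Y' X') (Unit M) e W.
Let dS W : hom W (X ⊗ (Y ⊗ W)) := @sem _ _ (Unit M) (Node X' Y') d W.

Lemma sem_zigzagl W : (idm X ⊗m eS W) ∘ dS (X ⊗ W) = idm (X ⊗ W).
Proof.
case: dualXY => h _.
have {h} := congr1 (fun f => @sem _ _ (Node (Unit M) X') X' f W) h.
rewrite sem_lu => <-.
rewrite (sem_comp (B := Node (Node X' Y') X')) (sem_comp (B := Node X' (Node Y' X'))).
rewrite (sem_comp (B := Node X' (Unit M))) sem_ru sem_asc !sem_tens.
by rewrite !sem1 actm1 comp1m compm1 comp1m compm1.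
Qed.

Lemma sem_zigzagr W : eS (Y ⊗ W) ∘ (idm Y ⊗m dS W) = idm (Y ⊗ W).
Proof.
case: dualXY => _ h.
have {h} := congr1 (fun f => @sem _ _ (Node Y' (Unit M)) Y' f W) h.
rewrite sem_ru => <-.
rewrite (sem_comp (B := Node Y' (Node X' Y'))) (sem_comp (B := Node (Node Y' X') Y')).
rewrite (sem_comp (B := Node (Unit M) Y')) sem_lu sem_ascV !sem_tens.
by rewrite !sem1 actm1 !comp1m !compm1.
Qed.

(** [mate] and [comate] are the two directions of the adjunction between tensoring on the right with
    [X] and with its dual [Y]. *)
Definition mate A B (f : hom (A ⊗ X) B) : hom A (B ⊗ Y) :=
  (f ⊗m idm Y) ∘ bwd (asc A X Y) ∘ (idm A ⊗m d) ∘ bwd (ru A).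

Definition comate A B (g : hom A (B ⊗ Y)) : hom (A ⊗ X) B :=
  ru B ∘ (idm B ⊗m e) ∘ asc B Y X ∘ (g ⊗m idm X).

Lemma sem_mate A B (f : hom (A ⊗ X) B) W :
  @sem _ _ (Leaf A) (Node (Leaf B) Y') (mate f) W =
  @sem _ _ (Node (Leaf A) X') (Leaf B) f (Y ⊗ W) ∘ (idm A ⊗m dS W).
Proof.
rewrite /mate (sem_comp (B := Node (Leaf A) (Unit M))).
rewrite (sem_comp (B := Node (Leaf A) (Node X' Y'))).
rewrite (sem_comp (B := Node (Node (Leaf A) X') Y')).
by rewrite sem_ruV sem_ascV !sem_tens !sem1 actm1 !compm1 comp1m.
Qed.

Lemma sem_comate A B (g : hom A (B ⊗ Y)) W :
  @sem _ _ (Node (Leaf A) X') (Leaf B) (comate g) W =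
  (idm B ⊗m eS W) ∘ @sem _ _ (Leaf A) (Node (Leaf B) Y') g (X ⊗ W).
Proof.
rewrite /comate (sem_comp (B := Node (Node (Leaf B) Y') X')).
rewrite (sem_comp (B := Node (Leaf B) (Node Y' X'))).
rewrite (sem_comp (B := Node (Leaf B) (Unit M))).
by rewrite sem_ru sem_asc !sem_tens !sem1 actm1 !compm1 !comp1m.
Qed.

Lemma mateK A B (f : hom (A ⊗ X) B) : comate (mate f) = f.
Proof.
apply: (@sem_inj _ _ (Node (Leaf A) X') (Leaf B)) => W.
rewrite sem_comate sem_mate compA -(sem_nat (A := Node (Leaf A) X') (B := Leaf B)).
by rewrite -compA /= -tensmCr sem_zigzagl tensm1 compm1.
Qed.

Lemma comateK A B (g : hom A (B ⊗ Y)) : mate (comate g) = g.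
Proof.
apply: (@sem_inj _ _ (Leaf A) (Node (Leaf B) Y')) => W.
rewrite sem_mate sem_comate -compA (sem_nat (A := Leaf A) (B := Node (Leaf B) Y')).
by rewrite compA /= -tensmCr sem_zigzagr tensm1 comp1m.
Qed.

Lemma comate0 A B : comate (0 : hom A (B ⊗ Y)) = 0.
Proof. by rewrite /comate bmap0l compm0. Qed.

Lemma comateZ A B a (g : hom A (B ⊗ Y)) : comate (a *: g) = a *: comate g.
Proof. by rewrite /comate bmapZl compmZ. Qed.

Lemma comate_neq0 A B (g : hom A (B ⊗ Y)) : g <> 0 -> comate g <> 0.
Proof. by move=> h c; apply: h; rewrite -(comateK g) c /mate bmap0l !comp0m. Qed.

Lemma mate_neq0 A B (f : hom (A ⊗ X) B) : f <> 0 -> mate f <> 0.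
Proof. by move=> h c; apply: h; rewrite -(mateK f) c comate0. Qed.

Lemma ev_neq0 : idm X <> 0 -> e <> 0.
Proof.
move=> h e0; apply: h; case: dualXY; rewrite e0 bmap0r compm0 !comp0m => z _.
by apply: (@iso_epi _ _ _ _ _ (lu X)); rewrite comp0m comp1m -z.
Qed.

(* [ru X ∘ (idm X ⊗m e) ∘ asc X Y X] commuting with the right action [g] of [D]
   makes [g] factor through the morphisms [D -> unit_]. *)
Lemma right_action_factor D (g : hom (X ⊗ D) X) (x : hom D (Y ⊗ (X ⊗ D))) :
  let v := ru X ∘ (idm X ⊗m e) ∘ asc X Y X in
  g ∘ (v ⊗m idm D) = v ∘ (idm (X ⊗ Y) ⊗m g) ∘ asc (X ⊗ Y) X D ->
  g ∘ (idm X ⊗m (lu D ∘ (e ⊗m idm D) ∘ bwd (asc Y X D) ∘ x)) =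
  ru X ∘ (idm X ⊗m (e ∘ (idm Y ⊗m g) ∘ x)).
Proof.
move=> v vg; pose D' := Leaf D.
have vS W : @sem _ _ (Node (Node X' Y') X') X' v W = idm X ⊗m eS W.
  rewrite /v (sem_comp (B := Node X' (Node Y' X'))) (sem_comp (B := Node X' (Unit M))).
  by rewrite sem_ru sem_asc sem_tens sem1 compm1 !comp1m.
pose g' W : hom (X ⊗ (D ⊗ W)) (X ⊗ W) := @sem _ _ (Node X' D') X' g W.
have {vg} E W : g' W ∘ (idm X ⊗m eS (D ⊗ W)) =
    (idm X ⊗m eS W) ∘ (idm X ⊗m (idm Y ⊗m g' W)).
  have := congr1 (fun f => @sem _ _ (Node (Node (Node X' Y') X') D') X' f W) vg.
  rewrite (sem_comp (B := Node X' D')).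
  rewrite (sem_comp (B := Node (Node X' Y') (Node X' D'))).
  rewrite (sem_comp (B := Node (Node X' Y') X')).
  by rewrite !sem_tens !sem1 actm1 vS vS sem_asc compm1 !compm1 comp1m.
rewrite !tensmCr !compA; congr (_ ∘ _).
apply: (@sem_inj _ _ (Node X' (Node Y' (Node X' D'))) X') => W.
rewrite (sem_comp (B := Node X' (Node (Node Y' X') D'))).
rewrite (sem_comp (B := Node X' (Node (Unit M) D'))).
rewrite (sem_comp (B := Node X' D')).
rewrite (sem_comp (B := Node X' (Node Y' X'))) (sem_comp (B := Node X' (Unit M))).
rewrite !(sem_tens (A := X')) !sem_ascV sem_lu sem_ru !sem_tens !sem1 !actm1.
by rewrite !comp1m !compm1 E.
Qed.

End Duals.

(** * Braidings in strict form, monodromy scalars, and one-sided actions *)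

Section Braided.
Variables (k : fieldType) (C : bfusion k).
Implicit Types X Y Z W : C.
Implicit Types A B : tree C.
Local Notation unit := (unit_ : C).

Definition bs A B W : hom (act A (act B W)) (act B (act A W)) :=
  @sem _ _ (Node A B) (Node B A) (braid (val A) (val B)) W.

Lemma bs_nat A A' B B' (f : hom (val A) (val A')) (g : hom (val B) (val B')) W :
  bs A' B' W ∘ (sem f (act B' W) ∘ actm A (sem g W)) =
  sem g (act A' W) ∘ actm B (sem f W) ∘ bs A B W.
Proof.
have := congr1 (fun h => @sem _ _ (Node A B) (Node B' A') h W) (braid_nat f g).
by rewrite (sem_comp (B := Node A' B')) (sem_comp (B := Node B A)) !sem_tens.
Qed.

Lemma bs_natW A B W W' (h : hom W W') :
  bs A B W' ∘ actm A (actm B h) = actm B (actm A h) ∘ bs A B W.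
Proof. exact: (sem_nat (A := Node A B) (B := Node B A)). Qed.

Lemma bs_hex1 A B D W :
  bs A (Node B D) W = actm B (bs A D W) ∘ bs A B (act D W).
Proof.
have := congr1 (fun f => @sem _ _ (Node (Node A B) D) (Node B (Node D A)) f W)
  (hexagon1 (val A) (val B) (val D)).
rewrite (sem_comp (B := Node A (Node B D))) (sem_comp (B := Node (Node B D) A)).
rewrite (sem_comp (B := Node (Node B A) D)) (sem_comp (B := Node B (Node A D))).
by rewrite !sem_asc !sem_tens !sem1 actm1 !compm1 !comp1m.
Qed.

Lemma bs_hex2 A B D W :
  bs (Node A B) D W = bs A D (act B W) ∘ actm A (bs B D W).
Proof.
have := congr1 (fun f => @sem _ _ (Node A (Node B D)) (Node (Node D A) B) f W)
  (hexagon2 (val A) (val B) (val D)).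
rewrite (sem_comp (B := Node (Node A B) D)) (sem_comp (B := Node D (Node A B))).
rewrite (sem_comp (B := Node A (Node D B))) (sem_comp (B := Node (Node A D) B)).
by rewrite !sem_ascV !sem_tens !sem1 actm1 !compm1 !comp1m.
Qed.

Definition bsV A B W : hom (act B (act A W)) (act A (act B W)) :=
  @sem _ _ (Node B A) (Node A B) (bwd (braid (val A) (val B))) W.

Lemma bsVK A B W : bsV A B W ∘ bs A B W = idm _.
Proof. exact: (@sem_bwd _ _ (Node A B) (Node B A)). Qed.

(** Naturality along [unit_ ⊗ unit_ ≅ unit_] and a hexagon make this crossing equal to its own
    square; being invertible, it is the identity. *)
Lemma bs_unitl A W : bs (Unit C) A W = idm _.
Proof.
have := bs_nat (lu unit : hom (val (Node (Unit C) (Unit C))) (val (Unit C))) (idm (val A)) W.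
rewrite !sem_lu !sem1 /= !actm1 bs_hex2 !comp1m compm1 /=.
move/(congr1 (fun f => bsV (Unit C) A W ∘ f)).
by have e := bsVK (Unit C) A W; rewrite /= in e; rewrite compA e comp1m.
Qed.

Lemma bs_unitr A W : bs A (Unit C) W = idm _.
Proof.
have := bs_nat (idm (val A)) (lu unit : hom (val (Node (Unit C) (Unit C))) (val (Unit C))) W.
rewrite !sem_lu !sem1 /= !actm1 bs_hex1 !comp1m compm1 /=.
move/(congr1 (fun f => bsV A (Unit C) W ∘ f)).
by have e := bsVK A (Unit C) W; rewrite /= in e; rewrite compA e comp1m.
Qed.

Definition monodromy X Y (a : k) : Prop :=
  braid Y X ∘ braid X Y = a *: idm (X ⊗ Y).

Lemma monodromyP A B a : monodromy (val A) (val B) a <->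
  forall W, bs B A W ∘ bs A B W = a *: idm _.
Proof.
split=> [h W|h].
  rewrite -[LHS](sem_comp (A := Node A B) (B := Node B A) (D := Node A B)).
  by rewrite h semZ sem1.
apply: (@sem_inj _ _ (Node A B) (Node A B)) => W.
by rewrite (sem_comp (B := Node B A)) semZ sem1 -h.
Qed.

Lemma monodromy_sym X Y a : monodromy X Y a -> monodromy Y X a.
Proof.
move=> h; apply: (@iso_epi _ _ _ _ _ (braid X Y)).
by rewrite -compA h compmZ compm1 compZm comp1m.
Qed.

Lemma monodromy_tensr X Y Z a b :
  monodromy X Y a -> monodromy X Z b -> monodromy X (Y ⊗ Z) (a * b).
Proof.
move=> /(monodromyP (Leaf X) (Leaf Y)) hY /(monodromyP (Leaf X) (Leaf Z)) hZ.
apply/(monodromyP (Leaf X) (Node (Leaf Y) (Leaf Z))) => W.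
have e : actm (Leaf Y) (bs (Leaf Z) (Leaf X) W) ∘ actm (Leaf Y) (bs (Leaf X) (Leaf Z) W)
    = b *: idm _ by rewrite -actm_comp hZ actmZ actm1.
rewrite bs_hex1 bs_hex2 -compA [X in _ ∘ X]compA e.
rewrite compZm comp1m compmZ mulrC -scalerA; congr (_ *: _); exact: hY.
Qed.

Lemma monodromy_tensl X Y Z a b :
  monodromy X Z a -> monodromy Y Z b -> monodromy (X ⊗ Y) Z (a * b).
Proof.
by move=> /monodromy_sym hX /monodromy_sym hY; apply/monodromy_sym/monodromy_tensr.
Qed.

Lemma monodromy_unitr X : monodromy X unit 1.
Proof.
apply/(monodromyP (Leaf X) (Unit C)) => W.
by rewrite bs_unitl bs_unitr scale1r comp1m.
Qed.

Lemma monodromy_retract X Y Y' a (i : hom Y' Y) (r : hom Y Y') :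
  r ∘ i = idm Y' -> monodromy X Y a -> monodromy X Y' a.
Proof.
move=> ri h; have rri : (idm X ⊗m r) ∘ (idm X ⊗m i) = idm _.
  by rewrite -tensmCr ri tensm1.
rewrite /monodromy -[LHS]comp1m -rri -compA (compA (idm X ⊗m i)) -braid_nat.
by rewrite -(compA (braid Y X)) -braid_nat (compA (braid Y X)) h compZm comp1m compmZ rri.
Qed.

Lemma monodromy_iso X Y Y' a : Y ≅ Y' -> monodromy X Y a -> monodromy X Y' a.
Proof. by case=> f; apply: (monodromy_retract (fwdK f)). Qed.

Lemma monodromy_dsum (I : finType) (S : I -> C) X Y a :
  is_dsum S Y -> (forall i, monodromy X (S i) a) -> monodromy X Y a.
Proof.
move=> [inj [pr [_ _ h]]] hS.
rewrite /monodromy -[LHS]compm1 -tensm1 -h bmap_sumr comp_sumr scaler_sumr.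
apply: eq_bigr => i _; rewrite tensmCr compA -(compA (braid Y X)) braid_nat.
by rewrite compA braid_nat -(compA _ (braid _ X)) hS compmZ compm1 compZm.
Qed.

Lemma monodromy_inj X Y a b : idm (X ⊗ Y) <> 0 ->
  monodromy X Y a -> monodromy X Y b -> a = b.
Proof.
move=> n0; rewrite /monodromy => -> /eqP; rewrite -subr_eq0 -scalerBl scaler_eq0.
by rewrite subr_eq0 => /orP[/eqP|/eqP/n0].
Qed.

(** Passing two strands across two strands takes four crossings, each worth [w]. *)
Lemma braid_square X w : braid X X = w *: idm (X ⊗ X) :> hom _ _ ->
  braid (X ⊗ X) (X ⊗ X) = w ^+ 4 *: idm _ :> hom _ _.
Proof.
pose A := Leaf X => h.
have hw W : bs A A W = w *: idm _ by rewrite /bs h semZ sem1.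
apply: (@sem_inj _ _ (Node (Node A A) (Node A A)) (Node (Node A A) (Node A A))) => W.
rewrite semZ sem1 -[LHS]/(bs (Node A A) (Node A A) W).
rewrite bs_hex2 !bs_hex1 !hw !actmZ !actm1 !(compZm, compmZ, comp1m, scalerA).
by rewrite actmZ actm1 scalerA !exprS expr0 mulr1 !mulrA.
Qed.

(* With [g] seen as a right action of [D] on [X], a left action [f] of [A] on
   [X] commutes with [g] up to the scalar [a]. *)
Definition right_eigen X D (g : hom (X ⊗ D) X) Y (f : hom (Y ⊗ X) X) (a : k) : Prop :=
  g ∘ (f ⊗m idm D) = a *: (f ∘ (idm Y ⊗m g) ∘ asc Y X D).

Section RightEigen.
Variables (X D : C) (g : hom (X ⊗ D) X).
Local Notation eigen := (right_eigen g).

Let gS W : hom (X ⊗ (D ⊗ W)) (X ⊗ W) := @sem _ _ (Node (Leaf X) (Leaf D)) (Leaf X) g W.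
Let fS A (f : hom (val A ⊗ X) X) W : hom (act A (X ⊗ W)) (X ⊗ W) :=
  @sem _ _ (Node A (Leaf X)) (Leaf X) f W.

Lemma right_eigenP A (f : hom (val A ⊗ X) X) a : eigen f a <->
  forall W, gS W ∘ fS f (D ⊗ W) = a *: (fS f W ∘ actm A (gS W)).
Proof.
pose X' := Leaf X; pose D' := Leaf D.
have e1 W : @sem _ _ (Node (Node A X') D') X' (g ∘ (f ⊗m idm D)) W =
    gS W ∘ fS f (D ⊗ W).
  by rewrite (sem_comp (B := Node X' D')) sem_tens sem1 actm1 compm1.
have e2 W : @sem _ _ (Node (Node A X') D') X'
    (a *: (f ∘ (idm (val A) ⊗m g) ∘ asc (val A) X D)) W = a *: (fS f W ∘ actm A (gS W)).
  rewrite semZ (sem_comp (B := Node A (Node X' D'))) (sem_comp (B := Node A X')).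
  by rewrite sem_asc sem_tens sem1 compm1 comp1m.
split=> [h W|h]; first by rewrite -e1 h e2.
rewrite /right_eigen; apply: (@sem_inj _ _ (Node (Node A X') D') X') => W; rewrite e1 e2; exact: h.
Qed.

Lemma right_eigen_lu : eigen (lu X) 1.
Proof.
apply/(@right_eigenP (Unit C)) => W.
by rewrite /fS (sem_lu (Leaf X)) (sem_lu (Leaf X)) compm1 scale1r comp1m.
Qed.

Lemma right_eigen_mul Y Z (f : hom (Y ⊗ X) X) (h : hom (Z ⊗ X) X) a b :
  eigen f a -> eigen h b -> eigen (f ∘ (idm Y ⊗m h) ∘ asc Y Z X) (a * b).
Proof.
pose Y' := Leaf Y; pose Z' := Leaf Z; pose X' := Leaf X.
move=> /(@right_eigenP Y') ef /(@right_eigenP Z') eh.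
apply/(@right_eigenP (Node Y' Z')) => W.
have e V : @fS (Node Y' Z') (f ∘ (idm Y ⊗m h) ∘ asc Y Z X) V =
    @fS Y' f V ∘ (idm Y ⊗m @fS Z' h V).
  rewrite /fS (sem_comp (B := Node Y' (Node Z' X'))) (sem_comp (B := Node Y' X')).
  by rewrite sem_asc sem_tens sem1 compm1 comp1m.
rewrite !e compA ef compZm -compA /= -tensmCr eh bmapZr compmZ scalerA.
by rewrite tensmCr compA.
Qed.

Lemma right_eigenZ Y (f : hom (Y ⊗ X) X) a b : eigen f a -> eigen (b *: f) a.
Proof.
by rewrite /right_eigen => h; rewrite bmapZl compmZ h !compZm !scalerA mulrC.
Qed.

Lemma right_eigen_comp Y Z (f : hom (Y ⊗ X) X) (i : hom Z Y) a :
  eigen f a -> eigen (f ∘ (i ⊗m idm X)) a.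
Proof.
rewrite /right_eigen tensmCl compA => ->; rewrite compZm; congr (_ *: _).
rewrite -!compA asc_nat tensm1 (compA (idm Y ⊗m g)) (compA (i ⊗m _)).
by rewrite -tensm_lr -tensm_rl.
Qed.

Lemma right_eigen_dsum (I : finType) (S : I -> C) Y (f : hom (Y ⊗ X) X) a
    (inj : forall i, hom (S i) Y) (pr : forall i, hom Y (S i)) :
  \sum_i inj i ∘ pr i = idm Y ->
  (forall i, eigen (f ∘ (inj i ⊗m idm X)) a) -> eigen f a.
Proof.
move=> h ef; have -> : f = \sum_i f ∘ (inj i ⊗m idm X) ∘ (pr i ⊗m idm X).
  rewrite -[LHS]compm1 -tensm1 -h bmap_suml comp_sumr.
  by apply: eq_bigr => i _; rewrite tensmCl compA.
rewrite /right_eigen bmap_suml comp_sumr !comp_suml scaler_sumr.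
by apply: eq_bigr => i _; apply: right_eigen_comp.
Qed.

End RightEigen.

(** The right action here is the left action [f] turned around by the braiding. Sliding [f] through
    the crossing leaves one crossing of two copies of [D], hence the factor [w]. *)
Lemma right_eigen_braid X D (f : hom (D ⊗ X) X) w :
  braid D D = w *: idm (D ⊗ D) :> hom _ _ -> right_eigen (f ∘ braid X D) f w.
Proof.
move=> h; pose D' := Leaf D; pose X' := Leaf X.
apply/(@right_eigenP _ _ _ D') => W.
have hw V : bs D' D' V = w *: idm _ by rewrite /bs h semZ sem1.
have e V : @sem _ _ (Node X' D') X' (f ∘ braid X D) V =
    @sem _ _ (Node D' X') X' f V ∘ bs X' D' V.
  by rewrite (sem_comp (B := Node D' X')).
rewrite !e -compA.
have := @bs_nat (Node D' X') X' D' D' f (idm D) W.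
rewrite !sem1 actm1 compm1 comp1m => ->; rewrite bs_hex2 hw compZm compmZ.
by rewrite comp1m compmZ /= tensmCr compA.
Qed.

End Braided.

(** * The tensor product as a monoidal bifunctor, braided on centralizing pairs *)

Section TensorSwap.
Variables (k : fieldType) (C : bfusion k).
Implicit Types X Y Z W : C.
Local Notation unit := (unit_ : C).

Definition swap X Y X' Y' : iso ((X ⊗ Y) ⊗ (X' ⊗ Y')) ((X ⊗ X') ⊗ (Y ⊗ Y')) :=
  iso_trans (iso_sym (asc X X' (Y ⊗ Y')))
    (iso_trans (bmap_iso (tens C) (iso_refl X)
        (iso_trans (asc X' Y Y') (iso_trans
          (bmap_iso (tens C) (braid Y X') (iso_refl Y')) (iso_sym (asc Y X' Y')))))
      (asc X Y (X' ⊗ Y'))).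

Lemma sem_swap (X Y X' Y' : tree C) W :
  @sem _ _ (Node (Node X Y) (Node X' Y')) (Node (Node X X') (Node Y Y'))
    (swap (val X) (val Y) (val X') (val Y')) W = actm X (bs Y X' (act Y' W)).
Proof.
rewrite /swap /= (sem_comp (B := Node X (Node X' (Node Y Y')))).
rewrite (sem_comp (B := Node X (Node Y (Node X' Y')))) sem_ascV sem_asc.
rewrite comp1m compm1 (sem_tens (A := X) (A' := X)) sem1 comp1m.
rewrite (sem_comp (B := Node (Node X' Y) Y')) (sem_comp (B := Node (Node Y X') Y')).
by rewrite sem_ascV sem_asc comp1m compm1 sem_tens sem1 actm1 compm1.
Qed.

Lemma swap_nat X1 X1' Y1 Y1' X2 X2' Y2 Y2' (f1 : hom X1 X1') (g1 : hom Y1 Y1')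
    (f2 : hom X2 X2') (g2 : hom Y2 Y2') :
  swap X1' Y1' X2' Y2' ∘ ((f1 ⊗m g1) ⊗m (f2 ⊗m g2)) =
  ((f1 ⊗m f2) ⊗m (g1 ⊗m g2)) ∘ swap X1 Y1 X2 Y2.
Proof.
rewrite /= -!compA asc_nat !compA -asc_natV -!compA; congr (_ ∘ _).
rewrite !compA; congr (_ ∘ _); rewrite -!tensmC comp1m compm1; congr (_ ⊗m _).
rewrite -!compA asc_natV !compA -asc_nat; congr (_ ∘ _).
by rewrite -!compA; congr (_ ∘ _); rewrite -!tensmC braid_nat comp1m compm1.
Qed.

Lemma swap_asc X1 Y1 X2 Y2 X3 Y3 :
  (asc X1 X2 X3 ⊗m asc Y1 Y2 Y3) ∘ swap (X1 ⊗ X2) (Y1 ⊗ Y2) X3 Y3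
    ∘ (swap X1 Y1 X2 Y2 ⊗m idm (X3 ⊗ Y3))
  = swap X1 Y1 (X2 ⊗ X3) (Y2 ⊗ Y3) ∘ (idm (X1 ⊗ Y1) ⊗m swap X2 Y2 X3 Y3)
    ∘ asc (X1 ⊗ Y1) (X2 ⊗ Y2) (X3 ⊗ Y3).
Proof.
pose x1 := Leaf X1; pose y1 := Leaf Y1; pose x2 := Leaf X2; pose y2 := Leaf Y2.
pose x3 := Leaf X3; pose y3 := Leaf Y3.
apply: (@sem_inj _ _ (Node (Node (Node x1 y1) (Node x2 y2)) (Node x3 y3))
  (Node (Node x1 (Node x2 x3)) (Node y1 (Node y2 y3)))) => W.
rewrite (sem_comp (B := Node (Node (Node x1 x2) (Node y1 y2)) (Node x3 y3))).
rewrite (sem_comp (B := Node (Node (Node x1 x2) x3) (Node (Node y1 y2) y3))).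
rewrite (sem_comp (B := Node (Node x1 y1) (Node (Node x2 y2) (Node x3 y3)))).
rewrite (sem_comp (B := Node (Node x1 y1) (Node (Node x2 x3) (Node y2 y3)))).
rewrite (sem_tens (A := Node (Node x1 x2) x3) (A' := Node x1 (Node x2 x3))
  (B := Node (Node y1 y2) y3) (B' := Node y1 (Node y2 y3))).
rewrite (sem_tens (A := Node x1 y1) (A' := Node x1 y1)).
rewrite (sem_tens (B := Node x3 y3) (B' := Node x3 y3)).
rewrite (@sem_asc _ _ x1 x2 x3) (@sem_asc _ _ y1 y2 y3).
rewrite (@sem_asc _ _ (Node x1 y1) (Node x2 y2) (Node x3 y3)) !sem1 !actm1.
rewrite (@sem_swap (Node x1 x2) (Node y1 y2) x3 y3) (@sem_swap x1 y1 x2 y2).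
rewrite (@sem_swap x1 y1 (Node x2 x3) (Node y2 y3)) (@sem_swap x2 y2 x3 y3).
rewrite bs_hex2 bs_hex1 /= !(comp1m, compm1, tensmCr).
rewrite -!compA; congr (_ ∘ _); rewrite -!tensmCr; congr (_ ⊗m _).
exact/esym/(@bs_natW _ _ y1 x2).
Qed.

Lemma swap_lu X Y :
  (lu X ⊗m lu Y) ∘ swap unit unit X Y ∘ (bwd (lu unit) ⊗m idm (X ⊗ Y)) = lu (X ⊗ Y).
Proof.
pose u := Unit C; pose x := Leaf X; pose y := Leaf Y.
apply: (@sem_inj _ _ (Node u (Node x y)) (Node x y)) => W.
rewrite (sem_comp (B := Node (Node u u) (Node x y))).
rewrite (sem_comp (B := Node (Node u x) (Node u y))).
rewrite (sem_tens (A := Node u x) (A' := x) (B := Node u y) (B' := y)).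
rewrite (sem_tens (A := u) (A' := Node u u)).
rewrite (@sem_lu _ _ x) (@sem_lu _ _ y) (@sem_lu _ _ (Node x y)).
rewrite (@sem_luV _ _ u) (@sem_swap u u x y) bs_unitl.
by rewrite !sem1 /= !(tensm1, comp1m).
Qed.

Lemma swap_ru X Y :
  (ru X ⊗m ru Y) ∘ swap X Y unit unit ∘ (idm (X ⊗ Y) ⊗m bwd (lu unit)) = ru (X ⊗ Y).
Proof.
pose u := Unit C; pose x := Leaf X; pose y := Leaf Y.
apply: (@sem_inj _ _ (Node (Node x y) u) (Node x y)) => W.
rewrite (sem_comp (B := Node (Node x y) (Node u u))).
rewrite (sem_comp (B := Node (Node x u) (Node y u))).
rewrite (sem_tens (A := Node x u) (A' := x) (B := Node y u) (B' := y)).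
rewrite (sem_tens (B := u) (B' := Node u u)).
rewrite (@sem_ru _ _ x) (@sem_ru _ _ y) (@sem_ru _ _ (Node x y)).
rewrite (@sem_luV _ _ u) (@sem_swap x y u u) bs_unitr.
by rewrite !sem1 /= !(tensm1, comp1m).
Qed.

(** The two sides consist of the same crossings, except that the right one also contains the double
    crossing of [X] with [Y'], which the hypothesis removes. *)
Lemma swap_braid X Y X' Y' : monodromy X Y' 1 ->
  (braid X X' ⊗m braid Y Y') ∘ swap X Y X' Y' =
  swap X' Y' X Y ∘ braid (X ⊗ Y) (X' ⊗ Y').
Proof.
pose x := Leaf X; pose y := Leaf Y; pose x' := Leaf X'; pose y' := Leaf Y'.
move/(monodromyP x y') => h.
apply: (@sem_inj _ _ (Node (Node x y) (Node x' y')) (Node (Node x' x) (Node y' y))) => W.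
rewrite (sem_comp (B := Node (Node x x') (Node y y'))).
rewrite (sem_comp (B := Node (Node x' y') (Node x y))).
rewrite (@sem_swap x y x' y') (@sem_swap x' y' x y).
rewrite (sem_tens (A := Node x x') (A' := Node x' x)).
rewrite -[X in _ = _ ∘ X]/(bs (Node x y) (Node x' y') W) bs_hex2 !bs_hex1.
rewrite -[@sem _ _ (Node x x') (Node x' x) (fwd (braid X X')) _]/(bs x x' _).
rewrite -[@sem _ _ (Node y y') (Node y' y) (fwd (braid Y Y')) _]/(bs y y' _).
have h' : actm x' (bs y' x (act y W)) ∘ actm x' (bs x y' (act y W)) = idm _.
  by rewrite -actm_comp h scale1r actm1.
rewrite /= in h' *; rewrite compA compA h' comp1m.
by rewrite tensmCr !compA.
Qed.

End TensorSwap.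
(** * Fusion subcategories *)

Section Split.
Variables (k : fieldType) (C : lincat k).

(** Retracts are kernels of idempotents, so a component closed under kernels is closed under
    retracts. *)
Lemma split_mono_ker (X Y : C) (f : hom X Y) (r : hom Y X) :
  r ∘ f = idm X -> is_ker (idm Y - f ∘ r) f.
Proof.
move=> rf; split; first by rewrite compBm comp1m -compA rf compm1 subrr.
move=> Z g; rewrite compBm comp1m => /eqP; rewrite subr_eq0 => /eqP eg.
exists (r ∘ g); split=> [|h <-]; first by rewrite compA -eg.
by rewrite compA rf comp1m.
Qed.

Lemma split_epi_coker (X Y : C) (f : hom X Y) (s : hom Y X) :
  f ∘ s = idm Y -> is_coker (idm X - s ∘ f) f.
Proof.
move=> fs; split; first by rewrite compmB compm1 compA fs comp1m subrr.
move=> Z g; rewrite compmB compm1 => /eqP; rewrite subr_eq0 => /eqP eg.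
exists (g ∘ s); split=> [|h <-]; first by rewrite -compA -eg.
by rewrite -compA fs compm1.
Qed.

End Split.

Section Subcategory.
Variables (k : closedFieldType) (C : bfusion k) (P : C -> Prop).

(** Closure under retracts covers kernels, cokernels and simple summands at once, since all of them
    split in [C]. *)
Record fusion_sub : Prop := FusionSub {
  fs_retract : forall (X Y : C) (i : hom Y X) (r : hom X Y),
    r ∘ i = idm Y -> P X -> P Y;
  fs_dsum : forall X Y Z : C, is_dsum2 X Y Z -> P X -> P Y -> P Z;
  fs_zero : forall X : C, is_zero X -> P X;
  fs_unit : P unit_;
  fs_tens : forall X Y : C, P X -> P Y -> P (X ⊗ Y);
  fs_dual : forall X : C, P X -> P (dual X)
}.

Hypothesis Psub : fusion_sub.
Hypothesis pivot : forall X : C, iso X (dual (dual X)).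

Lemma fs_iso (X Y : C) : X ≅ Y -> P X -> P Y.
Proof. by case=> f; apply: (fs_retract Psub (fwdK f)). Qed.

Definition sub_lincat : lincat k :=
  @LinCat k {X : C | P X} (fun X Y => hom (sval X) (sval Y))
    (fun X => idm (sval X)) (fun X Y Z g f => g ∘ f)
    (fun X Y Z f => @comp_linearl k C _ _ _ f)
    (fun X Y Z g => @comp_linearr k C _ _ _ g)
    (fun X Y f => @comp1m k C _ _ f) (fun X Y f => @compm1 k C _ _ f)
    (fun X Y Z W h g f => @compA k C _ _ _ _ h g f).

Definition sub_iso (X Y : sub_lincat) (f : iso (sval X) (sval Y)) : iso X Y :=
  @Iso k sub_lincat X Y (fwd f) (bwd f) (bwdK f) (fwdK f).

Definition sub_unlift (X Y : sub_lincat) (f : iso X Y) : iso (sval X) (sval Y) :=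
  @Iso k C (sval X) (sval Y) (fwd f) (bwd f) (bwdK f) (fwdK f).

Lemma sub_isom (X Y : sub_lincat) : X ≅ Y <-> sval X ≅ sval Y.
Proof. by split=> -[f]; constructor; [apply: sub_unlift|apply: sub_iso]. Qed.

Lemma sub_zero (X : sub_lincat) : is_zero X <-> is_zero (sval X).
Proof. by rewrite !is_zeroP. Qed.

Let Cab : abelian C := fusion_abelian C.
Let Css : semisimple C := @fusion_semisimple _ C.

(** The kernel taken in [C] is a retract of [X], so it lies in the subcategory, where monicity of
    [f] forces its inclusion to vanish. *)
Lemma sub_mono (X Y : sub_lincat) (f : hom X Y) :
  is_mono f <-> @is_mono _ C (sval X) (sval Y) f.
Proof.
split=> fm; last by move=> Z g h; apply: fm.
have [K [i ki]] := ab_ker Cab (f : hom (sval X) (sval Y)).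
have [r ri] := ker_split Cab Css ki.
case: ki => fi ui.
have PK : P K := fs_retract Psub ri (proj2_sig X).
have i0 : i = 0.
  exact: (fm (exist _ K PK) i 0 (etrans fi (esym (@compm0 k C _ _ _ f)))).
move=> Z g h e; apply/eqP; rewrite -subr_eq0; apply/eqP.
have [|x [<- _]] := ui Z (g - h); last by rewrite i0 comp0m.
by rewrite compmB e subrr.
Qed.

Lemma sub_epi (X Y : sub_lincat) (f : hom X Y) :
  is_epi f -> exists s : hom Y X, f ∘ s = idm Y.
Proof.
move=> fe; have [g e] := hom_regular Cab Css (f : hom (sval X) (sval Y)).
by exists g; apply: fe; apply: etrans e (esym (@comp1m k C _ _ f)).
Qed.

Lemma sub_simple (X : sub_lincat) : simple X <-> simple (sval X).
Proof.
have z (Y : sub_lincat) : is_zero (sval Y) -> is_zero Y := (sub_zero Y).2.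
have z' (Y : sub_lincat) : is_zero Y -> is_zero (sval Y) := (sub_zero Y).1.
split=> -[X0 Xs]; split.
- by move=> h; apply/X0/z.
- move=> Y i im; have [r ri] := mono_split Cab Css im.
  pose Y' : sub_lincat := exist _ Y (fs_retract Psub ri (proj2_sig X)).
  have im' : @is_mono _ sub_lincat Y' X i by apply/sub_mono.
  have [Y0|[j ij]] := Xs Y' i im'; [left; exact: (z' Y')|right].
  by exists (sub_unlift j).
- by move=> h; apply/X0/z'.
- move=> Y i /sub_mono im; have [Y0|[j ij]] := Xs _ _ im; [left; exact: z|right].
  by exists (sub_iso j).
Qed.

Lemma sub_abelian : abelian sub_lincat.
Proof.
split.
- have [Z Z0] := ab_zero Cab.
  by exists (exist _ Z (fs_zero Psub Z0)); apply/sub_zero.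
- move=> X Y; have [Z ZXY] := ab_dsum Cab (sval X) (sval Y).
  exists (exist _ Z (fs_dsum Psub ZXY (proj2_sig X) (proj2_sig Y))).
  by apply/dsum2P; move/dsum2P: (ZXY).
- move=> X Y f; have [K [i ki]] := ab_ker Cab (f : hom (sval X) (sval Y)).
  have [r ri] := ker_split Cab Css ki; case: ki => fi ui.
  exists (exist _ K (fs_retract Psub ri (proj2_sig X))), i; split=> // Z.
  exact: (ui (sval Z)).
- move=> X Y f; have [Q [p cp]] := ab_coker Cab (f : hom (sval X) (sval Y)).
  have [s [_ [ps _]]] := coker_split Cab Css cp; case: cp => pf up.
  exists (exist _ Q (fs_retract Psub ps (proj2_sig Y))), p; split=> // Z.
  exact: (up (sval Z)).
- move=> X Y f /sub_mono fm; have [r rf] := mono_split Cab Css fm.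
  by exists Y, (idm Y - f ∘ (r : hom Y X)); exact: (@split_mono_ker k sub_lincat _ _ _ _ rf).
- move=> X Y f fe; have [s fs] := sub_epi fe.
  by exists X, (idm X - s ∘ f); exact: (@split_epi_coker k sub_lincat _ _ _ _ fs).
Qed.

Lemma sub_semisimple : semisimple sub_lincat.
Proof.
move=> X; have [n [S [sS [inj [pr [h1 h2 h3]]]]]] := Css (sval X).
pose S' i : sub_lincat := exist _ (S i) (fs_retract Psub (h1 i) (proj2_sig X)).
exists n, S'; split=> [i|]; first exact: (proj2 (sub_simple (S' i)) (sS i)).
by exists inj, pr.
Qed.

Lemma sub_finite : finitely_many_simples sub_lincat.
Proof.
have [n [S SP]] := @fusion_finite _ C.
(* Representatives outside the subcategory are replaced by the unit as a dummy value. *)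
exists n, (fun i => if pselect (P (S i)) is left PS then exist _ (S i) PS
                    else exist _ unit_ (fs_unit Psub)) => X /sub_simple sX.
have [i iX] := SP _ sX; exists i; case: pselect => [PS|[]].
  exact/sub_isom.
exact: fs_iso iX (proj2_sig X).
Qed.

Definition sub_tens : bifunctor sub_lincat sub_lincat sub_lincat :=
  @Bifunctor k sub_lincat sub_lincat sub_lincat
    (fun X Y => exist _ (sval X ⊗ sval Y)
                  (fs_tens Psub (proj2_sig X) (proj2_sig Y)))
    (fun X X' Y Y' f g => f ⊗m g)
    (fun X X' Y Y' g => @bmap_linearl _ _ _ _ (tens C) _ _ _ _ g)
    (fun X X' Y Y' f => @bmap_linearr _ _ _ _ (tens C) _ _ _ _ f)
    (fun X Y => @bmap1 _ _ _ _ (tens C) _ _)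
    (fun X X' X'' Y Y' Y'' f' f g' g =>
       @bmap_comp _ _ _ _ (tens C) _ _ _ _ _ _ f' f g' g).

Definition sub_moncat : moncat k :=
  @MonCat k sub_lincat sub_tens (exist _ unit_ (fs_unit Psub))
    (fun X Y Z => @sub_iso (sub_tens (sub_tens X Y) Z) (sub_tens X (sub_tens Y Z))
       (asc (sval X) (sval Y) (sval Z)))
    (fun X => @sub_iso (sub_tens (exist _ unit_ (fs_unit Psub)) X) X (lu (sval X)))
    (fun X => @sub_iso (sub_tens X (exist _ unit_ (fs_unit Psub))) X (ru (sval X)))
    (fun X X' Y Y' Z Z' f g h => @asc_nat k C _ _ _ _ _ _ f g h)
    (fun X Y f => @lu_nat k C _ _ f)
    (fun X Y f => @ru_nat k C _ _ f)
    (fun X Y Z W => @pentagon k C (sval X) (sval Y) (sval Z) (sval W))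
    (fun X Y => @triangle k C (sval X) (sval Y)).

Let sub_dual (X : sub_moncat) : sub_moncat :=
  exist _ (dual (sval X)) (fs_dual Psub (proj2_sig X)).

(* An isomorphism of [X] with its double dual makes the left dual a right dual. *)
Lemma sub_right_dual (X : sub_moncat) : exists (Y : sub_moncat)
  (e : hom (X ⊗ Y) unit_) (d : hom unit_ (Y ⊗ X)), is_dual e d.
Proof.
exists (sub_dual X), (ev (dual (sval X)) ∘ (pivot (sval X) ⊗m idm _)),
  ((idm _ ⊗m bwd (pivot (sval X))) ∘ coev (dual (sval X))).
exact: (dual_iso (pivot (sval X)) (dualP (dual (sval X)))).
Qed.

Lemma sub_simple_unit : simple (unit_ : sub_moncat).
Proof. by apply/sub_simple; apply: (@fusion_unit _ C). Qed.

Definition sub_fusion : fusion k :=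
  @Fusion k sub_moncat sub_dual
    (fun X => @ev _ C (sval X)) (fun X => @coev _ C (sval X))
    (fun X => @dualP _ C (sval X)) sub_right_dual
    sub_abelian sub_semisimple sub_finite sub_simple_unit.

Definition sub_bfusion : bfusion k :=
  @BFusion k sub_fusion
    (fun X Y => @sub_iso (sub_tens X Y) (sub_tens Y X) (braid (sval X) (sval Y)))
    (fun X X' Y Y' f g => @braid_nat _ C _ _ _ _ f g)
    (fun X Y Z => @hexagon1 _ C (sval X) (sval Y) (sval Z))
    (fun X Y Z => @hexagon2 _ C (sval X) (sval Y) (sval Z)).

Lemma sub_spherical (a : forall X : C, iso X (dual (dual X))) : is_spherical a ->
  exists b : (forall X : sub_bfusion, iso X (dual (dual X))), is_spherical b.
Proof.
case=> -[h1 h2] h3.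
exists (fun X : sub_bfusion => @sub_iso X (sub_dual (sub_dual X)) (a (sval X))).
by split; [split=> [X Y f|X Y]|move=> X]; [apply: h1|apply: h2|apply: h3].
Qed.

Lemma sub_invertibleW (X : sub_bfusion) : invertible X -> invertible (sval X).
Proof.
case=> Y [h1 h2]; exists (sval Y).
by split; [exact: ((sub_isom _ _).1 h1)|exact: ((sub_isom _ _).1 h2)].
Qed.

End Subcategory.
(** * A criterion for Deligne products *)

Lemma linear_sumf (k : fieldType) (U V : lmodType k) (I : finType)
    (f : I -> U -> V) :
  (forall i, linear (f i)) -> linear (fun u => \sum_i f i u).
Proof.
move=> lf a u v; rewrite scaler_sumr -big_split /=.
by apply: eq_bigr => i _; apply: lf.
Qed.

Section Decomposition.
Variables (k : closedFieldType) (C : lincat k).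

(** Semisimplicity as data, so that summands and structure maps can be chosen for all objects
    simultaneously. *)
Record decomposition (X : C) := Decomposition {
  dec_n : nat;
  dec_S : 'I_dec_n -> C;
  dec_simple : forall i, simple (dec_S i);
  dec_inj : forall i, hom (dec_S i) X;
  dec_pr : forall i, hom X (dec_S i);
  dec_injK : forall i, dec_pr i ∘ dec_inj i = idm (dec_S i);
  dec_inj0 : forall i j, i != j -> dec_pr j ∘ dec_inj i = 0;
  dec_sum : \sum_i dec_inj i ∘ dec_pr i = idm X
}.

Lemma decomposition_exists : semisimple C ->
  exists _ : forall X : C, decomposition X, True.
Proof.
move=> Css; have d (X : C) : exists _ : decomposition X, True.
  have [n [S [sS [inj [pr [h1 h2 h3]]]]]] := Css X.
  by exists (Decomposition sS h1 h2 h3).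
by exists (fun X => sval (cid (d X))).
Qed.

End Decomposition.

Section Deligne.
Variables (k : closedFieldType) (B I E : lincat k) (T : bifunctor B I E).
Hypotheses (Bab : abelian B) (Bss : semisimple B).
Hypotheses (Iab : abelian I) (Iss : semisimple I).
Hypotheses (Eab : abelian E) (Ess : semisimple E).
Hypothesis T_simple : forall b c, simple b -> simple c -> simple (T b c).
Hypothesis T_inj : forall b b' c c', simple b -> simple b' -> simple c ->
  simple c' -> T b c ≅ T b' c' -> b ≅ b' /\ c ≅ c'.
Hypothesis T_surj : forall s, simple s ->
  exists b c, [/\ simple b, simple c & s ≅ T b c].

(** By Schur this Hom space is a line or zero. In the zero case one of [v], [w] vanishes as well,
    which keeps the rule [bmap T v w] to [bmap F v w] consistent there. *)
Lemma T_hom_simple b b' c c' : simple b -> simple b' -> simple c -> simple c' ->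
  (exists (v : iso b b') (w : iso c c'),
     forall h : hom (T b c) (T b' c'), exists a, h = a *: bmap T v w) \/
  (forall h : hom (T b c) (T b' c'), h = 0) /\
  (forall (v : hom b b') (w : hom c c'), v = 0 \/ w = 0).
Proof.
move=> sb sb' sc sc'.
have [iT|niT] := pselect (T b c ≅ T b' c').
  have [[v] [w]] := T_inj sb sb' sc sc' iT; left; exists v, w => h.
  exact: (simple_hom_scalar Eab (bmap_iso T v w) h (T_simple sb sc)).
right; split=> [h|v w].
  apply: contrapT => h0; apply: niT.
  exact: (simple_iso_of_hom Eab (T_simple sb sc) (T_simple sb' sc') h0).
have [->|v0] := pselect (v = 0); first by left.
have [->|w0] := pselect (w = 0); first by right.
by case: niT; apply: bmap_isom; [apply: (simple_iso_of_hom Bab _ _ v0)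
  |apply: (simple_iso_of_hom Iab _ _ w0)].
Qed.

Section Extension.
Variables (A : lincat k) (F : bifunctor B I A).

(** On a line the value at one generator determines [phi]; Schur in each variable makes all other
    pairs [v], [w] multiples of the generating one. *)
Lemma ext_simple b b' c c' : simple b -> simple b' -> simple c -> simple c' ->
  exists phi : hom (T b c) (T b' c') -> hom (F b c) (F b' c'),
    linear phi /\ forall v w, phi (bmap T v w) = bmap F v w.
Proof.
move=> sb sb' sc sc'; have sT := T_simple sb sc.
have [[v [w h]]|[_ vw0]] := T_hom_simple sb sb' sc sc'; last first.
  exists (fun=> 0); split=> [a x y|v w]; first by rewrite scaler0 addr0.
  by have [->|->] := vw0 v w; rewrite ?bmap0l ?bmap0r.
have T0 x y : x *: bmap T v w = y *: bmap T v w -> x = y.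
  move=> e; apply: (scalar_idm_inj (simple_idm_neq0 sT)).
  have := congr1 (fun f => bwd (bmap_iso T v w) ∘ f) e.
  by rewrite !compmZ -[bmap T v w]/(fwd (bmap_iso T v w)) bwdK.
pose c0 x := sval (cid (h x)).
have cE x : x = c0 x *: bmap T v w by rewrite /c0; case: (cid (h x)).
exists (fun x => c0 x *: bmap F v w); split=> [a x y|v' w'].
  rewrite scalerA -scalerDl; congr (_ *: _); apply: T0.
  by rewrite -cE scalerDl -scalerA -!cE.
have [x xE] := simple_hom_scalar Bab v v' sb.
have [y yE] := simple_hom_scalar Iab w w' sc.
rewrite xE yE bmapZl bmapZr scalerA [RHS]bmapZl bmapZr scalerA.
by congr (_ *: _); apply: T0; rewrite -cE.
Qed.

(** Cut a morphism into matrix entries between simple summands, extend each entry by [ext_simple],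
    and reassemble in the target of [F]. *)
Lemma ext_exists : exists phi : forall X X' Y Y',
    hom (T X Y) (T X' Y') -> hom (F X Y) (F X' Y'),
  (forall X X' Y Y', linear (@phi X X' Y Y')) /\
  forall X X' Y Y' (v : hom X X') (w : hom Y Y'), phi _ _ _ _ (bmap T v w) = bmap F v w.
Proof.
have [dB _] := decomposition_exists Bss; have [dI _] := decomposition_exists Iss.
have h b b' c c' (sb : simple b) (sb' : simple b') (sc : simple c) (sc' : simple c') :=
  cid (ext_simple sb sb' sc sc').
pose SB X := dec_S (d := dB X); pose SI Y := dec_S (d := dI Y).
pose ps X X' Y Y' (i : 'I_(dec_n (dB X))) (i' : 'I_(dec_n (dB X')))
  (j : 'I_(dec_n (dI Y))) (j' : 'I_(dec_n (dI Y'))) :=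
  sval (h _ _ _ _ (dec_simple i) (dec_simple i') (dec_simple j) (dec_simple j')).
have psP X X' Y Y' i i' j j' : linear (@ps X X' Y Y' i i' j j') /\
    forall v w, ps X X' Y Y' i i' j j' (bmap T v w) = bmap F v w.
  by rewrite /ps; case: (h _ _ _ _ _ _ _ _).
exists (fun X X' Y Y' f => \sum_i \sum_j \sum_i' \sum_j'
  bmap F (dec_inj i') (dec_inj j') ∘
  ps X X' Y Y' i i' j j'
    (bmap T (dec_pr i') (dec_pr j') ∘ f ∘ bmap T (dec_inj i) (dec_inj j))
  ∘ bmap F (dec_pr i) (dec_pr j)).
split=> [X X' Y Y'|X X' Y Y' v w].
  do 4!(apply: linear_sumf => ?; cbv beta); move=> a x y.
  rewrite compmD compmZ compDm compZm (proj1 (psP _ _ _ _ _ _ _ _)).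
  by rewrite compmD compmZ compDm compZm.
have e i j : \sum_i' \sum_j' bmap F (dec_inj i') (dec_inj j') ∘
    ps X X' Y Y' i i' j j'
      (bmap T (dec_pr i') (dec_pr j') ∘ bmap T v w ∘ bmap T (dec_inj i) (dec_inj j))
    ∘ bmap F (dec_pr i) (dec_pr j) =
    bmap F (v ∘ (dec_inj i ∘ dec_pr i)) (w ∘ (dec_inj j ∘ dec_pr j)).
  rewrite -[v in RHS]comp1m -[w in RHS]comp1m -(dec_sum (dB X')) -(dec_sum (dI Y')).
  rewrite !comp_suml bmap_suml.
  apply: eq_bigr => i' _; rewrite bmap_sumr; apply: eq_bigr => j' _.
  by rewrite -!bmap_comp (proj2 (psP _ _ _ _ _ _ _ _)) -!bmap_comp !compA.
under eq_bigr do under eq_bigr do rewrite e.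
rewrite -[v in RHS]compm1 -[w in RHS]compm1 -(dec_sum (dB X)) -(dec_sum (dI Y)).
rewrite !comp_sumr bmap_suml.
by apply: eq_bigr => i _; rewrite bmap_sumr.
Qed.

End Extension.

(** This allows identities linear in [h], such as functoriality of the extension, to be checked on
    pure morphisms only. *)
Lemma T_span X X' Y Y' (h : hom (T X Y) (T X' Y')) :
  exists s : seq (hom X X' * hom Y Y'), h = \sum_(p <- s) bmap T p.1 p.2.
Proof.
pose sp X X' Y Y' (h : hom (T X Y) (T X' Y')) :=
  exists s : seq (hom X X' * hom Y Y'), h = \sum_(p <- s) bmap T p.1 p.2.
have sp_sum (J : finType) (f : J -> hom (T X Y) (T X' Y')) :
    (forall i, sp _ _ _ _ (f i)) -> sp _ _ _ _ (\sum_i f i).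
  move=> hf; elim/big_rec: _ => [|i x _ [s ->]]; first by exists [::]; rewrite big_nil.
  by have [s' ->] := hf i; exists (s' ++ s); rewrite big_cat.
have [dB _] := decomposition_exists Bss; have [dI _] := decomposition_exists Iss.
have idT X0 Y0 : idm (T X0 Y0) = \sum_i \sum_j
    bmap T (dec_inj (d := dB X0) i) (dec_inj (d := dI Y0) j) ∘
    bmap T (dec_pr i) (dec_pr j).
  rewrite -bmap1 -(dec_sum (dB X0)) -(dec_sum (dI Y0)) bmap_suml.
  apply: eq_bigr => i _; rewrite bmap_sumr; apply: eq_bigr => j _.
  by rewrite bmap_comp.
rewrite -/(sp _ _ _ _ h) -[h]comp1m idT comp_suml; apply: (sp_sum) => i'.
rewrite comp_suml; apply: (sp_sum) => j'.
rewrite -[h]compm1 idT !comp_sumr; apply: (sp_sum) => i.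
rewrite !comp_sumr; apply: (sp_sum) => j.
have -> : bmap T (dec_inj i') (dec_inj j') ∘ bmap T (dec_pr i') (dec_pr j') ∘
    (h ∘ (bmap T (dec_inj i) (dec_inj j) ∘ bmap T (dec_pr i) (dec_pr j))) =
    bmap T (dec_inj i') (dec_inj j') ∘
    (bmap T (dec_pr i') (dec_pr j') ∘ h ∘ bmap T (dec_inj i) (dec_inj j)) ∘
    bmap T (dec_pr i) (dec_pr j) by rewrite !compA.
move: (_ ∘ h ∘ _) => f.
have [[v [w hE]]|[h0 _]] := T_hom_simple (dec_simple i) (dec_simple i')
    (dec_simple j) (dec_simple j'); last first.
  by exists [::]; rewrite big_nil (h0 f) compm0 comp0m.
have [a ->] := hE f.
exists [:: (a *: (dec_inj i' ∘ v ∘ dec_pr i), dec_inj j' ∘ w ∘ dec_pr j)].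
by rewrite big_seq1 /= bmapZl !bmap_comp compmZ compZm.
Qed.

(** Every object of [E] is a sum of objects [T b c], so a bifunctor [F] determines a functor on [E]
    by sending such a sum to the sum of the [F b c]. *)
Lemma deligne_criterion : is_deligne T.
Proof.
split=> [//||A Aab]; first exact: semisimple_right_exact2.
have span_ind X X' Y Y' (R : hom (T X Y) (T X' Y') -> Prop) : R 0 ->
    (forall f g, R f -> R g -> R (f + g)) -> (forall v w, R (bmap T v w)) ->
    forall h, R h.
  move=> R0 RD RT h; have [s ->] := T_span h.
  by elim/big_ind: _ => // -[v w] _.
have decE : exists d : forall Z : E, {n & {b : 'I_n -> B & {c : 'I_n -> I &
    {inj : forall i, hom (T (b i) (c i)) Z & {pr : forall i, hom Z (T (b i) (c i)) |
    [/\ forall i, pr i ∘ inj i = idm _, forall i j, i != j -> pr j ∘ inj i = 0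
      & \sum_i inj i ∘ pr i = idm Z]}}}}}, True.
  have d (Z : E) : exists _ : {n & {b : 'I_n -> B & {c : 'I_n -> I &
    {inj : forall i, hom (T (b i) (c i)) Z & {pr : forall i, hom Z (T (b i) (c i)) |
    [/\ forall i, pr i ∘ inj i = idm _, forall i j, i != j -> pr j ∘ inj i = 0
      & \sum_i inj i ∘ pr i = idm Z]}}}}}, True.
    have [n [S [sS SZ]]] := Ess Z.
    have h i := cid (T_surj (sS i)).
    have h' i := cid (svalP (h i)).
    have [|inj [pr H]] := is_dsum_eq (S' := fun i => T (sval (h i)) (sval (h' i))) _ SZ.
      by move=> i; case: (svalP (h' i)).
    by exists (existT _ n (existT _ (fun i => sval (h i))
      (existT _ (fun i => sval (h' i)) (existT _ inj (exist _ pr H))))).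
  by exists (fun Z => sval (cid (d Z))).
case: decE => d _.
pose n Z := tag (d Z).
pose b Z : 'I_(n Z) -> B := tag (tagged (d Z)).
pose c Z : 'I_(n Z) -> I := tag (tagged (tagged (d Z))).
pose inj Z : forall i : 'I_(n Z), hom (T (b Z i) (c Z i)) Z :=
  tag (tagged (tagged (tagged (d Z)))).
pose pr Z : forall i : 'I_(n Z), hom Z (T (b Z i) (c Z i)) :=
  sval (tagged (tagged (tagged (tagged (d Z))))).
have dP Z : [/\ forall i, pr Z i ∘ inj Z i = idm _,
    forall i j, i != j -> pr Z j ∘ inj Z i = 0 & \sum_i inj Z i ∘ pr Z i = idm Z].
  exact: (svalP (tagged (tagged (tagged (tagged (d Z)))))).
have injK Z i : pr Z i ∘ inj Z i = idm _ by case: (dP Z).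
have inj0 Z i j : i != j -> pr Z j ∘ inj Z i = 0 by case: (dP Z) => _ h _; apply: h.
have dsum Z : \sum_i inj Z i ∘ pr Z i = idm Z by case: (dP Z).
move: inj pr {dP} injK inj0 dsum => inj pr injK inj0 dsum.
split=> [F _|F G _ _ t tnat].
  have [phi [lphi phiT]] := ext_exists F.
  have phi_comp X X' X'' Y Y' Y'' (g : hom (T X' Y') (T X'' Y'')) (f : hom (T X Y) (T X' Y')) :
      phi _ _ _ _ (g ∘ f) = phi _ _ _ _ g ∘ phi _ _ _ _ f.
    move: g; apply: (span_ind) => [|g g' e e'|v w].
    - by rewrite comp0m !(lin0 (lphi _ _ _ _)) comp0m.
    - by rewrite compDm !(linD (lphi _ _ _ _)) compDm e e'.
    move: f; apply: (span_ind) => [|f f' e e'|v' w'].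
    - by rewrite compm0 !(lin0 (lphi _ _ _ _)) compm0.
    - by rewrite compmD !(linD (lphi _ _ _ _)) compmD e e'.
    by rewrite -bmap_comp !phiT bmap_comp.
  have phi1 X Y : phi _ _ _ _ (idm (T X Y)) = idm _ by rewrite -bmap1 phiT bmap1.
  have hA Z := cid (dsum_exists Aab (fun i => F (b Z i) (c Z i))).
  pose ob Z := sval (hA Z).
  have hi Z := cid (svalP (hA Z)); pose ai Z := sval (hi Z).
  have hp Z := cid (svalP (hi Z)); pose ap Z := sval (hp Z).
  have aK Z i : ap Z i ∘ ai Z i = idm _ by case: (svalP (hp Z)).
  have a0 Z i j : i != j -> ap Z j ∘ ai Z i = 0.
    by case: (svalP (hp Z)) => _ h _; apply: h.
  have asum Z : \sum_i ai Z i ∘ ap Z i = idm (ob Z) by case: (svalP (hp Z)).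
  move: ai ap aK a0 asum => ai ap aK a0 asum.
  (* [fm] acts on matrices: each entry of [f] between summands of [X] and [Y] is replaced by its
     image under [phi]. *)
  pose fm X Y (f : hom X Y) := \sum_i \sum_j
    ai Y j ∘ phi _ _ _ _ (pr Y j ∘ f ∘ inj X i) ∘ ap X i.
  have ap_fm X Y (f : hom X Y) j :
      ap Y j ∘ fm X Y f = \sum_i phi _ _ _ _ (pr Y j ∘ f ∘ inj X i) ∘ ap X i.
    rewrite comp_sumr; apply: eq_bigr => i _; rewrite comp_sumr.
    rewrite (bigD1 j) //= big1 ?addr0 => [|j' nj].
      by rewrite !compA aK comp1m.
    by rewrite !compA a0 // !comp0m.
  have fm_lin X Y : linear (fm X Y).
    do 2!(apply: linear_sumf => ?; cbv beta); move=> a x y.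
    by rewrite compmD compmZ compDm compZm lphi compmD compmZ compDm compZm.
  have eq_ap X Y (f g : hom X (ob Y)) : (forall j, ap Y j ∘ f = ap Y j ∘ g) -> f = g.
    move=> e; rewrite -[f]comp1m -[g]comp1m -asum !comp_suml.
    by apply: eq_bigr => j _; rewrite -!compA e.
  have fm1 X : fm X X (idm X) = idm (ob X).
    apply: (eq_ap) => j; rewrite ap_fm compm1 (bigD1 j) //= big1 ?addr0 => [|i ij].
      by rewrite compm1 injK phi1 comp1m.
    by rewrite inj0 // (lin0 (lphi _ _ _ _)) comp0m.
  have fm_comp X Y Z (g : hom Y Z) (f : hom X Y) : fm X Z (g ∘ f) = fm Y Z g ∘ fm X Y f.
    apply: (eq_ap) => l; rewrite compA !ap_fm comp_suml.
    under [RHS]eq_bigr do rewrite -compA ap_fm comp_sumr.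
    rewrite exchange_big /=; apply: eq_bigr => i _.
    under eq_bigr do rewrite compA -phi_comp.
    rewrite -comp_suml -(lin_sum (lphi _ _ _ _)); congr (phi _ _ _ _ _ ∘ _).
    rewrite -[f in LHS]comp1m -dsum comp_suml !comp_sumr comp_suml.
    by apply: eq_bigr => j _; rewrite !compA.
  pose F' := @Functor k E A ob fm fm_lin fm1 fm_comp.
  exists F'; split; first exact: semisimple_right_exact.
  (* The decomposition chosen for [T X Y] is arbitrary; its structure maps, transported by [phi],
     compare the resulting sum with [F X Y]. *)
  pose u X Y : hom (ob (T X Y)) (F X Y) := \sum_i phi _ _ _ _ (inj (T X Y) i) ∘ ap _ i.
  pose u' X Y : hom (F X Y) (ob (T X Y)) := \sum_i ai _ i ∘ phi _ _ _ _ (pr (T X Y) i).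
  have apu X Y i : ap _ i ∘ u' X Y = phi _ _ _ _ (pr (T X Y) i).
    rewrite comp_sumr (bigD1 i) //= big1 ?addr0 => [|j ij].
      by rewrite compA aK comp1m.
    by rewrite compA a0 // comp0m.
  have uu' X Y : u X Y ∘ u' X Y = idm _.
    rewrite comp_suml -phi1 -dsum (lin_sum (lphi _ _ _ _)).
    by apply: eq_bigr => i _; rewrite -compA apu phi_comp.
  have u'u X Y : u' X Y ∘ u X Y = idm _.
    apply: (eq_ap) => j; rewrite compA apu compm1 comp_sumr (bigD1 j) //= big1 ?addr0 => [|i ij].
      by rewrite compA -phi_comp injK phi1 comp1m.
    by rewrite compA -phi_comp inj0 // (lin0 (lphi _ _ _ _)) comp0m.
  exists (fun X Y => @Iso k A (F' (T X Y)) (F X Y) (u X Y) (u' X Y) (u'u X Y) (uu' X Y)).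
  move=> X X' Y Y' f g /=.
  rewrite comp_suml; under eq_bigr do rewrite -compA ap_fm comp_sumr.
  rewrite exchange_big /= comp_sumr; apply: eq_bigr => i _.
  under eq_bigr do rewrite compA -phi_comp.
  rewrite -comp_suml -(lin_sum (lphi _ _ _ _)) compA -phiT -phi_comp.
  congr (phi _ _ _ _ _ ∘ _).
  rewrite -[bmap T f g in RHS]comp1m -dsum !comp_suml.
  by apply: eq_bigr => j _; rewrite !compA.
have tspan X X' Y Y' (h : hom (T X Y) (T X' Y')) : t X' Y' ∘ fmap F h = fmap G h ∘ t X Y.
  move: h; apply: (span_ind) => [|h h' e e'|v w]; last exact: tnat.
    by rewrite !fmap0 comp0m compm0.
  by rewrite !fmapD compmD compDm e e'.
(* Naturality along the inclusions and projections of [Z] leaves no other choice. *)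
pose s Z : hom (F Z) (G Z) := \sum_i fmap G (inj Z i) ∘ t _ _ ∘ fmap F (pr Z i).
have s_inj Z i : s Z ∘ fmap F (inj Z i) = fmap G (inj Z i) ∘ t _ _.
  rewrite comp_suml (bigD1 i) //= big1 ?addr0 => [|j ij].
    by rewrite -compA -fmap_comp injK fmap1 compm1.
  by rewrite -compA -fmap_comp inj0 1?eq_sym // fmap0 compm0.
have eqF Z W (f g : hom (F Z) W) :
    (forall i, f ∘ fmap F (inj Z i) = g ∘ fmap F (inj Z i)) -> f = g.
  move=> e; rewrite -[f]compm1 -[g]compm1 -fmap1 -dsum fmap_sum !comp_sumr.
  by apply: eq_bigr => i _; rewrite fmap_comp !compA e.
exists s; split.
- move=> X Y f; apply: (eqF) => i.
  rewrite -compA -fmap_comp -compA s_inj compA -fmap_comp.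
  rewrite -[f ∘ inj X i]comp1m -dsum comp_suml !fmap_sum comp_sumr comp_suml.
  apply: eq_bigr => j _; rewrite -compA fmap_comp compA s_inj -compA tspan compA.
  by rewrite -fmap_comp.
- by move=> X Y; apply: (eqF) => i; rewrite s_inj tspan.
- move=> s' nat' s'T Z; apply: (eqF) => i; rewrite s_inj nat' s'T //.
Qed.

End Deligne.
(** * Invertible objects and monodromy *)

Definition retract (k : fieldType) (C : lincat k) (Y X : C) : Prop :=
  exists (i : hom Y X) (r : hom X Y), r ∘ i = idm Y.

Section Retracts.
Variables (k : closedFieldType) (C : lincat k).

Lemma retract_iso (X Y : C) : X ≅ Y -> retract X Y.
Proof. by case=> f; exists f, (bwd f); rewrite bwdK. Qed.

Lemma retract_trans (X Y Z : C) : retract X Y -> retract Y Z -> retract X Z.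
Proof.
move=> [i [r h]] [i' [r' h']]; exists (i' ∘ i), (r ∘ r').
by rewrite -compA (compA r') h' comp1m h.
Qed.

Lemma retract_dsum (I : finType) (S : I -> C) X i : is_dsum S X -> retract (S i) X.
Proof. by case=> inj [pr [h _ _]]; exists (inj i), (pr i). Qed.

Lemma retract_fmap (D : lincat k) (F : functor C D) (X Y : C) :
  retract X Y -> retract (F X) (F Y).
Proof.
by case=> i [r h]; exists (fmap F i), (fmap F r); rewrite -fmap_comp h fmap1.
Qed.

Hypotheses (Cab : abelian C) (Css : semisimple C).

Lemma retract_simple_dsum (I : finType) (S : I -> C) (X Y : C) :
  simple Y -> (forall i, simple (S i)) -> is_dsum S X -> retract Y X ->
  exists i, Y ≅ S i.
Proof.
move=> sY sS [inj [pr [h1 h2 h3]]] [i [r ri]].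
have i0 : i <> 0 by move=> i0; apply: (simple_idm_neq0 sY); rewrite -ri i0 compm0.
have [j pj] := dsum_hom_neq0 h3 i0.
by exists j; apply: (simple_iso_of_hom Cab sY (sS j) pj).
Qed.

Lemma constituent (X : C) : idm X <> 0 -> exists S, simple S /\ retract S X.
Proof.
move=> X0; have [n [S [sS XS]]] := Css X.
have [inj [pr [_ _ h]]] := XS; have [i _] := dsum_hom_neq0 h X0.
by exists (S i); split=> //; apply: retract_dsum XS.
Qed.

Lemma retract_of_hom (X Y : C) (f : hom X Y) : simple X -> f <> 0 -> retract X Y.
Proof. by move=> sX /(simple_mono Cab Css sX)[r rf]; exists f, r. Qed.

End Retracts.

Section FusionLemmas.
Variables (k : closedFieldType) (C : bfusion k).
Implicit Types X Y Z W g h : C.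
Local Notation unit := (unit_ : C).
Let Cab : abelian C := fusion_abelian C.
Let Css : semisimple C := @fusion_semisimple _ C.
Let s1 : simple unit := fusion_unit C.

Lemma tens_isom X X' Y Y' : X ≅ X' -> Y ≅ Y' -> X ⊗ Y ≅ X' ⊗ Y'.
Proof. exact: bmap_isom. Qed.
Lemma tens_isoA X Y Z : (X ⊗ Y) ⊗ Z ≅ X ⊗ (Y ⊗ Z).
Proof. by constructor; apply: asc. Qed.
Lemma tens_isoC X Y : X ⊗ Y ≅ Y ⊗ X.
Proof. by constructor; apply: braid. Qed.
Lemma tens_iso1 X : unit ⊗ X ≅ X.
Proof. by constructor; apply: lu. Qed.
Lemma tens_iso1r X : X ⊗ unit ≅ X.
Proof. by constructor; apply: ru. Qed.
Lemma tens_isoCA X Y Z : X ⊗ (Y ⊗ Z) ≅ Y ⊗ (X ⊗ Z).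
Proof.
apply: isoT (isoS (tens_isoA _ _ _)) _; apply: isoT _ (tens_isoA _ _ _).
by apply: tens_isom (tens_isoC _ _) (isoR _).
Qed.
Lemma tens_isoACA X Y X' Y' : (X ⊗ Y) ⊗ (X' ⊗ Y') ≅ (X ⊗ X') ⊗ (Y ⊗ Y').
Proof. by constructor; apply: swap. Qed.

Lemma retract_tensl X Y Z : retract X Y -> retract (X ⊗ Z) (Y ⊗ Z).
Proof. exact: (retract_fmap (bifunctor_l (tens C) Z)). Qed.
Lemma retract_tensr X Y Z : retract X Y -> retract (Z ⊗ X) (Z ⊗ Y).
Proof. exact: (retract_fmap (bifunctor_r (tens C) Z)). Qed.

Lemma coev_neq0 X : idm X <> 0 -> coev X <> 0.
Proof.
move=> X0 c0; apply: X0; have [h _] := dualP X.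
apply: (@iso_epi _ _ _ _ _ (lu X)).
by rewrite comp0m comp1m -h c0 bmap0l compm0.
Qed.

Lemma unit_retract_ev X : idm X <> 0 -> exists s : hom unit (dual X ⊗ X), ev X ∘ s = idm unit.
Proof. by move=> X0; apply: (simple_epi Cab Css s1); apply: ev_neq0 (dualP X) X0. Qed.

Lemma unit_retract X : idm X <> 0 -> retract unit (X ⊗ dual X).
Proof. by move=> X0; apply: (retract_of_hom Cab Css s1 (coev_neq0 X0)). Qed.

(** The unit is a retract of [dual X ⊗ X], so [Y] is a retract of [dual X ⊗ (X ⊗ Y)]. *)
Lemma tens_neq0 X Y : idm X <> 0 -> idm Y <> 0 -> idm (X ⊗ Y) <> 0.
Proof.
move=> X0 Y0 XY0; apply: Y0; apply/is_zeroP.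
have [s es] := unit_retract_ev X0.
have [i [r ri]] : retract Y (dual X ⊗ (X ⊗ Y)).
  apply: retract_trans (retract_iso (isoS (tens_iso1 Y))) _.
  apply: retract_trans (retract_iso (tens_isoA _ _ _)).
  by apply: retract_tensl; exists s, (ev X).
apply: (retract_zero ri); apply/is_zeroP.
by rewrite -tensm1 XY0 bmap0r.
Qed.

Lemma inv_unit : invertible unit.
Proof. by exists unit; split; apply: tens_iso1. Qed.

Lemma inv_iso g h : g ≅ h -> invertible g -> invertible h.
Proof.
move=> i [g' [h1 h2]]; exists g'; split.
  by apply: isoT (tens_isom (isoS i) (isoR _)) h1.
by apply: isoT (tens_isom (isoR _) (isoS i)) h2.
Qed.

Lemma inv_of_unit g h : g ⊗ h ≅ unit -> invertible g.
Proof. by move=> e; exists h; split=> //; apply: isoT (tens_isoC _ _) e. Qed.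

Lemma inv_tens g h : invertible g -> invertible h -> invertible (g ⊗ h).
Proof.
move=> [g' [e _]] [h' [e' _]]; apply: (@inv_of_unit _ (g' ⊗ h')).
apply: isoT (tens_isoACA _ _ _ _) _; apply: isoT (tens_isom e e') _.
exact: tens_iso1.
Qed.

Lemma inv_inverse g : invertible g -> exists g',
  [/\ invertible g', g ⊗ g' ≅ unit & g' ⊗ g ≅ unit].
Proof. by move=> [g' [e e']]; exists g'; split=> //; exists g. Qed.

Lemma invK g g' X : g' ⊗ g ≅ unit -> g' ⊗ (g ⊗ X) ≅ X.
Proof.
move=> e; apply: isoT (isoS (tens_isoA _ _ _)) _.
by apply: isoT (tens_isom e (isoR _)) (tens_iso1 X).
Qed.

Lemma inv_cancel g X Y : invertible g -> g ⊗ X ≅ g ⊗ Y -> X ≅ Y.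
Proof.
move=> /inv_inverse[g' [_ _ e]] h.
apply: isoT (isoS (invK X e)) _; apply: isoT _ (invK Y e).
by apply: tens_isom (isoR _) h.
Qed.

Lemma inv_of_tens g X : invertible g -> invertible (g ⊗ X) -> invertible X.
Proof.
move=> /inv_inverse[g' [ig' _ e]] h.
by apply: inv_iso (invK X e) _; apply: inv_tens.
Qed.

Lemma inv_tens_inj g X Y (f : hom X Y) : invertible g -> idm g ⊗m f = 0 -> f = 0.
Proof.
move=> /inv_inverse[g' [_ _ [w]]] h.
have e : idm (g' ⊗ g) ⊗m f = 0.
  apply: (@comp_iso_eq0 _ _ _ _ _ _ (asc g' g Y)).
  by rewrite -tensm1 asc_nat h bmap0r comp0m.
apply: (@iso_comp_eq0 _ _ _ _ _ (lu X)); rewrite -lu_nat.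
suff -> : idm unit ⊗m f = 0 by rewrite compm0.
apply: (@iso_comp_eq0 _ _ _ _ _ (bmap_iso (tens C) w (iso_refl X))).
by rewrite /= -tensm_rl tensm_lr e compm0.
Qed.

(** Tensoring with the inverse [g'] embeds the endomorphisms of [g ⊗ X] into those of
    [g' ⊗ (g ⊗ X) ≅ X], which are scalars. *)
Lemma inv_tens_simple g X : invertible g -> simple X -> simple (g ⊗ X).
Proof.
move=> ig sX; have [g' [ig' _ e]] := inv_inverse ig.
apply: (simple_of_end Css) => [|f].
  rewrite -tensm1 => /(inv_tens_inj ig); exact: simple_idm_neq0.
have sX' := simple_iso (isoS (invK X e)) sX.
have [a aE] := simple_end Cab (idm g' ⊗m f) sX'.
exists a; apply/eqP; rewrite -subr_eq0; apply/eqP; apply: (inv_tens_inj ig').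
rewrite (linB (@bmap_linearr _ _ _ _ (tens C) _ _ _ _ (idm g'))).
by rewrite bmapZr tensm1 aE subrr.
Qed.

Lemma inv_simple g : invertible g -> simple g.
Proof. by move=> ig; apply: simple_iso (tens_iso1r g) _; apply: inv_tens_simple. Qed.

Lemma tens_inv_simple X g : invertible g -> simple X -> simple (X ⊗ g).
Proof. by move=> ig sX; apply: simple_iso (tens_isoC _ _) _; apply: inv_tens_simple. Qed.

(* Both [Hom(Y ⊗ X, 1)] and [Hom(1, X ⊗ Y)] compute an endomorphism algebra. *)
Lemma dual_simple X : simple X -> simple (dual X).
Proof.
move=> sX; have dX := dualP X; set Y := dual X in dX *.
have c0 := coev_neq0 (simple_idm_neq0 sX).
have e0 := ev_neq0 dX (simple_idm_neq0 sX).
have h1 (x y : hom unit (X ⊗ Y)) : y <> 0 -> exists a, x = a *: y.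
  move=> y0.
  have [w wE] := schur Cab (simple_iso (isoS (tens_iso1 X)) sX) sX (comate_neq0 dX y0).
  have [a aE] := simple_hom_scalar Cab w (comate (ev X) x) (simple_iso (isoS (tens_iso1 X)) sX).
  by exists a; rewrite -(comateK dX x) aE wE -comateZ comateK.
have [s es] := simple_epi Cab Css s1 e0.
have h2 (x y : hom unit (Y ⊗ X)) : y <> 0 -> exists a, x = a *: y.
  move=> y0; have [a aE] := h1 (braid Y X ∘ x) (braid Y X ∘ y)
    (fun e0' => y0 (@comp_iso_eq0 _ _ _ _ _ y (braid Y X) e0')).
  by exists a; apply: (@iso_mono _ _ _ _ _ (braid Y X)); rewrite aE compmZ.
(* If [p] were not [b *: ev X], the difference would be split by some [t]; but [t] is a multiple of
   [s], where the difference vanishes. *)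
have h3 (p : hom (Y ⊗ X) unit) : exists a, p = a *: ev X.
  have [b bE] := simple_end Cab (p ∘ s) s1.
  exists b; apply: contrapT => ne.
  have [|t tE] := @simple_epi _ _ Cab Css unit (Y ⊗ X) (p - b *: ev X) s1.
    by move/eqP; rewrite subr_eq0 => /eqP.
  have s0 : s <> 0 by move=> s0; apply: (simple_idm_neq0 s1); rewrite -es s0 compm0.
  have [c cE] := h2 t s s0; apply: (simple_idm_neq0 s1).
  by rewrite -tE cE compmZ compBm bE compZm es subrr scaler0.
have Y0 : idm Y <> 0.
  move=> Y0; apply: (simple_idm_neq0 s1).
  by rewrite -es -[ev X]compm1 -tensm1 Y0 bmap0l compm0 comp0m.
apply: (simple_of_end Css) => // f.
have [a aE] := h3 (comate (ev X) (bwd (lu Y) ∘ f)).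
have [b bE] := h3 (comate (ev X) (bwd (lu Y))).
have l0 : bwd (lu Y) <> 0.
  by move=> l0; apply: Y0; rewrite -(fwdK (lu Y)) l0 compm0.
have b0 : b != 0.
  apply/eqP => b0; apply: (comate_neq0 dX l0); by rewrite bE b0 scale0r.
exists (a / b); apply: (@iso_mono _ _ _ _ _ (iso_sym (lu Y))).
rewrite /= compmZ compm1; apply: (can_inj (@comateK _ _ _ _ _ _ dX _ _)).
by rewrite comateZ aE bE scalerA divfK.
Qed.

Lemma inv_tens_dual g : invertible g -> g ⊗ dual g ≅ unit.
Proof.
move=> ig; have sg := inv_simple ig.
have c0 := coev_neq0 (simple_idm_neq0 sg).
exact/isoS/(simple_iso_of_hom Cab s1 (inv_tens_simple ig (dual_simple sg)) c0).
Qed.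

Lemma inv_dual g : invertible g -> invertible (dual g).
Proof.
move=> /inv_tens_dual e; apply: (@inv_of_unit _ g).
exact: isoT (tens_isoC _ _) e.
Qed.

Lemma ev_retract_dual X : idm X <> 0 -> retract unit (dual X ⊗ X).
Proof. by move=> /unit_retract_ev[s es]; exists s, (ev X). Qed.

(** The adjunction identifies these morphisms with maps [g ⊗ X] to [X] between simple objects. So
    [g] occurs at most once in [X ⊗ dual X]; the next two lemmas say that it occurs exactly when it
    fixes [X]. *)
Lemma hom_tens_dual g X (x y : hom g (X ⊗ dual X)) : simple X -> invertible g ->
  y <> 0 -> exists a, x = a *: y.
Proof.
move=> sX ig y0; have dX := dualP X; have sgX := inv_tens_simple ig sX.
have [w wE] := schur Cab sgX sX (comate_neq0 dX y0).
have [a aE] := simple_hom_scalar Cab w (comate (ev X) x) sgX.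
by exists a; rewrite -(comateK dX x) aE wE -comateZ comateK.
Qed.

Lemma hom_tens_dual_stab g X (x : hom g (X ⊗ dual X)) : simple X -> invertible g ->
  x <> 0 -> g ⊗ X ≅ X.
Proof.
move=> sX ig x0.
by apply: (simple_iso_of_hom Cab (inv_tens_simple ig sX) sX (comate_neq0 (dualP X) x0)).
Qed.

Lemma stab_hom_tens_dual g X : simple X -> invertible g -> g ⊗ X ≅ X ->
  exists x : hom g (X ⊗ dual X), x <> 0.
Proof.
move=> sX ig [f]; exists (mate (coev X) f); apply: (mate_neq0 (dualP X)) => f0.
by apply: (simple_idm_neq0 sX); rewrite -(fwdK f) f0 comp0m.
Qed.

Lemma retract_simple_iso X Y : simple X -> simple Y -> retract X Y -> X ≅ Y.
Proof.
move=> sX sY [i [r ri]]; apply: (simple_iso_of_hom Cab sX sY (f := i)) => i0.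
by apply: (simple_idm_neq0 sX); rewrite -ri i0 compm0.
Qed.

Lemma retract_simple_dsum2 S X Y Z : simple S -> simple X -> simple Y ->
  is_dsum2 X Y Z -> retract S Z -> S ≅ X \/ S ≅ Y.
Proof.
move=> sS sX sY dZ rS.
have [|[] e] := retract_simple_dsum Cab sS _ dZ rS; [by case|by left|by right].
Qed.

Definition generated (Q : C -> Prop) X : Prop :=
  forall S, simple S -> retract S X -> Q S.

Lemma generated_simple (Q : C -> Prop) X : generated Q X -> simple X -> Q X.
Proof. by move=> QX sX; apply: QX sX (retract_iso (isoR X)). Qed.

Lemma generated_of_simple (Q : C -> Prop) X : (forall Y, X ≅ Y -> Q X -> Q Y) ->
  simple X -> Q X -> generated Q X.
Proof.
by move=> Qiso sX QX S sS rS; apply: Qiso QX; apply/isoS/retract_simple_iso.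
Qed.

(** Everything reduces to simple summands. For duals, a nonzero map from [S] to [dual X] becomes by
    adjunction a map on [S ⊗ X], which is nonzero on [S ⊗ U j] for some simple summand [U j]; hence
    [S ≅ dual (U j)]. *)
Lemma generated_fusion_sub (Q : C -> Prop) :
  (forall X Y, X ≅ Y -> Q X -> Q Y) -> Q unit ->
  (forall X Y Z, simple X -> simple Y -> simple Z -> Q X -> Q Y ->
     retract Z (X ⊗ Y) -> Q Z) ->
  (forall X, simple X -> Q X -> Q (dual X)) -> fusion_sub (generated Q).
Proof.
move=> Qiso Q1 Qtens Qdual.
have rn0 S X (i : hom S X) (r : hom X S) : simple S -> r ∘ i = idm S -> i <> 0.
  by move=> sS ri i0; apply: (simple_idm_neq0 sS); rewrite -ri i0 compm0.
split.
- move=> X Y i r ri QX S sS rS; apply: QX sS _.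
  by apply: retract_trans rS _; exists i, r.
- move=> X Y Z dZ QX QY S sS [i [r ri]].
  have [inj [pr [_ _ h]]] := dZ; have [[] pi] := dsum_hom_neq0 h (rn0 _ _ _ _ sS ri).
    by apply: QX => //; apply: (retract_of_hom Cab Css sS pi).
  by apply: QY => //; apply: (retract_of_hom Cab Css sS pi).
- move=> X /is_zeroP X0 S sS [i [r ri]]; case: (simple_idm_neq0 sS).
  by rewrite -ri -[i]comp1m X0 comp0m compm0.
- by move=> S sS rS; apply: Qiso Q1; apply/isoS/retract_simple_iso.
- move=> X Y QX QY S sS [i [r ri]].
  have [n [U [sU dU]]] := Css X; have [m [V [sV dV]]] := Css Y.
  have [inj [pr [_ _ h]]] := bmap_dsum (tens C) dU dV.
  have [[u v] /= pi] := dsum_hom_neq0 h (rn0 _ _ _ _ sS ri).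
  apply: (Qtens _ _ _ (sU u) (sV v) sS); last exact: (retract_of_hom Cab Css sS pi).
    by apply: QX => //; apply: retract_dsum dU.
  by apply: QY => //; apply: retract_dsum dV.
- move=> X QX S sS [i [r ri]].
  have [n [U [sU dU]]] := Css X; have [inj [pr [_ _ h]]] := dU.
  have i0 := rn0 _ _ _ _ sS ri.
  have li0 : bwd (lu (dual X)) ∘ i <> 0.
    by move/(@comp_iso_eq0 _ _ _ _ _ i (iso_sym (lu (dual X)))).
  have hS : \sum_j (idm S ⊗m inj j) ∘ (idm S ⊗m pr j) = idm (S ⊗ X).
    by rewrite -tensm1 -h bmap_sumr; apply: eq_bigr => j _; rewrite tensmCr.
  have [j cj] := dsum_hom_neq0' hS (comate_neq0 (dualP X) li0).
  have := mate_neq0 (dualP (U j)) cj.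
  set f := mate _ _ => f0.
  have lf0 : lu (dual (U j)) ∘ f <> 0 by move/comp_iso_eq0.
  apply: Qiso (isoS (simple_iso_of_hom Cab sS (dual_simple (sU j)) lf0)) _.
  by apply: Qdual => //; apply: QX => //; apply: retract_dsum dU.
Qed.

End FusionLemmas.
Section Monodromy.
Variables (k : closedFieldType) (C : bfusion k).
Implicit Types X Y Z W g h : C.
Local Notation unit := (unit_ : C).
Let Cab : abelian C := fusion_abelian C.
Let Css : semisimple C := @fusion_semisimple _ C.
Let s1 : simple unit := fusion_unit C.

Lemma monodromy_retract' X Y Y' a : retract Y' Y -> monodromy X Y a -> monodromy X Y' a.
Proof. by case=> i [r ri]; apply: monodromy_retract ri. Qed.

Lemma monodromy_isol X X' Y a : X ≅ X' -> monodromy X Y a -> monodromy X' Y a.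
Proof. by move=> i /monodromy_sym h; apply/monodromy_sym/(monodromy_iso i h). Qed.

Lemma monodromy_unitl X : monodromy unit X 1.
Proof. exact/monodromy_sym/monodromy_unitr. Qed.

Lemma monodromy_exists g X : invertible g -> simple X -> exists a, monodromy g X a.
Proof. by move=> ig sX; apply: (simple_end Cab _ (inv_tens_simple ig sX)). Qed.

Lemma monodromy_uniq g X a b : invertible g -> simple X ->
  monodromy g X a -> monodromy g X b -> a = b.
Proof. by move=> ig sX; apply/monodromy_inj/simple_idm_neq0/inv_tens_simple. Qed.

Lemma monodromy_neq0 X Y a : idm (X ⊗ Y) <> 0 -> monodromy X Y a -> a != 0.
Proof.
move=> XY0; rewrite /monodromy => h; apply/eqP => a0; apply: XY0.
rewrite a0 scale0r in h.
have b0 := @comp_iso_eq0 _ _ _ _ _ _ (braid Y X) h.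
by rewrite -(bwdK (braid X Y)) b0 compm0.
Qed.

(** The value 0 marks pairs whose double braiding is not scalar; this never happens for [X]
    invertible and [Y] simple. *)
Definition mu X Y : k :=
  if pselect (exists a, monodromy X Y a) is left h then sval (cid h) else 0.

Lemma muP g X : invertible g -> simple X -> monodromy g X (mu g X).
Proof.
move=> ig sX; rewrite /mu; case: pselect => [h|[]]; first by case: (cid h).
exact: monodromy_exists.
Qed.

Lemma muE g X a : invertible g -> simple X -> monodromy g X a -> mu g X = a.
Proof. by move=> ig sX; apply: monodromy_uniq (muP ig sX). Qed.

Fixpoint tpow X n : C := if n is n'.+1 then X ⊗ tpow X n' else unit.

Lemma tpow_inv g n : invertible g -> invertible (tpow g n).
Proof. by move=> ig; elim: n => [|n IH] /=; [apply: inv_unit|apply: inv_tens]. Qed.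

Lemma tpow_neq0 X n : idm X <> 0 -> idm (tpow X n) <> 0.
Proof.
by move=> X0; elim: n => [|n IH] /=; [apply: simple_idm_neq0|apply: tens_neq0].
Qed.

Lemma monodromy_tpowr X Y n a : monodromy X Y a -> monodromy X (tpow Y n) (a ^+ n).
Proof.
move=> h; elim: n => [|n IH] /=; first exact: monodromy_unitr.
by rewrite exprS; apply: monodromy_tensr.
Qed.

Lemma monodromy_tpowl X Y n a : monodromy X Y a -> monodromy (tpow X n) Y (a ^+ n).
Proof. by move=> /monodromy_sym h; apply/monodromy_sym/monodromy_tpowr. Qed.

Lemma monodromy_all X a :
  (forall Y, simple Y -> monodromy X Y a) -> forall Y, monodromy X Y a.
Proof.
move=> h Y; have [n [S [sS SY]]] := Css Y.
by apply: monodromy_dsum SY _ => i; apply: h.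
Qed.

Lemma central_simple_unit X : nondegenerate C -> simple X ->
  (forall Y, simple Y -> monodromy X Y 1) -> X ≅ unit.
Proof.
move=> nd sX h; have [Y|n dX] := nd X; first by rewrite (monodromy_all h) scale1r.
have [_ //] := retract_simple_dsum Cab sX (fun=> s1) dX (retract_iso (isoR X)).
Qed.

(** The radical of the monodromy pairing on invertible objects. *)
Definition central_inv g :=
  invertible g /\ forall h, invertible h -> monodromy g h 1.

Lemma central_inv_iso g h : g ≅ h -> central_inv g -> central_inv h.
Proof.
move=> e [ig cg]; split; first exact: inv_iso e ig.
by move=> g' /cg; apply: monodromy_isol.
Qed.

Lemma central_inv_unit : central_inv unit.
Proof. by split=> [|h _]; [apply: inv_unit|apply: monodromy_unitl]. Qed.

Lemma central_inv_tens g h : central_inv g -> central_inv h -> central_inv (g ⊗ h).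
Proof.
move=> [ig cg] [ih ch]; split=> [|x ix]; first exact: inv_tens.
by rewrite -(mulr1 1); apply: monodromy_tensl; [apply: cg|apply: ch].
Qed.

Lemma central_inv_tpow g n : central_inv g -> central_inv (tpow g n).
Proof.
by move=> cg; elim: n => [|n IH] /=; [apply: central_inv_unit|apply: central_inv_tens].
Qed.

Lemma monodromy_inverse g g' X a : invertible g -> invertible g' -> simple X ->
  g ⊗ g' ≅ unit -> monodromy g X a -> monodromy g' X a^-1.
Proof.
move=> ig ig' sX e h.
have [b hb] := monodromy_exists ig' sX.
have ab : a * b = 1.
  apply: (monodromy_uniq (inv_unit C) sX _ (monodromy_unitl X)).
  by apply: (monodromy_isol e); apply: monodromy_tensl.
have a0 : a != 0 by apply: contra_eq_neq ab => ->; rewrite mul0r eq_sym oner_neq0.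
by rewrite -[a^-1]mulr1 -ab mulKf.
Qed.

Lemma central_inv_inverse g g' : central_inv g -> invertible g' ->
  g ⊗ g' ≅ unit -> central_inv g'.
Proof.
move=> [ig cg] ig' e; split=> // h ih.
by rewrite -invr1; apply: (monodromy_inverse ig ig' (inv_simple ih) e); apply: cg.
Qed.

(** For invertible [h], the monodromy with [g ⊗ X ≅ X] is both the product of those with [g] and [X]
    and the one with [X] alone; cancel the latter. *)
Lemma stab_central_inv g X : simple X -> invertible g -> g ⊗ X ≅ X -> central_inv g.
Proof.
move=> sX ig gX; split=> // h ih.
have [a ha] := monodromy_exists ih (inv_simple ig).
have [b hb] := monodromy_exists ih sX.
have b0 : b != 0.
  exact: (monodromy_neq0 (simple_idm_neq0 (inv_tens_simple ih sX)) hb).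
have e : a * b = b.
  by apply: (monodromy_uniq ih sX _ hb); apply: (monodromy_iso gX); apply: monodromy_tensr.
have a1 : a = 1 by apply: (mulIf b0); rewrite e mul1r.
by apply: monodromy_sym; rewrite -a1.
Qed.

Lemma inv_reps : exists (H : finType) (rep : H -> C),
  [/\ forall x, invertible (rep x), forall g, invertible g -> exists x, g ≅ rep x
    & forall x y, rep x ≅ rep y -> x = y].
Proof.
have [n [S SP]] := @fusion_finite _ C.
(* Keeping the least index of each isomorphism class removes repetitions. *)
pose Q (x : 'I_n) := `[< invertible (S x) /\ forall y : 'I_n, (y < x)%N -> ~ (S y ≅ S x) >].
exists {x : 'I_n | Q x}, (fun x => S (sval x)); split.
- by case=> x /= /asboolP[].
- move=> g ig; have [x0 e0] := SP g (inv_simple ig).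
  have ex : exists m : nat, `[< exists x : 'I_n, x = m :> nat /\ g ≅ S x >].
    by exists x0; apply/asboolP; exists x0.
  case: (ex_minnP ex) => m /asboolP[x [xm gx]] min.
  have Qx : Q x.
    apply/asboolP; split=> [|y yx Sy]; first exact: inv_iso gx ig.
    suff : (m <= y)%N by rewrite -xm leqNgt yx.
    by apply: min; apply/asboolP; exists y; split=> //; apply: isoT gx (isoS Sy).
  by exists (exist _ x Qx).
- move=> [x Qx] [y Qy] /= e; apply: val_inj => /=; apply: val_inj => /=.
  move/asboolP: Qx => [_ hx]; move/asboolP: Qy => [_ hy].
  case: (ltngtP x y) => // xy; first by case: (hy _ xy).
  by case: (hx _ xy); apply: isoS.
Qed.

(** * Orthogonality of characters on the invertible objects *)

Section CharacterSum.
Variables (H : finType) (rep : H -> C).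
Hypotheses (repI : forall x, invertible (rep x))
  (repE : forall g, invertible g -> exists x, g ≅ rep x)
  (repU : forall x y, rep x ≅ rep y -> x = y).

Lemma mu_sum_central g : central_inv g -> \sum_t mu (rep t) g = #|H|%:R.
Proof.
move=> [ig cg]; rewrite -sumr_const; apply: eq_bigr => t _.
by apply: (muE (repI t) (inv_simple ig)); apply/monodromy_sym/cg.
Qed.

(** Some [s] has [mu s g] different from 1; translating the summation index by [s] multiplies the
    sum by that scalar. *)
Lemma mu_sum_noncentral g : invertible g -> ~ central_inv g ->
  \sum_t mu (rep t) g = 0.
Proof.
move=> ig ncg.
have [s [iS ns]] : exists s, invertible s /\ ~ monodromy s g 1.
  apply: contrapT => hno; apply: ncg; split=> // s iS; apply: monodromy_sym.
  by apply: contrapT => ns; apply: hno; exists s.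
have tr t := cid (repE (inv_tens iS (repI t))).
pose tau t := sval (tr t).
have tauE t : s ⊗ rep t ≅ rep (tau t) by apply: (svalP (tr t)).
have tau_inj : injective tau.
  move=> x y e; apply: repU; apply: (inv_cancel iS).
  by apply: isoT (tauE x) _; rewrite e; apply: isoS.
have sg := inv_simple ig.
have e : \sum_t mu (rep t) g = mu s g * \sum_t mu (rep t) g.
  rewrite {1}(reindex_inj tau_inj) mulr_sumr; apply: eq_bigr => t _.
  apply: (muE (repI _) sg); apply: (monodromy_isol (tauE t)).
  by apply: monodromy_tensl; apply: muP.
apply/eqP; move/eqP: e; rewrite eq_sym -subr_eq0 -[X in _ - X]mul1r -mulrBl mulf_eq0.
rewrite subr_eq0 => /orP[/eqP e|//]; case: ns.
by rewrite -e; apply: muP.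
Qed.

End CharacterSum.

(* A simple object with only the trivial stabilizer is invertible, since
   [X ⊗ X^*] would be a multiple of the unit. *)
Lemma stab_exists X : simple X -> ~ invertible X ->
  (forall Y, simple Y -> retract Y (X ⊗ dual X) -> invertible Y) ->
  exists g, [/\ invertible g, ~ (g ≅ unit) & g ⊗ X ≅ X].
Proof.
move=> sX niX hinv; apply: contrapT => hno; apply: niX.
have X0 := simple_idm_neq0 sX; have c0 := coev_neq0 X0.
apply: (@inv_of_unit _ _ _ (dual X)).
have [r rc] := simple_mono Cab Css s1 c0.
have [n [S [sS dS]]] := Css (X ⊗ dual X); have [inj [pr [h1 h2 h3]]] := dS.
constructor; exists r (coev X) => //.
rewrite -[LHS]compm1 -h3 comp_sumr; apply: eq_bigr => j _.
rewrite compA; congr (_ ∘ _).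
have iS := hinv _ (sS j) (retract_dsum j dS).
have inj0 : inj j <> 0.
  by move=> i0; apply: (simple_idm_neq0 (sS j)); rewrite -h1 i0 compm0.
have [e|ne] := pselect (S j ≅ unit); last first.
  by case: hno; exists (S j); split=> //; apply: (hom_tens_dual_stab sX iS inj0).
case: e => w; have [a aE] := hom_tens_dual (inj j ∘ bwd w) sX (inv_unit C) c0.
have -> : inj j = a *: (coev X ∘ w) by rewrite -compZm -aE fwdmK.
by rewrite compmZ -(compA (coev X)) (compA r) rc comp1m.
Qed.

(* The key obstruction: [X ⊗ X^*] is a sum of powers of [h], whose left actions
   on [X] would all commute with the right action of [h] obtained through the
   braiding if [h] had trivial self-braiding. *)
Lemma self_braid_neq1 X h : simple X -> invertible h -> h ⊗ X ≅ X -> ~ (h ≅ unit) ->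
  (forall g, invertible g -> g ⊗ X ≅ X -> exists n, g ≅ tpow h n) ->
  (forall Y, simple Y -> retract Y (X ⊗ dual X) -> invertible Y) ->
  ~ (braid h h = 1 *: idm (h ⊗ h) :> hom _ _).
Proof.
move=> sX ih [f] nh hpow hinv hh; pose g := f ∘ braid X h.
have X0 := simple_idm_neq0 sX.
have ef : right_eigen g f 1 := right_eigen_braid f hh.
(* Iterating [f] gives an invertible left action of each power of [h] that commutes with the right
   action [g]. *)
have phi n : exists p : iso (tpow h n ⊗ X) X, right_eigen g p 1.
  elim: n => [|n [p ep]] /=; first by exists (lu X); apply: right_eigen_lu.
  exists (iso_trans (iso_trans f (bmap_iso (tens C) (iso_refl h) p)) (asc h (tpow h n) X)).
  by rewrite -(mulr1 1); apply: right_eigen_mul.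
pose v := ru X ∘ (idm X ⊗m ev X) ∘ asc X (dual X) X.
have ev1 : right_eigen g v 1.
  have [n [S [sS dS]]] := Css (X ⊗ dual X); have [inj [pr [h1 h2 h3]]] := dS.
  apply: (right_eigen_dsum h3) => j.
  have iS := hinv _ (sS j) (retract_dsum j dS).
  have inj0 : inj j <> 0.
    by move=> i0; apply: (simple_idm_neq0 (sS j)); rewrite -h1 i0 compm0.
  have [m [w]] := hpow _ iS (hom_tens_dual_stab sX iS inj0).
  have [p ep] := phi m.
  have [a aE] := simple_hom_scalar Cab (iso_trans p (bmap_iso (tens C) w (iso_refl X)))
    (v ∘ (inj j ⊗m idm X)) (inv_tens_simple iS sX).
  by rewrite aE; apply: right_eigenZ; apply: (right_eigen_comp w ep).
have [s es] := unit_retract_ev X0.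
(* Contracting [x] directly gives [idm h], while contracting after acting by [g] gives a map from
   [h] to the unit, hence 0. Since [v] commutes with [g], [right_action_factor] equates the two
   outcomes and forces [g = 0]. *)
pose x := asc (dual X) X h ∘ (s ⊗m idm h) ∘ bwd (lu h).
have e1 : lu h ∘ (ev X ⊗m idm h) ∘ bwd (asc (dual X) X h) ∘ x = idm h.
  rewrite /x !compA fwdmK -(compA (lu h)) -tensmCl es tensm1 compm1.
  exact: fwdK.
have e2 : ev X ∘ (idm (dual X) ⊗m g) ∘ x = 0.
  apply: contrapT => ne; apply: nh.
  exact: (simple_iso_of_hom Cab (inv_simple ih) s1 ne).
have : g ∘ (idm X ⊗m idm h) = ru X ∘ (idm X ⊗m 0).
  rewrite -[X in g ∘ (_ ⊗m X)]e1 -e2; apply: right_action_factor.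
  by move: ev1; rewrite /right_eigen scale1r.
rewrite tensm1 compm1 bmap0r compm0 => g0.
apply: (tens_neq0 X0 (simple_idm_neq0 (inv_simple ih))).
have b0 := @comp_iso_eq0 _ _ _ _ _ _ f g0.
by rewrite -(bwdK (braid X h)) b0 compm0.
Qed.

End Monodromy.
(** * Graded extensions with pointed trivial component *)

Section Graded.
Variables (k : closedFieldType) (C : bfusion k) (gT : finGroupType).
Variable P : gT -> C -> Prop.
Hypothesis Pgr : grading P.
Hypothesis gT_prime : prime #|gT|.
Hypothesis P1_inv : forall X, simple X -> P 1%g X -> invertible X.
Hypothesis Cnd : nondegenerate C.
Implicit Types X Y Z W g h : C.
Local Notation unit := (unit_ : C).
Local Notation q := #|gT|.
Let Cab : abelian C := fusion_abelian C.
Let Css : semisimple C := @fusion_semisimple _ C.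
Let s1 : simple unit := fusion_unit C.

Lemma gr_iso i X Y : X ≅ Y -> P i X -> P i Y.
Proof. exact: (fas_iso (gr_sub Pgr i)). Qed.

Lemma gr_retract i X Y : retract Y X -> P i X -> P i Y.
Proof.
case=> f [r rf] PX.
exact: (fas_ker (gr_sub Pgr i) (split_mono_ker rf) PX PX).
Qed.

Lemma simple_homogeneous X : simple X -> exists i, P i X.
Proof.
move=> sX; have [Y [PY [inj [pr [_ _ h]]]]] := gr_sum Pgr X.
have [i pi] := dsum_hom_neq0 h (simple_idm_neq0 sX).
rewrite compm1 in pi; exists i; apply: gr_retract (PY i).
exact: (retract_of_hom Cab Css sX pi).
Qed.

(** Since [unit ⊗ unit ≅ unit], the degree of the unit is idempotent in the group. *)
Lemma unit_degree : P 1%g unit.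
Proof.
have [i Pi] := simple_homogeneous s1.
have Pii : P (i * i)%g unit by apply: gr_iso (tens_iso1 _) _; apply: gr_tens.
have [e|ne] := eqVneq i (i * i)%g.
  by have -> : 1%g = i by apply: (mulgI i); rewrite mulg1.
by have := simple_idm_neq0 s1; rewrite (gr_orth Pgr ne Pi Pii (idm unit)).
Qed.

Lemma tpow_degree i X n : P i X -> P (i ^+ n)%g (tpow X n).
Proof.
by move=> PX; elim: n => [|n IH]; [apply: unit_degree|rewrite expgS; apply: gr_tens].
Qed.

Lemma prime_group_expg (i j : gT) : i != 1%g -> exists n, j = (i ^+ n)%g.
Proof.
move=> i1; apply/cycleP.
suff -> : <[i]>%g = [set: gT] by rewrite inE.
apply/eqP; rewrite eqEcard subsetT /= cardsT.
have := cardSg (subsetT <[i]>%g); rewrite cardsT.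
case/primeP: gT_prime => _ h /h /orP[|/eqP ->//].
by rewrite -orderE order_eq1 (negbTE i1).
Qed.

Lemma gr_tens_dual i X Y : P i X -> P i Y -> P 1%g (X ⊗ dual Y).
Proof. by move=> PX PY; rewrite -(mulgV i); apply: gr_tens Pgr _ _ _ _ PX (gr_dual Pgr PY). Qed.

Lemma constituent_inv X Y : P 1%g X -> simple Y -> retract Y X -> invertible Y.
Proof. by move=> PX sY rY; apply: P1_inv => //; apply: gr_retract rY PX. Qed.

Lemma tens_dual_inv X : simple X ->
  forall Y, simple Y -> retract Y (X ⊗ dual X) -> invertible Y.
Proof.
move=> sX Y sY; have [i PX] := simple_homogeneous sX.
exact: (constituent_inv (gr_tens_dual PX PX) sY).
Qed.

(** [X] is a retract of [(X ⊗ dual Y) ⊗ Y], and the constituents of [X ⊗ dual Y] are invertible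
    because its degree is trivial. *)
Lemma homogeneous_transitive i X Y : simple X -> simple Y -> P i X -> P i Y ->
  exists g, invertible g /\ X ≅ g ⊗ Y.
Proof.
move=> sX sY PX PY; have [n [S [sS dS]]] := Css (X ⊗ dual Y).
have iS j : invertible (S j).
  by apply: (constituent_inv (gr_tens_dual PX PY)) => //; apply: retract_dsum dS.
have dSY := fmap_dsum (bifunctor_l (tens C) Y) dS.
have [||j ej] := retract_simple_dsum Cab sX _ dSY.
- by move=> j; apply: inv_tens_simple.
- apply: retract_trans (retract_iso (isoS (tens_iso1r X))) _.
  apply: retract_trans (retract_iso (isoS (tens_isoA _ _ _))).
  apply: retract_tensr; apply: ev_retract_dual; exact: simple_idm_neq0.
- by exists (S j).
Qed.

Variable X0 : C.
Hypotheses (sX0 : simple X0) (niX0 : ~ invertible X0).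

Lemma noninv_degree X i : simple X -> ~ invertible X -> P i X -> i != 1%g.
Proof. by move=> sX niX PX; apply/eqP => i1; apply/niX/P1_inv; rewrite // -i1. Qed.

(** The degree of [X] generates the group, so each simple object is an invertible object times a
    constituent of a power of [X]. Thus [g] centralizes everything and non-degeneracy applies. *)
Lemma central_inv_trivial g X : central_inv g -> simple X -> ~ invertible X ->
  monodromy g X 1 -> g ≅ unit.
Proof.
move=> [ig cg] sX niX gX; apply: (central_simple_unit Cnd (inv_simple ig)) => Y sY.
have [i PX] := simple_homogeneous sX; have [j PY] := simple_homogeneous sY.
have [n jn] := prime_group_expg j (noninv_degree sX niX PX).
have [Z [sZ rZ]] := constituent Css (@tpow_neq0 _ _ X n (simple_idm_neq0 sX)).
have PZ : P j Z by apply: gr_retract rZ _; rewrite jn; apply: tpow_degree.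
have [h [ih YhZ]] := homogeneous_transitive sY sZ PY PZ.
apply: (monodromy_iso (isoS YhZ)); rewrite -(mulr1 1).
apply: monodromy_tensr; first exact: cg.
by apply: (monodromy_retract' rZ); rewrite -(expr1n _ n); apply: monodromy_tpowr.
Qed.

Lemma central_inv_inj g g' X a : central_inv g -> central_inv g' -> simple X ->
  ~ invertible X -> monodromy g X a -> monodromy g' X a -> g ≅ g'.
Proof.
move=> cg cg' sX niX ga g'a; have [ig' _] := cg'.
have [h [ih e e']] := inv_inverse ig'.
have ha := monodromy_inverse ig' ih sX e g'a.
have a0 : a != 0.
  by apply: (monodromy_neq0 _ g'a); apply: simple_idm_neq0; apply: inv_tens_simple.
have : g ⊗ h ≅ unit.
  apply: (central_inv_trivial _ sX niX).
    by apply: central_inv_tens => //; apply: central_inv_inverse cg' ih e.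
  by rewrite -(divff a0); apply: monodromy_tensl.
move=> gh; apply: (inv_cancel ih).
apply: isoT (tens_isoC _ _) _; apply: isoT gh _; exact: isoS e'.
Qed.

(** The [q]-th tensor power of [X] has trivial degree, so its constituents are invertible and [g]
    centralizes them. *)
Lemma monodromy_root g X a : central_inv g -> simple X -> monodromy g X a -> a ^+ q = 1.
Proof.
move=> [ig cg] sX ga; have [i PX] := simple_homogeneous sX.
have [Z [sZ rZ]] := constituent Css (@tpow_neq0 _ _ X q (simple_idm_neq0 sX)).
have iZ : invertible Z.
  apply: constituent_inv sZ rZ; rewrite -(_ : (i ^+ q)%g = 1%g); first exact: tpow_degree.
  have := cardSg (subsetT <[i]>%g); rewrite cardsT -orderE => /dvdnP[m ->].
  by rewrite mulnC expgM expg_order expg1n.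
apply: (monodromy_uniq ig sZ _ (cg _ iZ)).
by apply: (monodromy_retract' rZ); apply: monodromy_tpowr.
Qed.

(* The monodromy with a fixed non-invertible simple object embeds the group of
   central invertible objects into the [q]-th roots of unity. *)
Lemma central_inv_tpow_eq h X : central_inv h -> ~ (h ≅ unit) -> simple X ->
  ~ invertible X -> forall g, central_inv g -> exists n, (n < q)%N /\ g ≅ tpow h n.
Proof.
move=> ch nh sX niX g cg; have [ih _] := ch; have [ig _] := cg.
have [z hz] := monodromy_exists ih sX; have [a ga] := monodromy_exists ig sX.
have q0 : (0 < q)%N by apply: prime_gt0.
have [m pz mq] := prim_order_exists q0 (monodromy_root ch sX hz).
(* The order [m] of [z] divides the prime [q], and [m = 1] would make [h] trivial. *)
have {mq} mq : m = q.
  case/primeP: gT_prime => _ /(_ _ mq)/orP[/eqP m1|/eqP//].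
  case: nh; apply: (central_inv_trivial ch sX niX).
  by rewrite -(prim_expr_order pz) m1 expr1.
rewrite mq in pz; have [n an] := prim_rootP pz (monodromy_root cg sX ga).
exists n; split=> //.
apply: (central_inv_inj cg (central_inv_tpow n ch) sX niX ga).
by rewrite an; apply: monodromy_tpowl.
Qed.

Lemma tpow_card_unit h : central_inv h -> tpow h q ≅ unit.
Proof.
move=> ch; have [ih _] := ch; have [z hz] := monodromy_exists ih sX0.
apply: (central_inv_trivial (central_inv_tpow q ch) sX0 niX0).
by rewrite -(monodromy_root ch sX0 hz); apply: monodromy_tpowl.
Qed.

Lemma stab_self_braid h X w : simple X -> ~ invertible X -> invertible h ->
  h ⊗ X ≅ X -> ~ (h ≅ unit) -> braid h h = w *: idm (h ⊗ h) :> hom _ _ -> w <> 1.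
Proof.
move=> sX niX ih hX nh hw w1; rewrite w1 in hw.
have ch := stab_central_inv sX ih hX.
apply: (self_braid_neq1 sX ih hX nh _ (tens_dual_inv sX) hw) => g ig gX.
have cg := stab_central_inv sX ig gX.
by have [n [_ e]] := central_inv_tpow_eq ch nh sX niX cg; exists n.
Qed.

Lemma self_braid_sq h w : central_inv h -> braid h h = w *: idm (h ⊗ h) :> hom _ _ ->
  w ^+ 2 = 1.
Proof.
move=> [ih ch] hw; apply: (monodromy_uniq ih (inv_simple ih) _ (ch _ ih)).
by rewrite /monodromy hw compZm comp1m scalerA.
Qed.

(** The [q]-fold iterate of [f] is an action of [tpow h q ≅ unit_] and commutes with [g] up to
    [w ^+ q]. By Schur it is a nonzero multiple of the unit constraint, which commutes strictly. *)
Lemma self_braid_root h X w : simple X -> ~ invertible X -> invertible h ->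
  h ⊗ X ≅ X -> braid h h = w *: idm (h ⊗ h) :> hom _ _ -> w ^+ q = 1.
Proof.
move=> sX niX ih hX hw; have ch := stab_central_inv sX ih hX.
case: hX => f; pose g := f ∘ braid X h.
have ef : right_eigen g f w := right_eigen_braid f hw.
have [p ep] : exists p : iso (tpow h q ⊗ X) X, right_eigen g p (w ^+ q).
  elim: (q) => [|n [p ep]] /=; first by exists (lu X); apply: right_eigen_lu.
  exists (iso_trans (iso_trans f (bmap_iso (tens C) (iso_refl h) p)) (asc h (tpow h n) X)).
  by rewrite exprS; apply: right_eigen_mul.
have [u] := isoS (tpow_card_unit ch).
have el := right_eigen_lu g.
have [a aE] := simple_hom_scalar Cab (lu X) (p ∘ (u ⊗m idm X))
  (simple_iso (isoS (tens_iso1 X)) sX).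
have := right_eigen_comp u ep; rewrite aE => e1.
have e2 := right_eigenZ a el.
move: e1 e2; rewrite /right_eigen => -> /eqP; rewrite -subr_eq0 -scalerBl scaler_eq0.
rewrite subr_eq0 => /orP[/eqP//|/eqP e0]; exfalso.
have e0' := @iso_comp_eq0 _ _ _ _ _ (asc unit X h) _ e0.
pose gi := iso_trans f (braid X h).
have := @iso_comp_eq0 _ _ _ _ _ (bmap_iso (tens C) (iso_refl unit) gi) _ e0'.
rewrite -aE => p0; apply: (simple_idm_neq0 sX).
have p0' := @iso_comp_eq0 _ _ _ _ _ (bmap_iso (tens C) u (iso_refl X)) _ p0.
by rewrite -(fwdK p) p0' comp0m.
Qed.

Lemma gT_order2 : q = 2%N.
Proof.
have [h [ih nh hX]] := stab_exists sX0 niX0 (tens_dual_inv sX0).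
have ch := stab_central_inv sX0 ih hX.
have [w hw] := simple_end Cab (braid h h) (inv_tens_simple ih (inv_simple ih)).
have w1 := stab_self_braid sX0 niX0 ih hX nh hw.
have w2 := self_braid_sq ch hw; have wq := self_braid_root sX0 niX0 ih hX hw.
have [//|odd_q] := even_prime gT_prime.
by case: w1; rewrite -wq -(odd_double_half q) odd_q exprS -mul2n exprM w2 expr1n mulr1.
Qed.

Variable d : C.
Hypotheses (d_inv : invertible d) (d_neq1 : ~ (d ≅ unit)) (dX0 : d ⊗ X0 ≅ X0).

Lemma d_central : central_inv d.
Proof. exact: stab_central_inv sX0 d_inv dX0. Qed.

Lemma central_inv2 g : central_inv g -> g ≅ unit \/ g ≅ d.
Proof.
move=> cg; have [n []] := central_inv_tpow_eq d_central d_neq1 sX0 niX0 cg.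
rewrite gT_order2; case: n => [|[|//]] _ e; [by left|right].
exact: isoT e (tens_iso1r d).
Qed.

Lemma d_square : d ⊗ d ≅ unit.
Proof.
have := tpow_card_unit d_central; rewrite gT_order2 /=.
by apply: isoT; apply: tens_isom (isoR _) (isoS (tens_iso1r d)).
Qed.

(** Something nontrivial fixes [X]; it is central, and [d] is the only nontrivial central invertible
    object. *)
Lemma d_stab X : simple X -> ~ invertible X -> d ⊗ X ≅ X.
Proof.
move=> sX niX; have [h [ih nh hX]] := stab_exists sX niX (tens_dual_inv sX).
have [//|hd] := central_inv2 (stab_central_inv sX ih hX).
by apply: isoT hX; apply: tens_isom (isoS hd) (isoR X).
Qed.

Lemma d_monodromy X : simple X -> ~ invertible X -> ~ monodromy d X 1.
Proof. by move=> sX niX /(central_inv_trivial d_central sX niX). Qed.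

(** If [t] has self-braiding [w], then [w ^+ 4] is both the self-braiding of [t ⊗ t] and the
    monodromy of [t] with [t ⊗ t]. For [t ⊗ t ≅ d] centrality makes it 1, which [stab_self_braid]
    forbids. *)
Lemma d_not_square t : invertible t -> ~ (t ⊗ t ≅ d).
Proof.
move=> it td; have itt := inv_tens it it.
have ctt : central_inv (t ⊗ t) by apply: central_inv_iso d_central; apply: isoS.
have [w hw] := simple_end Cab (braid t t) (inv_tens_simple it (inv_simple it)).
have htt := braid_square hw.
have ht : monodromy t t (w * w) by rewrite /monodromy hw compZm comp1m scalerA.
have w4 : w ^+ 4 = 1.
  apply: (monodromy_uniq it (inv_simple itt) _ (monodromy_sym (proj2 ctt _ it))).
  have := monodromy_tensr ht ht; congr (monodromy _ _ _).
  by rewrite !exprS expr0 mulr1 !mulrA.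
apply: (stab_self_braid sX0 niX0 itt _ _ htt w4).
  by apply: isoT dX0; apply: tens_isom td (isoR X0).
by move=> e; apply: d_neq1; apply: isoT (isoS td) e.
Qed.

Lemma noninv_degree_eq X Y i j : simple X -> ~ invertible X -> simple Y ->
  ~ invertible Y -> P i X -> P j Y -> i = j.
Proof.
move=> sX niX sY niY PX PY.
have i1 := noninv_degree sX niX PX; have j1 := noninv_degree sY niY PY.
apply/eqP; apply: contraT => ij.
have /card_uniqP e : uniq [:: 1%g; i; j].
  by rewrite /= !inE negb_or [1%g == i]eq_sym [1%g == j]eq_sym i1 j1 ij.
by have := max_card (mem [:: 1%g; i; j]); rewrite e gT_order2.
Qed.

Lemma noninv_transitive X Y : simple X -> ~ invertible X -> simple Y ->
  ~ invertible Y -> exists g, invertible g /\ X ≅ g ⊗ Y.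
Proof.
move=> sX niX sY niY.
have [i PX] := simple_homogeneous sX; have [j PY] := simple_homogeneous sY.
have e := noninv_degree_eq sX niX sY niY PX PY; rewrite -e in PY.
exact: homogeneous_transitive sX sY PX PY.
Qed.

(** Constituents are invertible and fix [X], hence are central, that is [unit] or [d]; by
    [hom_tens_dual] each occurs with multiplicity one. *)
Lemma tens_dual_decomp X : simple X -> ~ invertible X -> is_dsum2 unit d (X ⊗ dual X).
Proof.
move=> sX niX; have X0' := simple_idm_neq0 sX; have sd := inv_simple d_inv.
have [x x0] := stab_hom_tens_dual sX d_inv (d_stab sX niX).
have c0 := coev_neq0 X0'.
have [r rc] := simple_mono Cab Css s1 c0; have [p px] := simple_mono Cab Css sd x0.
have hom0 (Y Z : C) (f : hom Y Z) : simple Y -> simple Z -> ~ (Y ≅ Z) -> f = 0.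
  by move=> sY sZ ne; apply: contrapT => f0; apply/ne/(simple_iso_of_hom Cab sY sZ f0).
have rx : r ∘ x = 0 by apply: hom0.
have pc : p ∘ coev X = 0 by apply: hom0 => // e; apply/d_neq1/isoS.
apply/dsum2P; exists (coev X), x, r, p; split=> //.
have [n [S [sS dS]]] := Css (X ⊗ dual X); have [inj [pr [h1 h2 h3]]] := dS.
rewrite -[LHS]compm1 -h3 comp_sumr; apply: eq_bigr => j _.
rewrite compA; congr (_ ∘ _).
have iS := tens_dual_inv sX (sS j) (retract_dsum j dS).
have inj0 : inj j <> 0.
  by move=> i0; apply: (simple_idm_neq0 (sS j)); rewrite -h1 i0 compm0.
have cS := stab_central_inv sX iS (hom_tens_dual_stab sX iS inj0).
have [[w]|[w]] := central_inv2 cS.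
  have [a aE] := hom_tens_dual (inj j ∘ bwd w) sX (inv_unit C) c0.
  have -> : inj j = a *: (coev X ∘ w) by rewrite -compZm -aE fwdmK.
  rewrite compmZ compDm -!compA (compA r) rc comp1m (compA p) pc comp0m compm0.
  by rewrite addr0.
have [a aE] := hom_tens_dual (inj j ∘ bwd w) sX d_inv x0.
have -> : inj j = a *: (x ∘ w) by rewrite -compZm -aE fwdmK.
by rewrite compmZ compDm -!compA (compA r) rx comp0m compm0 add0r (compA p) px comp1m.
Qed.

Lemma dual_noninv X : simple X -> ~ invertible X -> ~ invertible (dual X).
Proof.
move=> sX niX iY; apply: niX; apply: (@inv_of_unit _ _ _ (dual X)).
have [i [r ri]] := unit_retract (simple_idm_neq0 sX).
have i0 : i <> 0 by move=> i0; apply: (simple_idm_neq0 s1); rewrite -ri i0 compm0.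
exact/isoS/(simple_iso_of_hom Cab s1 (tens_inv_simple iY sX) i0).
Qed.

Hypothesis char0 : [pchar k]%R =i pred0.

(* Double counting of the character values [mu t (h ⊗ h ⊗ a)], where
   [X0 ≅ a ⊗ X0^*], produces an [h] such that [h ⊗ X0] is self-dual. *)
Lemma self_dual_exists : exists Z, [/\ simple Z, ~ invertible Z & is_dsum2 unit d (Z ⊗ Z)].
Proof.
have sY := dual_simple sX0; have niY := dual_noninv sX0 niX0.
have [a [ia aE]] := noninv_transitive sX0 niX0 sY niY.
have sa := inv_simple ia.
(* With [x], [y], [z] the monodromies of [t] with [X0], [dual X0] and [a], one has [x * y = 1] and
   [z * y = x], so [z = x * x]. This is the monodromy of [t ⊗ t ≅ unit] with [X0]. *)
have mu_a t : invertible t -> central_inv (t ⊗ t) -> monodromy t a 1.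
  move=> it ctt.
  have [x hx] := monodromy_exists it sX0; have [y hy] := monodromy_exists it sY.
  have [z hz] := monodromy_exists it sa.
  have xy : x * y = 1.
    apply: (monodromy_uniq it s1 _ (monodromy_unitr t)).
    apply: (monodromy_retract' (unit_retract (simple_idm_neq0 sX0))).
    exact: monodromy_tensr.
  have zy : z * y = x.
    apply: (monodromy_uniq it sX0 _ hx); apply: (monodromy_iso (isoS aE)).
    exact: monodromy_tensr.
  have x2 : x * x = 1.
    have [e|/d_not_square//] := central_inv2 ctt.
    apply: (monodromy_uniq (inv_unit C) sX0 _ (monodromy_unitl X0)).
    by apply: (monodromy_isol e); apply: monodromy_tensl.
  have z1 : z = 1 by rewrite -[LHS]mulr1 -{1}xy [x * y]mulrC mulrA zy x2.
  by rewrite -z1.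
have [H [rep [repI repE repU]]] := inv_reps C.
have [h ch] : exists u : H, central_inv ((rep u ⊗ rep u) ⊗ a).
  apply: contrapT => hno.
  have S0 : \sum_u \sum_t mu (rep t) ((rep u ⊗ rep u) ⊗ a) = 0.
    apply: big1 => h _; apply: (mu_sum_noncentral repI repE repU).
      by apply: inv_tens ia; apply: inv_tens.
    by move=> ch; apply: hno; exists h.
  (* By bilinearity and symmetry the square of the pairing of [t] with [u] is the pairing of [u]
     with [t ⊗ t], so orthogonality can now be used in [u]. *)
  have S1 : \sum_u \sum_t mu (rep t) ((rep u ⊗ rep u) ⊗ a) =
      \sum_t mu (rep t) a * \sum_u mu (rep u) (rep t ⊗ rep t).
    rewrite exchange_big /=; apply: eq_bigr => t _; rewrite mulr_sumr.
    apply: eq_bigr => h _.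
    have [y hy] := monodromy_exists (repI t) (inv_simple (repI h)).
    have hy' := monodromy_sym hy.
    rewrite (muE (repI h) (inv_simple (inv_tens (repI t) (repI t))) (monodromy_tensr hy' hy')).
    rewrite mulrC; apply: muE => //.
      by apply: inv_simple; apply: inv_tens ia; apply: inv_tens.
    by apply: monodromy_tensr (muP (repI t) sa); apply: monodromy_tensr.
  have S2 : \sum_t mu (rep t) a * \sum_u mu (rep u) (rep t ⊗ rep t) =
      (#|[set t | `[< central_inv (rep t ⊗ rep t) >]]| * #|H|)%:R.
    rewrite natrM -sum1_card natr_sum mulr_suml [RHS]big_mkcond /=.
    apply: eq_bigr => t _; rewrite inE; have itt := inv_tens (repI t) (repI t).
    case: asboolP => [ctt|nctt].
      by rewrite (mu_sum_central repI ctt) (muE (repI t) sa (mu_a _ (repI t) ctt)).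
    by rewrite (mu_sum_noncentral repI repE repU itt nctt) mulr0.
  (* The class of the unit shows that both factors of the count are positive. *)
  have [t0 t0E] := repE _ (inv_unit C).
  move/eqP: S0; rewrite S1 S2 ((pcharf0P k).1 char0) muln_eq0 cards_eq0 => /orP[/eqP|/eqP].
    move/setP/(_ t0); rewrite !inE => /asboolP; apply.
    apply: (central_inv_iso _ (central_inv_unit C)).
    by apply: isoT (isoS (tens_iso1 _)) (tens_isom t0E t0E).
  by move/eqP; rewrite -leqn0 leqNgt; case/negP; apply/card_gt0P; exists t0.
exists (rep h ⊗ X0); split.
- exact: inv_tens_simple.
- by move=> /(inv_of_tens (repI h)).
(* Replacing one [X0] by [a ⊗ dual X0] collects the factor [(rep h ⊗ rep h) ⊗ a], which is [unit] or
   [d] and is absorbed by the other [X0]. *)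
apply: is_dsum_iso (tens_dual_decomp sX0 niX0); apply: isoS.
apply: isoT (tens_isoACA _ _ _ _) _.
apply: isoT (tens_isom (isoR _) (tens_isom (isoR _) aE)) _.
apply: isoT (tens_isom (isoR _) (tens_isoCA _ _ _)) _.
apply: isoT (isoS (tens_isoA _ _ _)) _.
apply: isoT (isoS (tens_isoA _ _ _)) _; apply: tens_isom (isoR _).
have [e|e] := central_inv2 ch; last by apply: isoT (tens_isom e (isoR _)) dX0.
by apply: isoT (tens_isom e (isoR _)) (tens_iso1 X0).
Qed.

Variable Z : C.
Hypotheses (sZ : simple Z) (niZ : ~ invertible Z) (ZZ : is_dsum2 unit d (Z ⊗ Z)).

(** These are the simple objects centralizing both [Z] and [d]: non-invertible ones fail on [d] by
    [d_monodromy], and invertible ones centralize [d] anyway. *)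
Definition central_part X : Prop := invertible X /\ monodromy X Z 1.
Definition ising_part X : Prop := [\/ X ≅ unit, X ≅ d | X ≅ Z].

Let sd : simple d := inv_simple d_inv.

Lemma unit_retract_ZZ : retract unit (Z ⊗ Z).
Proof. exact: (retract_dsum true ZZ). Qed.

Lemma monodromy_Z_sq g a : invertible g -> monodromy g Z a -> a * a = 1.
Proof.
move=> ig ga; apply: (monodromy_uniq ig s1 _ (monodromy_unitr g)).
by apply: (monodromy_retract' unit_retract_ZZ); apply: monodromy_tensr.
Qed.

Lemma d_monodromy_Z : monodromy d Z (-1).
Proof.
have [a ha] := monodromy_exists d_inv sZ.
have /eqP := monodromy_Z_sq d_inv ha; rewrite -expr2 sqrf_eq1 => /orP[/eqP a1|/eqP <- //].
by case: (d_monodromy sZ niZ); rewrite -a1.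
Qed.

(** The monodromy with [Z] is a sign; since [d] has sign -1, multiplying by [d] corrects it. *)
Lemma inv_split g : invertible g -> exists b, central_part b /\ (g ≅ b \/ g ≅ b ⊗ d).
Proof.
move=> ig; have [a ha] := monodromy_exists ig sZ.
have /eqP := monodromy_Z_sq ig ha; rewrite -expr2 sqrf_eq1 => /orP[/eqP a1|/eqP a1].
  by exists g; split; [split=> //; rewrite -a1|left; apply: isoR].
exists (g ⊗ d); split; last first.
  right; apply: isoT (isoS (tens_iso1r g)) _; apply: isoT _ (isoS (tens_isoA _ _ _)).
  by apply: tens_isom (isoR _) (isoS d_square).
split; first exact: inv_tens.
have -> : 1 = a * -1 :> k by rewrite a1 mulrN1 opprK.
by apply: monodromy_tensl d_monodromy_Z.
Qed.

Lemma central_part_iso X Y : X ≅ Y -> central_part X -> central_part Y.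
Proof. by move=> e [iX hX]; split; [apply: inv_iso e iX|apply: monodromy_isol e hX]. Qed.

Lemma central_part_tens X Y : central_part X -> central_part Y -> central_part (X ⊗ Y).
Proof.
move=> [iX hX] [iY hY]; split; first exact: inv_tens.
by rewrite -(mulr1 1); apply: monodromy_tensl.
Qed.

Lemma central_part_inverse X Y : invertible Y -> X ⊗ Y ≅ unit -> central_part X ->
  central_part Y.
Proof.
move=> iY e [iX hX]; split=> //; rewrite -invr1.
exact: (monodromy_inverse iX iY sZ e hX).
Qed.

Lemma central_part_d X Y : central_part X -> central_part Y -> ~ (X ≅ Y ⊗ d).
Proof.
move=> [iX hX] [iY hY] e; apply: (d_monodromy sZ niZ).
have h := monodromy_tensl hY d_monodromy_Z.
have := monodromy_uniq iX sZ hX (monodromy_isol (isoS e) h).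
by rewrite mul1r => ->; apply: d_monodromy_Z.
Qed.

Lemma central_part_sub : fusion_sub (generated central_part).
Proof.
apply: generated_fusion_sub.
- exact: central_part_iso.
- by split; [apply: inv_unit|apply: monodromy_unitl].
- move=> X Y S sX sY sS cX cY rS; have cXY := central_part_tens cX cY.
  apply: central_part_iso (cXY); apply: isoS; apply: retract_simple_iso rS => //.
  by apply: inv_simple; case: cXY.
- move=> X sX cX; have [iX _] := cX.
  exact: (central_part_inverse (inv_dual iX) (inv_tens_dual iX) cX).
Qed.

Lemma ising_part_iso X Y : X ≅ Y -> ising_part X -> ising_part Y.
Proof.
move=> e [h|h|h]; [apply: Or31|apply: Or32|apply: Or33]; exact: isoT (isoS e) h.
Qed.

Lemma ising_part_simple X : ising_part X -> simple X.
Proof. by case=> e; apply: simple_iso (isoS e) _. Qed.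

(** Write [Z ≅ g ⊗ dual S]. Then [Z ⊗ Z], which contains the unit, is [g ⊗ (S ⊗ dual S)], the sum of
    [g] and [g ⊗ d]. So [g] is [unit] or [d], and both fix [dual S]. *)
Lemma dual_Z_iso S : S ≅ Z -> dual S ≅ Z.
Proof.
move=> e; have sS := simple_iso (isoS e) sZ.
have niS : ~ invertible S by move/(inv_iso e).
have sdS := dual_simple sS; have nidS := dual_noninv sS niS.
have [g [ig gE]] := noninv_transitive sZ niZ sdS nidS.
have eZZ : Z ⊗ Z ≅ g ⊗ (S ⊗ dual S).
  apply: isoT (tens_isom (isoR _) gE) _; apply: isoT (tens_isoCA _ _ _) _.
  by apply: tens_isom (isoR _) (tens_isom (isoS e) (isoR _)).
have dg := fmap_dsum (bifunctor_r (tens C) g) (tens_dual_decomp sS niS).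
have r1 : retract unit (g ⊗ (S ⊗ dual S)).
  by apply: retract_trans unit_retract_ZZ (retract_iso eZZ).
have [|[] e1] := retract_simple_dsum Cab s1 _ dg r1.
- by case; apply: inv_tens_simple.
- apply: isoT _ (isoS gE); apply: isoT (isoS (tens_iso1 _)) _.
  by apply: tens_isom (isoR _); apply: isoT e1 (tens_iso1r g).
- apply: isoT _ (isoS gE); apply: isoT (isoS (d_stab sdS nidS)) _.
  apply: tens_isom (isoR _); apply: (inv_cancel d_inv).
  apply: isoT d_square _; apply: isoT e1 _; exact: tens_isoC.
Qed.

Lemma ising_part_dual X : ising_part X -> ising_part (dual X).
Proof.
case=> e; last by apply: Or33; apply: dual_Z_iso.
  have iX := inv_iso (isoS e) (inv_unit C); apply: Or31.
  apply: isoT (isoS (tens_iso1 _)) _; apply: isoT _ (inv_tens_dual iX).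
  by apply: tens_isom (isoS e) (isoR _).
have iX := inv_iso (isoS e) d_inv; apply: Or32; apply: (inv_cancel d_inv).
apply: isoT _ (isoS d_square); apply: isoT _ (inv_tens_dual iX).
by apply: tens_isom (isoS e) (isoR _).
Qed.

Lemma ising_part_tens X Y S : simple S -> ising_part X -> ising_part Y ->
  retract S (X ⊗ Y) -> ising_part S.
Proof.
move=> sS.
have aux W : ising_part W -> retract S W -> ising_part S.
  move=> pW rS; apply: ising_part_iso (pW); apply: isoS.
  exact: (retract_simple_iso sS (ising_part_simple pW) rS).
have aux2 A B : X ≅ A -> Y ≅ B -> retract S (X ⊗ Y) -> retract S (A ⊗ B).
  by move=> eA eB rS; apply: retract_trans rS (retract_iso (tens_isom eA eB)).
have p1 : ising_part unit by apply: Or31; apply: isoR.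
have pd : ising_part d by apply: Or32; apply: isoR.
have pZ : ising_part Z by apply: Or33; apply: isoR.
have dZ := d_stab sZ niZ.
have step A B W : ising_part W -> A ⊗ B ≅ W -> X ≅ A -> Y ≅ B ->
    retract S (X ⊗ Y) -> ising_part S.
  move=> pW e eA eB /(aux2 _ _ eA eB) rS; apply: aux pW _.
  exact: retract_trans rS (retract_iso e).
(* Unit factors are disposed of here; the products of [d] and [Z] remain. *)
case=> eX; case=> eY; try exact: step (tens_iso1 _) eX eY; try exact: step (tens_iso1r _) eX eY.
- exact: step d_square eX eY.
- exact: step dZ eX eY.
- exact: step (isoT (tens_isoC _ _) dZ) eX eY.
- move=> /(aux2 _ _ eX eY) rS.
  by have [e|e] := retract_simple_dsum2 sS s1 sd ZZ rS; [apply: Or31|apply: Or32].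
Qed.

Lemma ising_part_sub : fusion_sub (generated ising_part).
Proof.
apply: generated_fusion_sub.
- exact: ising_part_iso.
- by apply: Or31; apply: isoR.
- by move=> X Y S _ _ sS pX pY; apply: ising_part_tens.
- by move=> X _; apply: ising_part_dual.
Qed.

(** A non-invertible [S] is [g ⊗ Z], and splitting [g] by [inv_split] leaves at most a factor [d],
    which [Z] absorbs. *)
Lemma tens_parts_surj S : simple S ->
  exists b c, [/\ central_part b, ising_part c & S ≅ b ⊗ c].
Proof.
move=> sS.
have inv_case g : invertible g -> exists b c, [/\ central_part b,
    c ≅ unit \/ c ≅ d & g ≅ b ⊗ c].
  move=> ig; have [b [cb [e|e]]] := inv_split ig.
    exists b, unit; split=> //; first by left; apply: isoR.
    by apply: isoT e (isoS (tens_iso1r b)).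
  by exists b, d; split=> //; right; apply: isoR.
have [/inv_case[b [c [cb pc e]]]|niS] := pselect (invertible S).
  by exists b, c; split=> //; case: pc => ec; [apply: Or31|apply: Or32].
have [g [/inv_case[b [c [cb pc e]]] gE]] := noninv_transitive sS niS sZ niZ.
exists b, Z; split=> //; first by apply: Or33; apply: isoR.
apply: isoT gE _; apply: isoT (tens_isom e (isoR Z)) _.
apply: isoT (tens_isoA _ _ _) _; apply: tens_isom (isoR b) _.
case: pc => ec; apply: isoT (tens_isom ec (isoR Z)) _; first exact: tens_iso1.
exact: d_stab.
Qed.

(** Invertibility tells [Z] from [unit] and [d], and the sign of the monodromy with [Z] tells [b]
    from [b' ⊗ d]. If both second factors are [Z], the quotient of [b] by [b'] fixes [Z], so it is
    [unit] or [d]; being in the central part, it is not [d]. *)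
Lemma tens_parts_inj b b' c c' : central_part b -> central_part b' ->
  ising_part c -> ising_part c' -> b ⊗ c ≅ b' ⊗ c' -> b ≅ b' /\ c ≅ c'.
Proof.
move=> cb cb' pc pc' e; have [ib _] := cb; have [ib' _] := cb'.
have nZ x y y' : invertible x -> invertible y -> y' ≅ Z -> ~ (b ⊗ y' ≅ x ⊗ y) /\
    ~ (b' ⊗ y' ≅ x ⊗ y).
  move=> ix iy ey; split=> exy; apply: niZ; apply: inv_iso ey _.
    by apply: (inv_of_tens ib); apply: inv_iso (isoS exy) (inv_tens ix iy).
  by apply: (inv_of_tens ib'); apply: inv_iso (isoS exy) (inv_tens ix iy).
have i1 x : x ≅ unit -> invertible x by move=> ex; apply: inv_iso (isoS ex) (inv_unit C).
have id x : x ≅ d -> invertible x by move=> ex; apply: inv_iso (isoS ex) d_inv.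
have r1 x y : y ≅ unit -> x ⊗ y ≅ x.
  by move=> ey; apply: isoT (tens_isom (isoR x) ey) (tens_iso1r x).
have rd x y : y ≅ d -> x ⊗ y ≅ x ⊗ d by apply: tens_isom (isoR x).
case: pc => ec; case: pc' => ec'.
- split; last exact: isoT ec (isoS ec').
  exact: isoT (isoS (r1 b c ec)) (isoT e (r1 b' c' ec')).
- case: (central_part_d cb cb').
  exact: isoT (isoS (r1 b c ec)) (isoT e (rd b' c' ec')).
- by case: (nZ b c c' ib (i1 c ec) ec') => _ []; apply: isoS.
- case: (central_part_d cb' cb).
  exact: isoT (isoS (r1 b' c' ec')) (isoT (isoS e) (rd b c ec)).
- split; last exact: isoT ec (isoS ec').
  apply: (inv_cancel d_inv).
  apply: isoT (tens_isoC _ _) _; apply: isoT _ (tens_isoC _ _).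
  exact: isoT (isoS (rd b c ec)) (isoT e (rd b' c' ec')).
- by case: (nZ b c c' ib (id c ec) ec') => _ []; apply: isoS.
- by case: (nZ b' c' c ib' (i1 c' ec') ec).
- by case: (nZ b' c' c ib' (id c' ec') ec).
- split; last exact: isoT ec (isoS ec').
  have [h [ih e1 e2]] := inv_inverse ib'.
  have ch := central_part_inverse ih e1 cb'.
  have hbZ : (h ⊗ b) ⊗ Z ≅ Z.
    apply: isoT (tens_isoA _ _ _) _; apply: isoT _ (invK Z e2).
    apply: tens_isom (isoR h) _; apply: isoT (tens_isom (isoR b) (isoS ec)) _.
    exact: isoT e (tens_isom (isoR b') ec').
  have ihb := inv_tens ih ib.
  have [e3|e3] := central_inv2 (stab_central_inv sZ ihb hbZ).
    apply: (inv_cancel ih); apply: isoT e3 (isoS e2).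
  case: (central_part_d (central_part_tens ch cb) _ (isoT e3 (isoS (tens_iso1 d)))).
  by split; [apply: inv_unit|apply: monodromy_unitl].
Qed.

Lemma parts_monodromy X Y : generated central_part X -> generated ising_part Y ->
  monodromy X Y 1.
Proof.
move=> gX gY; have [n [U [sU dU]]] := Css X; have [m [V [sV dV]]] := Css Y.
apply: (monodromy_dsum dV) => j; apply: monodromy_sym; apply: (monodromy_dsum dU) => i.
apply: monodromy_sym.
have [iU hU] : central_part (U i) by apply: gX => //; apply: retract_dsum dU.
have : ising_part (V j) by apply: gY => //; apply: retract_dsum dV.
case=> e; apply: (monodromy_iso (isoS e)) => //; first exact: monodromy_unitr.
by apply: monodromy_sym; apply: (proj2 d_central).
Qed.

End Graded.
(** * The factorization *)

Section Factorization.
Variables (k : closedFieldType) (C : bfusion k) (QB QI : C -> Prop).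
Variable pivot : forall X : C, iso X (dual (dual X)).
Hypothesis pivotP : is_spherical pivot.
Hypothesis Cnd : nondegenerate C.
Hypotheses (subB : fusion_sub (generated QB)) (subI : fusion_sub (generated QI)).
Hypotheses (QB_iso : forall X Y, X ≅ Y -> QB X -> QB Y).
Hypotheses (QI_iso : forall X Y, X ≅ Y -> QI X -> QI Y).
Hypothesis QB_inv : forall X, QB X -> invertible X.
Hypothesis QI_simple : forall X, QI X -> simple X.
Hypothesis Q_surj : forall S, simple S -> exists b c, [/\ QB b, QI c & S ≅ b ⊗ c].
Hypothesis Q_inj : forall b b' c c', QB b -> QB b' -> QI c -> QI c' ->
  b ⊗ c ≅ b' ⊗ c' -> b ≅ b' /\ c ≅ c'.
Hypothesis Q_monodromy : forall X Y, generated QB X -> generated QI Y -> monodromy X Y 1.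
Local Notation unit := (unit_ : C).
Let Cab : abelian C := fusion_abelian C.
Let Css : semisimple C := @fusion_semisimple _ C.

Local Notation B := (sub_bfusion subB pivot).
Local Notation I := (sub_bfusion subI pivot).

Definition subB_obj (X : C) (bX : QB X) : B :=
  exist _ X (generated_of_simple (@QB_iso X) (inv_simple (QB_inv bX)) bX).
Definition subI_obj (X : C) (cX : QI X) : I :=
  exist _ X (generated_of_simple (@QI_iso X) (QI_simple cX) cX).

Lemma subB_simple (X : B) : simple X -> QB (sval X).
Proof. by move=> sX; apply: (generated_simple (proj2_sig X) ((sub_simple subB X).1 sX)). Qed.
Lemma subI_simple (X : I) : simple X -> QI (sval X).
Proof. by move=> sX; apply: (generated_simple (proj2_sig X) ((sub_simple subI X).1 sX)). Qed.

Lemma subB_pointed : pointed B.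
Proof.
move=> X sX; have iX := QB_inv (subB_simple sX).
apply: (@inv_of_unit _ B X (dual X)); apply/sub_isom; exact: inv_tens_dual iX.
Qed.

(** A simple object central in [B] also centralizes [I], hence every product [b ⊗ c], and these
    exhaust the simple objects of the non-degenerate [C]. *)
Lemma subB_modular : modular B.
Proof.
split; last exact: sub_spherical pivotP.
move=> X cX; have [n [S [sS dS]]] := @fusion_semisimple _ B X.
exists n; apply: (is_dsum_eq _ dS) => i; apply/sub_isom.
have bS := subB_simple (sS i); have iS := QB_inv bS.
apply: (central_simple_unit Cnd (inv_simple iS)) => Y sY.
have [b [c [Qb Qc e]]] := Q_surj sY.
apply: (monodromy_iso (isoS e)); rewrite -(mulr1 1); apply: monodromy_tensr.
  apply: monodromy_sym; have [f [r rf]] := retract_dsum i dS.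
  apply: (@monodromy_retract k C b (sval X) (sval (S i)) 1 f r rf).
  apply: monodromy_sym; rewrite /monodromy scale1r; exact: (cX (subB_obj Qb)).
apply: Q_monodromy (proj2_sig (S i)) _; exact: (proj2_sig (subI_obj Qc)).
Qed.

Definition parts_tens : bifunctor B I C :=
  @Bifunctor k B I C (fun X Y => sval X ⊗ sval Y)
    (fun X X' Y Y' f g =>
       @bmap k C C C (tens C) (sval X) (sval X') (sval Y) (sval Y') f g)
    (fun X X' Y Y' g => @bmap_linearl _ _ _ _ (tens C) _ _ _ _ g)
    (fun X X' Y Y' f => @bmap_linearr _ _ _ _ (tens C) _ _ _ _ f)
    (fun X Y => @bmap1 _ _ _ _ (tens C) _ _)
    (fun X X' X'' Y Y' Y'' f' f g' g =>
       @bmap_comp _ _ _ _ (tens C) _ _ _ _ _ _ f' f g' g).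

Lemma parts_tens_deligne : is_deligne parts_tens.
Proof.
apply: deligne_criterion => //.
- exact: fusion_abelian B.
- exact: (@fusion_semisimple _ B).
- exact: fusion_abelian I.
- exact: (@fusion_semisimple _ I).
- move=> b c sb sc.
  exact: (inv_tens_simple (QB_inv (subB_simple sb)) (QI_simple (subI_simple sc))).
- move=> b b' c c' sb sb' sc sc' e.
  have [e1 e2] := Q_inj (subB_simple sb) (subB_simple sb') (subI_simple sc)
    (subI_simple sc') e.
  by split; apply/sub_isom.
- move=> S sS; have [b [c [Qb Qc e]]] := Q_surj sS.
  exists (subB_obj Qb), (subI_obj Qc); split=> //.
    exact: (sub_simple subB (subB_obj Qb)).2 (inv_simple (QB_inv Qb)).
  exact: (sub_simple subI (subI_obj Qc)).2 (QI_simple Qc).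
Qed.

Lemma parts_deligne_product : deligne_product B I C.
Proof.
exists parts_tens; split; first exact: parts_tens_deligne.
exists (fun X Y X' Y' => swap (sval X) (sval Y) (sval X') (sval Y')), (iso_sym (lu unit)).
split; first split.
- by move=> *; apply: swap_nat.
- by move=> *; apply: swap_asc.
- by move=> *; apply: swap_lu.
- by move=> *; apply: swap_ru.
- move=> X Y X' Y'; apply: swap_braid.
  exact: Q_monodromy (proj2_sig X) (proj2_sig Y').
Qed.

End Factorization.

Lemma braided_equivalent_refl (k : fieldType) (C : bfusion k) : braided_equivalent C C.
Proof.
pose F : functor C C := @Functor k C C id (fun X Y f => f) (fun X Y a f g => erefl)
  (fun X => erefl) (fun X Y Z g f => erefl).
exists F, (fun X Y => iso_refl (X ⊗ Y)), (iso_refl unit_); split.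
- by split=> [*|*|*|*] /=; rewrite ?(tensm1, compm1, comp1m).
- by move=> X Y /=; rewrite compm1 comp1m.
- by move=> X Y; exists id.
- by move=> Y; exists Y; apply: isoR.
Qed.

(** * The Ising factor *)

Section IsingPart.
Variables (k : closedFieldType) (C : bfusion k) (d Z : C).
Variable pivot : forall X : C, iso X (dual (dual X)).
Hypothesis sub : fusion_sub (generated (ising_part d Z)).
Local Notation unit := (unit_ : C).
Hypotheses (d_inv : invertible d) (d_neq1 : ~ (d ≅ unit)) (dd : d ⊗ d ≅ unit).
Hypotheses (sZ : simple Z) (niZ : ~ invertible Z) (ZZ : is_dsum2 unit d (Z ⊗ Z)).
Local Notation I := (sub_bfusion sub pivot).

Lemma ising_part_ising : ising I.
Proof.
have sd := inv_simple d_inv.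
have gd : generated (ising_part d Z) d.
  apply: (generated_of_simple (@ising_part_iso _ _ _ _ _) sd).
  by apply: Or32; apply: isoR.
have gZ : generated (ising_part d Z) Z.
  apply: (generated_of_simple (@ising_part_iso _ _ _ _ _) sZ).
  by apply: Or33; apply: isoR.
pose dI : I := exist _ d gd; pose ZI : I := exist _ Z gZ.
have dI_inv : invertible dI by apply: (@inv_of_unit _ I dI dI); apply/sub_isom.
have niZI : ~ invertible ZI by move/sub_invertibleW.
have sZI : simple ZI := (sub_simple sub ZI).2 sZ.
have cases (Y : I) : simple Y -> [\/ Y ≅ unit_, Y ≅ dI | Y ≅ ZI].
  move=> sY0; have sY := (sub_simple sub Y).1 sY0.
  by case: (generated_simple (proj2_sig Y) sY) => e; [apply: Or31|apply: Or32|apply: Or33];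
    apply/sub_isom.
split; first by move=> pt; apply: niZI; apply: pt.
exists dI, ZI; split; last first.
- apply/dsum2P; exact: ((dsum2P _ _ _).1 ZZ).
- split=> // Y sY niY; case: (cases Y sY) => // e; case: niY.
    exact: inv_iso (isoS e) (inv_unit I).
  exact: inv_iso (isoS e) dI_inv.
- split=> //; first by move/sub_isom.
  move=> Y iY; case: (cases Y (inv_simple iY)) => e; [by left|by right|].
  by case: niZI; apply: inv_iso e iY.
Qed.

End IsingPart.

(** Full faithfulness identifies endomorphisms in [D] and [C], so a simple object of trivial degree
    comes from a simple, hence invertible, object of [D]; the monoidal structure of [F] carries over
    its inverse. *)
Lemma extension_trivial_component (k : closedFieldType) (gT : finGroupType)
    (C D : fusion k) : pointed D -> extension_of gT C D ->
  exists P : gT -> C -> Prop, grading P /\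
    forall X, simple X -> P 1%g X -> invertible X.
Proof.
move=> Dpt [P [[Pgr _] [F [J [J0 [_ ff FP]]]]]]; exists P; split=> // X sX /FP[X' [w]].
have Cab := fusion_abelian C; have Dss := @fusion_semisimple _ D.
have sFX : simple (F X') by apply: simple_iso sX; constructor; apply: iso_sym.
have sX' : simple X'.
  apply: (simple_of_end Dss) => [X0|f].
    by apply: (simple_idm_neq0 sFX); rewrite -fmap1 X0 fmap0.
  have [a aE] := simple_end Cab (fmap F f) sFX; exists a.
  by apply: (bij_inj (ff X' X')); rewrite aE fmapZ fmap1.
have [Y [h1 h2]] := Dpt _ sX'; exists (F Y).
have uF : F unit_ ≅ unit_ by constructor; apply: iso_sym.
have JF A A' : F A ⊗ F A' ≅ F (A ⊗ A') by constructor; apply: J.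
have XF : X ≅ F X' by constructor; apply: iso_sym.
split.
  apply: isoT (bmap_isom (tens C) XF (isoR _)) _; apply: isoT (JF _ _) _.
  exact: isoT (fmap_isom F h1) uF.
apply: isoT (bmap_isom (tens C) (isoR _) XF) _; apply: isoT (JF _ _) _.
exact: isoT (fmap_isom F h2) uF.
Qed.

Theorem theorem3p4 (k : closedFieldType) (char0 : [pchar k]%R =i pred0)
    (q : nat) (q_prime : prime q) (C : bfusion k) (D : fusion k)
    (D_pointed : pointed D) (C_ext : extension_of 'Z_q C D)
    (C_modular : modular C) :
  pointed C \/
  exists B I E : bfusion k,
    [/\ pointed B, modular B, ising I, deligne_product B I E
      & braided_equivalent C E].
Proof.
have [ptC|nptC] := pselect (pointed C); [by left|right].
have [X0 [sX0 niX0]] : exists X : C, simple X /\ ~ invertible X.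
  apply: contrapT => hno; apply: nptC => X sX.
  by apply: contrapT => niX; apply: hno; exists X.
have [Cnd [a aP]] := C_modular.
have [P [Pgr P1]] := extension_trivial_component D_pointed C_ext.
(* ['Z_q] is an ordinal type forced to have at least two elements, so its cardinal is [q] only for
   [q > 1]. *)
have card_q : prime #|'Z_q| by rewrite card_ord Zp_cast // prime_gt1.
have [d [d_inv nd dX0]] := stab_exists sX0 niX0 (tens_dual_inv Pgr P1 sX0).
have [Z [sZ niZ ZZ]] :=
  self_dual_exists Pgr card_q P1 Cnd sX0 niX0 d_inv nd dX0 char0.
have subB := central_part_sub sZ.
have subI := ising_part_sub Pgr card_q P1 Cnd sX0 niX0 d_inv nd dX0 sZ niZ ZZ.
have dd := d_square Pgr card_q P1 Cnd sX0 niX0 d_inv dX0.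
(* The product is realized on [C] itself, so the braided equivalence is the identity; the spherical
   structure [a] also supplies the right duals of the two factors. *)
exists (sub_bfusion subB a), (sub_bfusion subI a), C.
have iB := @central_part_iso _ _ Z; have iI := @ising_part_iso _ _ d Z.
have invB (X : C) : central_part Z X -> invertible X by case.
have sI := @ising_part_simple _ _ d d_inv Z sZ.
have surj := tens_parts_surj Pgr card_q P1 Cnd sX0 niX0 d_inv nd dX0 sZ niZ ZZ.
have inj := tens_parts_inj Pgr card_q P1 Cnd sX0 niX0 d_inv nd dX0 sZ niZ ZZ.
have mon := @parts_monodromy _ _ _ sX0 d d_inv dX0 Z.
split.
- exact: subB_pointed invB.
- exact: (subB_modular aP Cnd subB subI iB iI invB sI surj mon).
- exact: (ising_part_ising a subI d_inv nd dd sZ niZ ZZ).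
- exact: (parts_deligne_product a subB subI iB iI invB sI surj inj mon).
- exact: braided_equivalent_refl.
Qed.
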